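(* Assume $\operatorname{char}K\neq2$. The dimensions over $K$ of the Hochschild cohomology spaces of $A$ are $$\dim \mathrm{HH}^{4k+i}(A)=\begin{cases}2k+3 & i=0,\ k>0,\\ 2k+3 & i=1,\ k\ge0,\\ 2k+3 & i=2,\ k\ge0,\\ 2k+4 & i=3,\ k\ge0,\end{cases}$$ and the set $\{e_1+e_2,\ \varepsilon,\ \alpha\beta+\beta\alpha,\ \varepsilon^2,\ \beta\alpha\beta\alpha\}$ is a $K$-basis of $\mathrm{HH}^0(A)$.
   Context: Let $K$ be a field and let $\mathcal Q$ be the quiver with two vertices $1,2$ and three arrows: a loop $\varepsilon:1\to 1$, an arrow $\alpha:1\to 2$ and an arrow $\beta:2\to 1$. Paths are read from left to right. Let $A=K\mathcal Q/I$, where $I$ is the ideal generated by the relations $\varepsilon\alpha=0$, $\beta\varepsilon=0$, $(\alpha\beta)^2=\varepsilon^2$. Let $e_i$ be the trivial path at vertex $i$. Let $A^e=A^{op}\otimes_K A$ be the enveloping algebra. The Hochschild cohomology is $\mathrm{HH}^n(A)=\operatorname{Ext}^n_{A^e}(A,A)$, and $\mathrm{HH}^0(A)$ is identified with the center $Z(A)$ of $A$. *)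

(* Defs.v *)
From HB Require Import structures.
From mathcomp Require Import all_boot all_order all_algebra finmap.
From mathcomp.multinomials Require Import monalg.
From mathcomp Require boolp.

Set Implicit Arguments.
Unset Strict Implicit.
Unset Printing Implicit Defensive.

Import GRing.Theory.
Local Open Scope ring_scope.
Local Open Scope quotient_scope.

Local Notation "`[< P >]" := (boolp.asbool P) : bool_scope.

Record submodule (R : pzRingType) (V : lmodType R) := Submodule {
  smem :> V -> Prop;
  smem0 : smem 0;
  smemP : forall a u v, smem u -> smem v -> smem (a *: u + v) }.

Section SubmoduleTheory.
Variables (R : pzRingType) (V : lmodType R) (S : submodule V).

Lemma smemD u v : S u -> S v -> S (u + v).
Proof. by move=> Su Sv; rewrite -[u]scale1r; apply: smemP. Qed.

Lemma smemZ a u : S u -> S (a *: u).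
Proof. by move=> Su; rewrite -[_ *: _]addr0; apply: smemP => //; apply: smem0. Qed.

Lemma smemN u : S u -> S (- u).
Proof. by move=> Su; rewrite -scaleN1r; apply: smemZ. Qed.

Lemma smemB u v : S u -> S v -> S (u - v).
Proof. by move=> Su Sv; apply: smemD => //; apply: smemN. Qed.

End SubmoduleTheory.

Definition sub_pred (R : pzRingType) (V : lmodType R) (S : submodule V) :
  pred V := fun v => `[< S v >].

Record submod (R : pzRingType) (V : lmodType R) (S : submodule V) := Submod {
  submod_val :> V;
  submod_valP : sub_pred S submod_val }.

Section SubmodInst.
Variables (R : pzRingType) (V : lmodType R) (S : submodule V).

HB.instance Definition _ := [isSub for @submod_val R V S].
HB.instance Definition _ := [Choice of submod S by <:].

Lemma sub_pred_closed : GRing.subsemimod_closed (sub_pred S).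
Proof.
split=> [|a u /boolp.asboolP Su]; last by apply/boolp.asboolP/smemZ.
split=> [|u v /boolp.asboolP Su /boolp.asboolP Sv]; apply/boolp.asboolP.
  exact: smem0.
exact: smemD.
Qed.

HB.instance Definition _ :=
  GRing.SubChoice_isSubLmodule.Build R V (sub_pred S) (submod S) sub_pred_closed.

Lemma submodP (v : submod S) : S (val v).
Proof. by apply/boolp.asboolP; apply: (valP v). Qed.

Definition to_submod (v : V) (Sv : S v) : submod S :=
  Submod (introT (boolp.asboolP _) Sv).

End SubmodInst.

Section LinearSubmodules.
Variables (R : pzRingType) (U V : lmodType R) (f : {linear U -> V}).

Fact ker_linear a (u v : U) : f u = 0 -> f v = 0 -> f (a *: u + v) = 0.
Proof. by move=> fu fv; rewrite linearP fu fv scaler0 addr0. Qed.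
Definition ker_sub : submodule U := Submodule (linear0 f) ker_linear.

Fact image0 : exists u, f u = 0.
Proof. by exists 0; apply: linear0. Qed.
Fact image_linear a (v w : V) :
  (exists u, f u = v) -> (exists u, f u = w) -> exists u, f u = a *: v + w.
Proof. by move=> [u <-] [u' <-]; exists (a *: u + u'); rewrite linearP. Qed.
Definition im_sub : submodule V := Submodule image0 image_linear.

Variable S : submodule V.
Fact preimage0 : S (f 0).
Proof. by rewrite linear0; apply: smem0. Qed.
Fact preimage_linear a (u v : U) : S (f u) -> S (f v) -> S (f (a *: u + v)).
Proof. by move=> Su Sv; rewrite linearP; apply: smemP. Qed.
Definition preimage : submodule U := Submodule preimage0 preimage_linear.

End LinearSubmodules.

Section Quotient.
Variables (R : pzRingType) (V : lmodType R) (S : submodule V).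

Definition quot_equiv (x y : V) := `[< S (x - y) >].

Lemma quot_equiv_is_equiv : equiv_class_of quot_equiv.
Proof.
split=> [x|x y|y x z]; rewrite /quot_equiv.
- by apply/boolp.asboolP; rewrite subrr; apply: smem0.
- by apply/boolp.asboolP/boolp.asboolP => /smemN; rewrite opprB.
- move=> /boolp.asboolP Sxy /boolp.asboolP Syz; apply/boolp.asboolP.
  by rewrite -[x](subrK y) -addrA; apply: smemD.
Qed.

Canonical quot_equiv_equiv := EquivRelPack quot_equiv_is_equiv.
Canonical quot_equiv_encModRel := defaultEncModRel quot_equiv.

Definition quotmod : Type := {eq_quot quot_equiv}.

HB.instance Definition _ : EqQuotient V quot_equiv quotmod :=
  EqQuotient.on quotmod.
HB.instance Definition _ := Choice.on quotmod.

Lemma quotmodP (x y : V) : \pi_quotmod x = \pi_quotmod y <-> S (x - y).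
Proof.
split=> [/eqP|Sxy]; first by rewrite piE => /boolp.asboolP.
by apply/eqP; rewrite piE; apply/boolp.asboolP.
Qed.

Lemma quotmod_ind (P : quotmod -> Prop) :
  (forall x, P (\pi_quotmod x)) -> forall q, P q.
Proof. by move=> Ppi q; rewrite -[q]reprK. Qed.

Lemma repr_pi (x : V) : S (repr (\pi_quotmod x) - x).
Proof. by apply/quotmodP; rewrite reprK. Qed.

Definition quot_add (x y : quotmod) : quotmod := \pi_quotmod (repr x + repr y).
Definition quot_opp (x : quotmod) : quotmod := \pi_quotmod (- repr x).
Definition quot_scale (a : R) (x : quotmod) : quotmod := \pi_quotmod (a *: repr x).

Lemma quot_addE (x y : V) :
  quot_add (\pi_quotmod x) (\pi_quotmod y) = \pi_quotmod (x + y).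
Proof. by apply/quotmodP; rewrite opprD addrACA; apply: smemD; apply: repr_pi. Qed.

Lemma quot_oppE (x : V) : quot_opp (\pi_quotmod x) = \pi_quotmod (- x).
Proof. by apply/quotmodP; rewrite -opprD; apply/smemN/repr_pi. Qed.

Lemma quot_scaleE a (x : V) : quot_scale a (\pi_quotmod x) = \pi_quotmod (a *: x).
Proof. by apply/quotmodP; rewrite -scalerBr; apply/smemZ/repr_pi. Qed.

Lemma quot_addA : associative quot_add.
Proof.
elim/quotmod_ind=> x; elim/quotmod_ind=> y; elim/quotmod_ind=> z.
by rewrite !quot_addE addrA.
Qed.
Lemma quot_addC : commutative quot_add.
Proof. by elim/quotmod_ind=> x; elim/quotmod_ind=> y; rewrite !quot_addE addrC. Qed.
Lemma quot_add0 : left_id (\pi_quotmod 0) quot_add.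
Proof. by elim/quotmod_ind=> x; rewrite quot_addE add0r. Qed.
Lemma quot_addN : left_inverse (\pi_quotmod 0) quot_opp quot_add.
Proof. by elim/quotmod_ind=> x; rewrite quot_oppE quot_addE addNr. Qed.

HB.instance Definition _ :=
  GRing.isZmodule.Build quotmod quot_addA quot_addC quot_add0 quot_addN.

Lemma quot_scaleA a b v : quot_scale a (quot_scale b v) = quot_scale (a * b) v.
Proof. by elim/quotmod_ind: v => x; rewrite !quot_scaleE scalerA. Qed.
Lemma quot_scale1 : left_id 1 quot_scale.
Proof. by elim/quotmod_ind=> x; rewrite quot_scaleE scale1r. Qed.
Lemma quot_scaleDr : right_distributive quot_scale +%R.
Proof.
move=> a; elim/quotmod_ind=> x; elim/quotmod_ind=> y.
by rewrite [_ + _]quot_addE !quot_scaleE [RHS]quot_addE scalerDr.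
Qed.
Lemma quot_scaleDl v : {morph quot_scale^~ v : a b / a + b}.
Proof.
by move=> a b; elim/quotmod_ind: v => x; rewrite !quot_scaleE [RHS]quot_addE scalerDl.
Qed.

HB.instance Definition _ := GRing.Zmodule_isLmodule.Build R quotmod
  quot_scaleA quot_scale1 quot_scaleDr quot_scaleDl.

Definition quot_proj (x : V) : quotmod := \pi_quotmod x.

Lemma quot_proj_linear : linear quot_proj.
Proof.
by move=> a x y; rewrite /quot_proj -quot_addE -quot_scaleE.
Qed.
HB.instance Definition _ :=
  GRing.isLinear.Build R V quotmod *:%R quot_proj quot_proj_linear.

Lemma quot_projP (x : V) : quot_proj x = 0 <-> S x.
Proof. by rewrite -[x in S x]subr0 -quotmodP. Qed.

Lemma quot_proj_surj (y : quotmod) : exists x, quot_proj x = y.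
Proof. by exists (repr y); apply: reprK. Qed.

End Quotient.

Section FreeModule.
Variables (R : pzRingType) (X : choiceType).

(* The Zmodule of {malg R[X]} (finitely supported functions X -> R); the
   library makes it a module only over nonzero rings. *)
Definition freemod : Type := {malg R[X]}.
HB.instance Definition _ := GRing.Zmodule.on freemod.

Definition fm_scale (a : R) (g : freemod) : freemod :=
  \sum_(x <- msupp g) << a * mcoeff x g *g x >>.

Lemma fm_scaleE a g x : mcoeff x (fm_scale a g) = a * mcoeff x g.
Proof.
rewrite {2}[g]monalgE !raddf_sum mulr_sumr.
by apply/eq_bigr=> /= i _; rewrite !mcoeffU mulrnAr.
Qed.

Lemma fm_scaleA a b g : fm_scale a (fm_scale b g) = fm_scale (a * b) g.
Proof. by apply/malgP=> x; rewrite !fm_scaleE mulrA. Qed.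
Lemma fm_scale1 : left_id 1 fm_scale.
Proof. by move=> g; apply/malgP=> x; rewrite fm_scaleE mul1r. Qed.
Lemma fm_scaleDr : right_distributive fm_scale +%R.
Proof. by move=> a g h; apply/malgP=> x; rewrite !(mcoeffD, fm_scaleE) mulrDr. Qed.
Lemma fm_scaleDl g : {morph fm_scale^~ g : a b / a + b}.
Proof. by move=> a b; apply/malgP=> x; rewrite !(mcoeffD, fm_scaleE) mulrDl. Qed.

HB.instance Definition _ := GRing.Zmodule_isLmodule.Build R freemod
  fm_scaleA fm_scale1 fm_scaleDr fm_scaleDl.

Definition fm_base (x : X) : freemod := << 1 *g x >>.

Lemma fm_baseE x y : mcoeff y (fm_base x) = (x == y)%:R.
Proof. exact: mcoeffU. Qed.

Lemma freemodE (g : freemod) :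
  g = \sum_(x <- msupp g) mcoeff x g *: fm_base x.
Proof.
rewrite [LHS]monalgE; apply: eq_bigr => x _; apply/malgP => y.
by rewrite fm_scaleE fm_baseE mcoeffU mulr_natr.
Qed.

Section Lift.
Variables (V : lmodType R) (f : X -> V).

Definition fm_lift (g : freemod) : V := \sum_(x <- msupp g) mcoeff x g *: f x.

Lemma fm_liftEw (d : {fset X}) (g : freemod) : (msupp g `<=` d)%fset ->
  fm_lift g = \sum_(x <- d) mcoeff x g *: f x.
Proof.
move=> sgd; rewrite /fm_lift (big_fset_incl _ sgd) //= => x _ /mcoeff_outdom ->.
by rewrite scale0r.
Qed.

Lemma fm_lift_linear : linear fm_lift.
Proof.
move=> a g h; pose d := (msupp g `|` msupp h `|` msupp (a *: g + h)%R)%fset.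
rewrite (@fm_liftEw d) ?(@fm_liftEw d g) ?(@fm_liftEw d h).
- rewrite scaler_sumr -big_split /=; apply: eq_bigr => x _.
  by rewrite mcoeffD fm_scaleE scalerDl scalerA.
- by rewrite /d fsubsetU // fsubsetUr.
- by rewrite /d -fsetUA fsubsetUl.
- by rewrite /d fsubsetUr.
Qed.
HB.instance Definition _ :=
  GRing.isLinear.Build R freemod V *:%R fm_lift fm_lift_linear.

Lemma fm_lift_base x : fm_lift (fm_base x) = f x.
Proof.
rewrite (@fm_liftEw [fset x]%fset) ?msuppU_le // big_seq_fset1 fm_baseE eqxx.
by rewrite scale1r.
Qed.

End Lift.

Lemma freemod_ext (V : lmodType R) (f g : {linear freemod -> V}) :
  (forall x, f (fm_base x) = g (fm_base x)) -> f =1 g.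
Proof.
move=> efg h; rewrite [h]freemodE !linear_sum; apply: eq_bigr => x _.
by rewrite !linearZ /= efg.
Qed.

End FreeModule.

(* Associative unital algebras. The library's algType is not used because it
   excludes the zero algebra. *)

Record kalg (K : fieldType) := KAlg {
  ka_mod : lmodType K;
  ka_one : ka_mod;
  ka_mul : ka_mod -> ka_mod -> ka_mod;
  ka_mulA : associative ka_mul;
  ka_mul1 : left_id ka_one ka_mul;
  ka_mulr1 : right_id ka_one ka_mul;
  ka_mulDl : left_distributive ka_mul +%R;
  ka_mulDr : right_distributive ka_mul +%R;
  ka_scalerAl : forall c x y, c *: ka_mul x y = ka_mul (c *: x) y;
  ka_scalerAr : forall c x y, c *: ka_mul x y = ka_mul x (c *: y) }.

Definition ka_sort (K : fieldType) (A : kalg K) : Type := ka_mod A.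
Coercion ka_sort : kalg >-> Sortclass.

Section KAlgInst.
Variables (K : fieldType) (A : kalg K).

HB.instance Definition _ := GRing.Lmodule.copy A (ka_mod A).
HB.instance Definition _ := GRing.Zmodule_isPzRing.Build A
  (@ka_mulA K A) (@ka_mul1 K A) (@ka_mulr1 K A) (@ka_mulDl K A) (@ka_mulDr K A).

Lemma kscalerAl (c : K) (x y : A) : c *: (x * y) = (c *: x) * y.
Proof. exact: ka_scalerAl. Qed.
Lemma kscalerAr (c : K) (x y : A) : c *: (x * y) = x * (c *: y).
Proof. exact: ka_scalerAr. Qed.

Definition opposite : kalg K :=
  @KAlg K A 1 (fun x y => y * x)
    (fun x y z => esym (mulrA z y x)) (@mulr1 A) (@mul1r A)
    (fun x y z => mulrDr z x y) (fun x y z => mulrDl y z x)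
    (fun c x y => kscalerAr c y x) (fun c x y => kscalerAl c y x).

End KAlgInst.

Record ideal (K : fieldType) (A : kalg K) := Ideal {
  ideal_sub :> submodule A;
  idealMl : forall a x : A, ideal_sub x -> ideal_sub (a * x);
  idealMr : forall a x : A, ideal_sub x -> ideal_sub (x * a) }.

Section GeneratedIdeal.
Variables (K : fieldType) (A : kalg K) (X : A -> Prop).

Definition gen_mem (x : A) :=
  forall J : ideal A, (forall y, X y -> J y) -> J x.

Fact gen_mem0 : gen_mem 0.
Proof. by move=> J _; apply: smem0. Qed.
Fact gen_mem_linear c (x y : A) : gen_mem x -> gen_mem y -> gen_mem (c *: x + y).
Proof. by move=> gx gy J sXJ; apply: smemP; [apply: gx | apply: gy]. Qed.
Definition gen_sub : submodule A := Submodule gen_mem0 gen_mem_linear.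

Fact gen_memMl (a x : A) : gen_mem x -> gen_mem (a * x).
Proof. by move=> gx J sXJ; apply: idealMl; apply: gx. Qed.
Fact gen_memMr (a x : A) : gen_mem x -> gen_mem (x * a).
Proof. by move=> gx J sXJ; apply: idealMr; apply: gx. Qed.
Definition gen_ideal : ideal A := @Ideal K A gen_sub gen_memMl gen_memMr.

End GeneratedIdeal.

Section QuotientAlgebra.
Variables (K : fieldType) (A : kalg K) (I : ideal A).

Local Notation pi := (quot_proj I : A -> quotmod I).

Definition qa_mul (x y : quotmod I) : quotmod I := pi (repr x * repr y).

Lemma qa_mulE (x y : A) : qa_mul (pi x) (pi y) = pi (x * y).
Proof.
apply/quotmodP. set x' := repr _; set y' := repr _.
have -> : x' * y' - x * y = x' * (y' - y) + (x' - x) * y.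
  by rewrite mulrBr mulrBl addrA subrK.
by apply: smemD; [apply: idealMl | apply: idealMr]; apply: repr_pi.
Qed.

Let piD (x y : A) : pi x + pi y = pi (x + y).
Proof. by rewrite -linearD. Qed.
Let piZ c (x : A) : c *: pi x = pi (c *: x).
Proof. by rewrite -linearZ. Qed.

Lemma qa_mulA : associative qa_mul.
Proof.
move=> x y z; have [{}x <-] := quot_proj_surj x; have [{}y <-] := quot_proj_surj y.
have [{}z <-] := quot_proj_surj z.
by rewrite !qa_mulE mulrA.
Qed.
Lemma qa_mul1 : left_id (pi 1) qa_mul.
Proof. by move=> x; have [{}x <-] := quot_proj_surj x; rewrite qa_mulE mul1r. Qed.
Lemma qa_mulr1 : right_id (pi 1) qa_mul.
Proof. by move=> x; have [{}x <-] := quot_proj_surj x; rewrite qa_mulE mulr1. Qed.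
Lemma qa_mulDl : left_distributive qa_mul +%R.
Proof.
move=> x y z; have [{}x <-] := quot_proj_surj x; have [{}y <-] := quot_proj_surj y.
have [{}z <-] := quot_proj_surj z.
by rewrite piD !qa_mulE piD mulrDl.
Qed.
Lemma qa_mulDr : right_distributive qa_mul +%R.
Proof.
move=> x y z; have [{}x <-] := quot_proj_surj x; have [{}y <-] := quot_proj_surj y.
have [{}z <-] := quot_proj_surj z.
by rewrite piD !qa_mulE piD mulrDr.
Qed.

Lemma qa_scaleAl (c : K) (x y : quotmod I) :
  c *: qa_mul x y = qa_mul (c *: x) y.
Proof.
have [{}x <-] := quot_proj_surj x; have [{}y <-] := quot_proj_surj y.
by rewrite qa_mulE !piZ qa_mulE kscalerAl.
Qed.
Lemma qa_scaleAr (c : K) (x y : quotmod I) :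
  c *: qa_mul x y = qa_mul x (c *: y).
Proof.
have [{}x <-] := quot_proj_surj x; have [{}y <-] := quot_proj_surj y.
by rewrite qa_mulE !piZ qa_mulE kscalerAr.
Qed.

Definition quotalg : kalg K :=
  KAlg qa_mulA qa_mul1 qa_mulr1 qa_mulDl qa_mulDr qa_scaleAl qa_scaleAr.

Definition quotalg_proj (x : A) : quotalg := pi x.

Fact quotalg_proj_linear : linear quotalg_proj.
Proof. exact: linearP. Qed.
HB.instance Definition _ :=
  GRing.isLinear.Build K A quotalg *:%R quotalg_proj quotalg_proj_linear.

Fact quotalg_proj_monoid_morphism : monoid_morphism quotalg_proj.
Proof. by split=> // x y; rewrite [RHS]qa_mulE. Qed.
HB.instance Definition _ :=
  GRing.isMonoidMorphism.Build A quotalg quotalg_proj quotalg_proj_monoid_morphism.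

Lemma quotalg_proj_surj (y : quotalg) : exists x, quotalg_proj x = y.
Proof. exact: quot_proj_surj. Qed.

Lemma quotalg_projP (x : A) : quotalg_proj x = 0 <-> I x.
Proof. exact: quot_projP. Qed.

End QuotientAlgebra.

(* An algebra with underlying module freemod K mt_base, given by the products
   of basis elements *)

Record multable (K : fieldType) := MulTable {
  mt_base : choiceType;
  mt_mul : mt_base -> mt_base -> freemod K mt_base;
  mt_one : freemod K mt_base;
  mt_mulA : forall x y z,
    fm_lift (mt_mul^~ z) (mt_mul x y) = fm_lift (mt_mul x) (mt_mul y z);
  mt_mul1 : forall x, fm_lift (mt_mul^~ x) mt_one = fm_base K x;
  mt_mulr1 : forall x, fm_lift (mt_mul x) mt_one = fm_base K x }.

Arguments mt_mul {K m} x y : rename.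

Section TableAlgebra.
Variables (K : fieldType) (T : multable K).

Local Notation tab := (freemod K (mt_base T)).

Local Notation "[ x ]" := (fm_base K x).

Definition ta_mul (g h : tab) : tab :=
  fm_lift (fun x => fm_lift (mt_mul x) h) g.

Definition ta_mulrev (h g : tab) : tab := ta_mul g h.

Lemma ta_mul_linearl h : linear (ta_mulrev h).
Proof. by move=> c g g'; apply: linearP. Qed.
HB.instance Definition _ h :=
  GRing.isLinear.Build K tab tab *:%R (ta_mulrev h) (ta_mul_linearl h).

Lemma ta_mul_linearr g : linear (ta_mul g).
Proof.
move=> c h h'; rewrite /ta_mul /fm_lift scaler_sumr -big_split /=.
apply: eq_bigr => x _; rewrite -!/(fm_lift _ _) linearP scalerDr !scalerA.
by rewrite mulrC.
Qed.
HB.instance Definition _ g :=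
  GRing.isLinear.Build K tab tab *:%R (ta_mul g) (ta_mul_linearr g).

Lemma ta_mul_base x y : ta_mul [x] [y] = mt_mul x y.
Proof. by rewrite /ta_mul !fm_lift_base. Qed.

Lemma ta_mul_basel x h : ta_mul [x] h = fm_lift (mt_mul x) h.
Proof. by rewrite /ta_mul fm_lift_base. Qed.

Lemma ta_mul_baser g y : ta_mul g [y] = fm_lift (mt_mul^~ y) g.
Proof. by apply: eq_bigr => x _; rewrite fm_lift_base. Qed.

Lemma ta_mulA : associative ta_mul.
Proof.
move=> f g h.
apply: (freemod_ext (f := ta_mulrev (ta_mul g h))
  (g := ta_mulrev h \o ta_mulrev g)) f => x /=.
apply: (freemod_ext (f := ta_mul [x] \o ta_mulrev h)
  (g := ta_mulrev h \o ta_mul [x])) g => y /=.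
apply: (freemod_ext (f := ta_mul [x] \o ta_mul [y])
  (g := ta_mul (ta_mul [x] [y]))) h => z /=.
by rewrite /ta_mulrev !ta_mul_base ta_mul_basel ta_mul_baser mt_mulA.
Qed.

Lemma ta_mul1 : left_id (mt_one T) ta_mul.
Proof.
move=> g; apply: (freemod_ext (f := ta_mul (mt_one T)) (g := idfun)) g => x.
by rewrite /= ta_mul_baser mt_mul1.
Qed.
Lemma ta_mulr1 : right_id (mt_one T) ta_mul.
Proof.
move=> g; rewrite -[LHS]/(ta_mulrev _ g).
apply: (freemod_ext (f := ta_mulrev (mt_one T)) (g := idfun)) g => x.
by rewrite /= /ta_mulrev ta_mul_basel mt_mulr1.
Qed.
Lemma ta_mulDl : left_distributive ta_mul +%R.
Proof. by move=> f g h; apply: (linearD (ta_mulrev h)). Qed.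
Lemma ta_mulDr : right_distributive ta_mul +%R.
Proof. by move=> f g h; apply: linearD. Qed.

Lemma ta_scaleAl (c : K) g h : c *: ta_mul g h = ta_mul (c *: g) h.
Proof. exact/esym/(linearZ_LR (ta_mulrev h)). Qed.
Lemma ta_scaleAr (c : K) g h : c *: ta_mul g h = ta_mul g (c *: h).
Proof. exact/esym/(linearZ_LR (ta_mul g)). Qed.

Definition tabalg : kalg K :=
  KAlg ta_mulA ta_mul1 ta_mulr1 ta_mulDl ta_mulDr ta_scaleAl ta_scaleAr.

End TableAlgebra.

Record quiver := Quiver {
  vertex : finType;
  arrow : finType;
  src : arrow -> vertex;
  tgt : arrow -> vertex }.

Section PathAlgebra.
Variables (K : fieldType) (Q : quiver).

Fixpoint is_path (v : vertex Q) (s : seq (arrow Q)) : bool :=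
  if s is a :: s' then (src a == v) && is_path (tgt a) s' else true.

(* A path is its source together with its arrows, in the order in which they
   are travelled; the trivial path at v is (v, [::]). *)
Definition qpath := {p : vertex Q * seq (arrow Q) | is_path p.1 p.2}.
HB.instance Definition _ := Choice.on qpath.

Definition psrc (p : qpath) : vertex Q := (val p).1.
Definition ptgt (p : qpath) : vertex Q :=
  last (psrc p) (map (@tgt Q) (val p).2).

Definition ptriv (v : vertex Q) : qpath := exist _ (v, [::]) isT.
Definition parrow (a : arrow Q) : qpath :=
  exist _ (src a, [:: a]) (introT andP (conj (eqxx (src a)) isT)).

Lemma is_path_cat v s t :
  is_path v (s ++ t) = is_path v s && is_path (last v (map (@tgt Q) s)) t.
Proof. by elim: s v => //= a s IHs v; rewrite IHs andbA. Qed.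

Lemma pcat_subproof (p q : qpath) :
  is_path (psrc p) ((val p).2 ++ if ptgt p == psrc q then (val q).2 else [::]).
Proof.
case: p q => [[v s] /= ps] [[w t] /= qt]; rewrite is_path_cat ps /=.
by rewrite /ptgt /psrc /=; case: eqP => [->|].
Qed.

(* Meaningful only when ptgt p = psrc q *)
Definition pcat (p q : qpath) : qpath :=
  exist (fun u => is_path u.1 u.2)
    (psrc p, (val p).2 ++ if ptgt p == psrc q then (val q).2 else [::])
    (pcat_subproof p q).

Definition pmul (p q : qpath) : freemod K qpath :=
  if ptgt p == psrc q then fm_base K (pcat p q) else 0.

Definition pone : freemod K qpath := \sum_v fm_base K (ptriv v).

Lemma pmul_cat (p q : qpath) : ptgt p = psrc q -> pmul p q = fm_base K (pcat p q).
Proof. by rewrite /pmul => ->; rewrite eqxx. Qed.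

Lemma psrc_cat p q : psrc (pcat p q) = psrc p. Proof. by []. Qed.

Lemma ptgt_cat p q : ptgt p = psrc q -> ptgt (pcat p q) = ptgt q.
Proof.
by move=> epq; rewrite /ptgt /= epq eqxx map_cat last_cat -/(ptgt p) epq.
Qed.

Lemma pmulA p q r : fm_lift (pmul^~ r) (pmul p q) = fm_lift (pmul p) (pmul q r).
Proof.
have [epq|npq] := eqVneq (ptgt p) (psrc q); last first.
  rewrite {2}/pmul (negbTE npq) linear0 {2}/pmul; case: ifP => _.
    by rewrite fm_lift_base /pmul psrc_cat (negbTE npq).
  by rewrite linear0.
rewrite (pmul_cat epq) fm_lift_base.
have [eqr|nqr] := eqVneq (ptgt q) (psrc r); last first.
  by rewrite /pmul ptgt_cat // (negbTE nqr) linear0.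
rewrite (pmul_cat eqr) fm_lift_base !pmul_cat ?ptgt_cat //.
by congr fm_base; apply: val_inj; rewrite /= ptgt_cat // epq eqr !eqxx catA.
Qed.

Lemma pmul1 p : fm_lift (pmul^~ p) pone = fm_base K p.
Proof.
rewrite linear_sum (bigD1 (psrc p)) //= fm_lift_base pmul_cat // big1 ?addr0.
  congr fm_base; apply: val_inj; rewrite /= eqxx.
  by case: p => [[]].
by move=> v nv; rewrite fm_lift_base /pmul (negbTE nv).
Qed.

Lemma pmulr1 p : fm_lift (pmul p) pone = fm_base K p.
Proof.
rewrite linear_sum (bigD1 (ptgt p)) //= fm_lift_base pmul_cat // big1 ?addr0.
  congr fm_base; apply: val_inj; rewrite /= eqxx cats0.
  by case: p => [[]].
by move=> v nv; rewrite fm_lift_base /pmul eq_sym (negbTE nv).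
Qed.

Definition path_table : multable K := MulTable pmulA pmul1 pmulr1.
Definition path_algebra := tabalg path_table.

Definition pa_vertex (v : vertex Q) : path_algebra := fm_base K (ptriv v).
Definition pa_arrow (a : arrow Q) : path_algebra := fm_base K (parrow a).

End PathAlgebra.

Section Tensor.
Variables (K : fieldType) (A B : kalg K).

Local Notation "[ a , b ]" := (fm_base K ((a, b) : A * B)).

Definition tmul (p q : A * B) : freemod K (A * B)%type := [p.1 * q.1, p.2 * q.2].

Fact tmulA p q r : fm_lift (tmul^~ r) (tmul p q) = fm_lift (tmul p) (tmul q r).
Proof. by rewrite !fm_lift_base /tmul !mulrA. Qed.
Fact tmul1 p : fm_lift (tmul^~ p) [1, 1] = fm_base K p.
Proof. by rewrite fm_lift_base /tmul !mul1r; case: p. Qed.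
Fact tmulr1 p : fm_lift (tmul p) [1, 1] = fm_base K p.
Proof. by rewrite fm_lift_base /tmul !mulr1; case: p. Qed.

Definition tensor_table : multable K := MulTable tmulA tmul1 tmulr1.

Inductive tensor_rel : tabalg tensor_table -> Prop :=
| TensorDl a a' b : tensor_rel ([a + a', b] - [a, b] - [a', b])
| TensorDr a b b' : tensor_rel ([a, b + b'] - [a, b] - [a, b'])
| TensorZl c a b : tensor_rel ([c *: a, b] - c *: [a, b])
| TensorZr c a b : tensor_rel ([a, c *: b] - c *: [a, b]).

(* The tensor product over K: the free module on A * B modulo the bilinearity
   relations, whose span is already stable under multiplication. *)
Definition tensor := quotalg (gen_ideal tensor_rel).

Definition tens (a : A) (b : B) : tensor :=
  quotalg_proj (gen_ideal tensor_rel) [a, b].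

End Tensor.

Section Enveloping.
Variables (K : fieldType) (A : kalg K).

Definition enveloping : kalg K := tensor (opposite A) A.

Local Notation pre := (tabalg (tensor_table (opposite A) A)).

Definition pre_act (t : pre) (x : A) : A :=
  fm_lift (fun p : opposite A * A => p.2 * x * (p.1 : A)) t.

Lemma pre_act_linearl x : linear (pre_act^~ x).
Proof. exact: linearP. Qed.

Lemma pre_act_linearr t : linear (pre_act t).
Proof.
move=> c x y; rewrite /pre_act /fm_lift scaler_sumr -big_split /=.
apply: eq_bigr => p _; rewrite mulrDr mulrDl scalerDr !scalerA.
by rewrite -kscalerAr -kscalerAl scalerA [c * _]mulrC.
Qed.

Lemma pre_act_base a b x : pre_act (fm_base K (a, b)) x = b * x * (a : A).
Proof. by rewrite /pre_act fm_lift_base. Qed.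

Definition pre_actx x (t : pre) : A := pre_act t x.
HB.instance Definition _ x :=
  GRing.isLinear.Build K pre A *:%R (pre_actx x) (pre_act_linearl x).
HB.instance Definition _ t :=
  GRing.isLinear.Build K A A *:%R (pre_act t) (pre_act_linearr t).

Lemma pre_actM (s t : pre) x : pre_act (s * t) x = pre_act s (pre_act t x).
Proof.
pose mr (t : pre) : {linear pre -> pre} := ta_mulrev t.
pose ml (s : pre) : {linear pre -> pre} := ta_mul s.
apply: (freemod_ext (f := pre_actx x \o mr t)
  (g := pre_actx (pre_act t x))) s => -[a b] /=.
apply: (freemod_ext (f := pre_actx x \o ml (fm_base K (a, b)))
  (g := pre_act (fm_base K (a, b)) \o pre_actx x)) t => -[a' b'] /=.
by rewrite /pre_actx ta_mul_base !pre_act_base /= !mulrA.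
Qed.

Lemma pre_act1 x : pre_act 1 x = x.
Proof. by rewrite pre_act_base mul1r mulr1. Qed.

Definition pre_ann (t : pre) := forall x, pre_act t x = 0.
Fact pre_ann0 : pre_ann 0.
Proof. by move=> x; apply: (linear0 (pre_actx x)). Qed.
Fact pre_ann_linear c (s t : pre) : pre_ann s -> pre_ann t -> pre_ann (c *: s + t).
Proof.
move=> s0 t0 x; rewrite -[LHS]/(pre_actx x _) (linearP (pre_actx x)) /= /pre_actx.
by rewrite s0 t0 scaler0 addr0.
Qed.
Fact pre_annMl (s t : pre) : pre_ann t -> pre_ann (s * t).
Proof. by move=> t0 x; rewrite pre_actM t0 linear0. Qed.
Fact pre_annMr (s t : pre) : pre_ann t -> pre_ann (t * s).
Proof. by move=> t0 x; rewrite pre_actM t0. Qed.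
Definition pre_ann_ideal : ideal pre :=
  @Ideal K pre (Submodule pre_ann0 pre_ann_linear) pre_annMl pre_annMr.

Lemma tensor_rel_ann (t : pre) : tensor_rel t -> pre_ann t.
Proof.
case=> [a a' b|a b b'|c a b|c a b] x; rewrite -[LHS]/(pre_actx x _);
  rewrite !(linearB (pre_actx x)) ?(linearZ_LR (pre_actx x)) /= /pre_actx;
  rewrite !pre_act_base.
- by rewrite mulrDr addrAC addrK subrr.
- by rewrite !mulrDl addrAC addrK subrr.
- by rewrite -kscalerAr subrr.
- by rewrite -!kscalerAl subrr.
Qed.

Definition bimod_act (t : enveloping) (x : A) : A := pre_act (repr t) x.

Lemma bimod_actE (t : pre) x :
  bimod_act (quotalg_proj (gen_ideal (@tensor_rel K (opposite A) A)) t) x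
    = pre_act t x.
Proof.
apply/eqP; rewrite -subr_eq0; apply/eqP; rewrite /bimod_act.
rewrite -[LHS](linearB (pre_actx x)) /pre_actx.
have := repr_pi (gen_ideal (@tensor_rel K (opposite A) A)) t.
by move/(_ pre_ann_ideal tensor_rel_ann); apply.
Qed.

(* For a, b, x in A: (a (x) b) *: x = b * x * a *)
Definition bimod : Type := A.
HB.instance Definition _ := GRing.Zmodule.on bimod.

Fact bimod_actA s t (x : bimod) : bimod_act s (bimod_act t x) = bimod_act (s * t) x.
Proof.
have [{}s <-] := quotalg_proj_surj s; have [{}t <-] := quotalg_proj_surj t.
by rewrite -rmorphM !bimod_actE pre_actM.
Qed.
Fact bimod_act1 : left_id 1 (bimod_act : _ -> bimod -> bimod).
Proof.
move=> x; rewrite -(rmorph1 (quotalg_proj (gen_ideal (@tensor_rel _ _ _)))).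
by rewrite bimod_actE pre_act1.
Qed.
Fact bimod_actDr : right_distributive (bimod_act : _ -> bimod -> bimod) +%R.
Proof. by move=> t x y; apply: linearD. Qed.
Fact bimod_actDl (x : bimod) : {morph bimod_act^~ x : s t / s + t}.
Proof.
move=> s t; have [{}s <-] := quotalg_proj_surj s.
have [{}t <-] := quotalg_proj_surj t.
by rewrite -linearD !bimod_actE; apply: (linearD (pre_actx x)).
Qed.
HB.instance Definition _ := GRing.Zmodule_isLmodule.Build enveloping bimod
  bimod_actA bimod_act1 bimod_actDr bimod_actDl.

Lemma bimodE (a : opposite A) (b : A) (x : bimod) :
  tens a b *: x = b * (x : A) * (a : A).
Proof. by rewrite [LHS]bimod_actE pre_act_base. Qed.

End Enveloping.

Definition projective (R : pzRingType) (P : lmodType R) : Prop :=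
  forall (U V : lmodType R) (g : {linear U -> V}) (f : {linear P -> V}),
    (forall v, exists u, g u = v) ->
    exists h : {linear P -> U}, forall x, g (h x) = f x.

(* Every module has one: see free_resolution below. *)
Record projective_resolution (R : pzRingType) (M : lmodType R) := ProjRes {
  pr_mod : nat -> lmodType R;
  pr_d : forall n, {linear pr_mod n.+1 -> pr_mod n};
  pr_aug : {linear pr_mod 0 -> M};
  pr_projective : forall n, projective (pr_mod n);
  pr_aug_surj : forall x, exists y, pr_aug y = x;
  pr_exact0 : forall y, pr_aug y = 0 <-> exists z, pr_d 0 z = y;
  pr_exact : forall n y, pr_d n y = 0 <-> exists z, pr_d n.+1 z = y }.

Section FreeResolution.
Variables (R : pzRingType) (M : lmodType R).

Lemma freemod_projective (X : choiceType) : projective (freemod R X).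
Proof.
move=> U V g f gsurj.
have [s sE] : {s : X -> U | forall x, g (s x) = f (fm_base R x)}.
  exists (fun x => sval (boolp.cid (gsurj (f (fm_base R x))))) => x.
  by case: boolp.cid.
exists (fm_lift s) => h; apply: (freemod_ext (f := g \o fm_lift s)) => x /=.
by rewrite fm_lift_base sE.
Qed.

(* Step n: a free module F_n with the submodule of F_n to be covered next *)
Definition fr_state := {F : lmodType R & submodule F}.

Definition fr_cover (N : lmodType R) : {linear freemod R N -> N} :=
  fm_lift (fun x : N => x).

Lemma fr_cover_surj (N : lmodType R) x : exists y, fr_cover N y = x.
Proof. by exists (fm_base R x); apply: fm_lift_base. Qed.

Definition fr_map (s : fr_state) :
    {linear freemod R (submod (projT2 s)) -> projT1 s} :=
  (\val : submod (projT2 s) -> projT1 s) \o fr_cover (submod (projT2 s)).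

Lemma fr_map_image (s : fr_state) y :
  projT2 s y <-> exists z, fr_map s z = y.
Proof.
split=> [sy|[z <-]]; last exact: submodP.
by have [z zE] := fr_cover_surj (to_submod sy); exists z; rewrite /= zE.
Qed.

Fixpoint fr_seq (n : nat) : fr_state :=
  if n is n'.+1 then
    existT _ (freemod R (submod (projT2 (fr_seq n'))) : lmodType R)
      (ker_sub (fr_map (fr_seq n')))
  else existT _ (freemod R M : lmodType R) (ker_sub (fr_cover M)).

Definition free_resolution : projective_resolution M.
Proof.
refine (@ProjRes R M (fun n => projT1 (fr_seq n)) (fun n => fr_map (fr_seq n))
  (fr_cover M) _ (@fr_cover_surj M) _ _).
- by case=> [|n]; apply: freemod_projective.
- by move=> y; exact (@fr_map_image (fr_seq 0) y).
- by move=> n y; exact (@fr_map_image (fr_seq n.+1) y).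
Defined.

End FreeResolution.

Section Hom.
Variables (K : fieldType) (R : kalg K) (M N : lmodType R).

(* K acts on Hom_R(M, N) through c |-> c *: 1 : R. *)
Definition homspace : Type := {linear M -> N}.
HB.instance Definition _ := boolp.gen_eqMixin homspace.
HB.instance Definition _ := boolp.gen_choiceMixin homspace.

Lemma hom_ext (f g : {linear M -> N}) : f =1 g -> f = g.
Proof.
case: f g => [f [[f1] [f2]]] [g [[g1] [g2]]] /= /boolp.funext efg.
case: _ / efg g1 g2 => g1 g2.
by rewrite (boolp.Prop_irrelevance f1 g1) (boolp.Prop_irrelevance f2 g2).
Qed.

Fact hom_add_linear (f g : homspace) : linear (fun x => f x + g x).
Proof. by move=> a x y; rewrite !linearP scalerDr addrACA. Qed.
Fact hom_opp_linear (f : homspace) : linear (fun x => - f x).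
Proof. by move=> a x y; rewrite linearP opprD scalerN. Qed.
Fact hom_scale_linear (c : K) (f : homspace) : linear (fun x => (c *: (1 : R)) *: f x).
Proof.
move=> a x y; rewrite linearP scalerDr !scalerA -kscalerAl -kscalerAr.
by rewrite mul1r mulr1.
Qed.

Definition hom_zero : homspace := \0.
Definition hom_add (f g : homspace) : homspace :=
  HB.pack (fun x => f x + g x)
    (GRing.isLinear.Build R M N *:%R _ (hom_add_linear f g)).
Definition hom_opp (f : homspace) : homspace :=
  HB.pack (fun x => - f x)
    (GRing.isLinear.Build R M N *:%R _ (hom_opp_linear f)).
Definition hom_scale (c : K) (f : homspace) : homspace :=
  HB.pack (fun x => (c *: (1 : R)) *: f x)
    (GRing.isLinear.Build R M N *:%R _ (hom_scale_linear c f)).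

Fact hom_addA : associative hom_add.
Proof. by move=> f g h; apply: hom_ext => x; apply: addrA. Qed.
Fact hom_addC : commutative hom_add.
Proof. by move=> f g; apply: hom_ext => x; apply: addrC. Qed.
Fact hom_add0 : left_id hom_zero hom_add.
Proof. by move=> f; apply: hom_ext => x; apply: add0r. Qed.
Fact hom_addN : left_inverse hom_zero hom_opp hom_add.
Proof. by move=> f; apply: hom_ext => x; apply: addNr. Qed.
HB.instance Definition _ :=
  GRing.isZmodule.Build homspace hom_addA hom_addC hom_add0 hom_addN.

Fact hom_scaleA a b f : hom_scale a (hom_scale b f) = hom_scale (a * b) f.
Proof.
apply: hom_ext => x /=.
by rewrite scalerA -kscalerAl mul1r scalerA.
Qed.
Fact hom_scale1 : left_id 1 hom_scale.
Proof. by move=> f; apply: hom_ext => x /=; rewrite !scale1r. Qed.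
Fact hom_scaleDr : right_distributive hom_scale +%R.
Proof. by move=> a f g; apply: hom_ext => x /=; apply: scalerDr. Qed.
Fact hom_scaleDl f : {morph hom_scale^~ f : a b / a + b}.
Proof. by move=> a b; apply: hom_ext => x /=; rewrite -[RHS]scalerDl -scalerDl. Qed.
HB.instance Definition _ := GRing.Zmodule_isLmodule.Build K homspace
  hom_scaleA hom_scale1 hom_scaleDr hom_scaleDl.

End Hom.

Section Ext.
Variables (K : fieldType) (R : kalg K) (M N : lmodType R).
Variable P : projective_resolution M.

Definition pullback n (f : homspace (pr_mod P n) N) : homspace (pr_mod P n.+1) N :=
  f \o pr_d P n.

Fact pullback_linear n : linear (@pullback n).
Proof. by move=> c f g; apply: hom_ext. Qed.
HB.instance Definition _ n := GRing.isLinear.Build K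
  (homspace (pr_mod P n) N) (homspace (pr_mod P n.+1) N) *:%R (@pullback n) (@pullback_linear n).

Definition cocycles n : submodule (homspace (pr_mod P n) N) := ker_sub (@pullback n).

Fact zero_sub_linear (c : K) (f g : homspace (pr_mod P 0) N) :
  f = 0 -> g = 0 -> c *: f + g = 0.
Proof. by move=> -> ->; rewrite scaler0 addr0. Qed.

Definition coboundaries n : submodule (homspace (pr_mod P n) N) :=
  match n with
  | 0 => Submodule (erefl (0 : homspace (pr_mod P 0) N)) zero_sub_linear
  | n'.+1 => im_sub (@pullback n')
  end.

(* H^n(Hom_R(P, N)) *)
Definition Ext n : lmodType K :=
  quotmod (preimage (\val : submod (cocycles n) -> _) (coboundaries n)).

End Ext.

Definition is_basis (K : fieldType) (V : lmodType K) d (b : 'I_d -> V) : Prop :=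
  forall v, exists! c : {ffun 'I_d -> K}, v = \sum_i c i *: b i.

Definition dim_eq (K : fieldType) (V : lmodType K) (d : nat) : Prop :=
  exists b : 'I_d -> V, is_basis b.

Section Hochschild.
Variables (K : fieldType) (A : kalg K).
Variable P : projective_resolution (bimod A).

Definition HH n : lmodType K := Ext (bimod A) P n.

Definition central (z : A) : Prop := forall x : A, z * x = x * z.
Fact central0 : central 0.
Proof. by move=> x; rewrite mul0r mulr0. Qed.
Fact central_linear c (y z : A) : central y -> central z -> central (c *: y + z).
Proof.
by move=> cy cz x; rewrite mulrDl mulrDr -kscalerAl -kscalerAr cy cz.
Qed.
Definition center : submodule A := Submodule central0 central_linear.

Definition aug_mul (z : submod center) (x : pr_mod P 0) : bimod A :=
  (pr_aug P x : A) * (val z : A).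

Lemma bimod_mul_central t (x : bimod A) (z : A) : central z ->
  t *: ((x : A) * z : bimod A) = ((t *: x : bimod A) : A) * z.
Proof.
move=> cz; have [{}t <-] := quotalg_proj_surj t.
rewrite [LHS]bimod_actE.
suff -> : (quotalg_proj _ t *: x : bimod A) = pre_act t x by
  rewrite /pre_act /fm_lift mulr_suml; apply: eq_bigr => p _;
  rewrite -kscalerAl -!mulrA cz.
exact: bimod_actE.
Qed.

Fact aug_mul_linear z : linear (aug_mul z).
Proof.
move=> t x y; rewrite /aug_mul linearP bimod_mul_central; last exact: (submodP z).
exact: mulrDl.
Qed.

Definition aug_mul_hom (z : submod center) : homspace (pr_mod P 0) (bimod A) :=
  HB.pack (aug_mul z)
    (GRing.isLinear.Build (enveloping A) _ (bimod A) *:%R _ (aug_mul_linear z)).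

Fact aug_mul_cocycle z : cocycles (bimod A) P 0 (aug_mul_hom z).
Proof.
apply: hom_ext => x; rewrite /= /aug_mul.
have -> : pr_aug P (pr_d P 0 x) = 0 by apply/pr_exact0; exists x.
exact: mul0r.
Qed.

(* The identification Z(A) = HH^0(A): z goes to the class of the composite of
   the augmentation P_0 -> A with multiplication by z. *)
Definition center_HH0 (z : submod center) : HH 0 :=
  quot_proj _ (to_submod (aug_mul_cocycle z)).

End Hochschild.

Inductive Qvertex := vtx1 | vtx2.
Inductive Qarrow := eps | alpha | beta.

Definition bool_of_vertex v := if v is vtx1 then true else false.
Definition vertex_of_bool (b : bool) := if b then vtx1 else vtx2.
Fact bool_of_vertexK : cancel bool_of_vertex vertex_of_bool. Proof. by case. Qed.
HB.instance Definition _ := Finite.copy Qvertex (can_type bool_of_vertexK).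

Definition opt_of_arrow a :=
  match a with eps => None | alpha => Some true | beta => Some false end.
Definition arrow_of_opt (o : option bool) :=
  match o with None => eps | Some true => alpha | Some false => beta end.
Fact opt_of_arrowK : cancel opt_of_arrow arrow_of_opt. Proof. by case. Qed.
HB.instance Definition _ := Finite.copy Qarrow (can_type opt_of_arrowK).

Definition QQ : quiver := {|
  vertex := Qvertex;
  arrow := Qarrow;
  src := fun a => match a with eps => vtx1 | alpha => vtx1 | beta => vtx2 end;
  tgt := fun a => match a with eps => vtx1 | alpha => vtx2 | beta => vtx1 end |}.

Section TheAlgebra.
Variable K : fieldType.

Local Notation KQ := (path_algebra K QQ).
Local Notation path a := (pa_arrow K (a : arrow QQ)).

Inductive relations : KQ -> Prop :=
| rel_eps_alpha : relations (path eps * path alpha)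
| rel_beta_eps : relations (path beta * path eps)
| rel_square : relations ((path alpha * path beta) ^+ 2 - path eps ^+ 2).

Definition algA : kalg K := quotalg (gen_ideal relations).

Definition A_proj : KQ -> algA := quotalg_proj (gen_ideal relations).
Definition A_e1 : algA := A_proj (pa_vertex K (vtx1 : vertex QQ)).
Definition A_e2 : algA := A_proj (pa_vertex K (vtx2 : vertex QQ)).
Definition A_eps : algA := A_proj (path eps).
Definition A_alpha : algA := A_proj (path alpha).
Definition A_beta : algA := A_proj (path beta).

End TheAlgebra.

(* Main.v *)
Require Import Defs.
From HB Require Import structures.
From mathcomp Require Import all_boot all_order all_algebra finmap.
From mathcomp.multinomials Require Import monalg.
From mathcomp Require boolp.
From mathcomp Require Import zify.

(** Paths that are not among the eleven monomials e_1, e_2, ε, α, β, αβ, βα, αβα,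
βαβ, (αβ)², (βα)² either equal one of them or vanish in A, and products of
monomials are monomials or 0. The monomials are independent since the algebra
with this multiplication table is a quotient of KQ that satisfies the relations
([A_basis]). From here on A is handled through its multiplication table.

Over A^e a projective resolution of A is assembled from copies of one complex R.
Its beginning R_0 <- R_1 <- R_2 <- R_3 is that of the minimal resolution, given by
the vertices, arrows, relations and their overlaps, and from degree 4 on
R_m = (A e_1 (x) e_1 A)² with a differential of period 2, made of the operators
l ± r for left and right multiplication by ε and by αβ. The complex R is not
exact: besides H_0(R) = A it has H_3(R) = A. So one puts
Q_n = R_n + R_(n-4) + R_(n-8) + ..., with differential d + t, where
t : R_m -> R_(m+3) goes from block k to block k - 1 and its part on R_0 kills the
second copy of A. Exactness follows from a contraction that is linear only for right
multiplication: h inside the blocks and g from R_3 of a block to R_0 of the next.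
It is a contraction up to terms in lower blocks, and one concludes by induction on
the number of blocks ([defect_key], [D_exact], [resolution]).

The cohomology of Hom(R, A) has dimensions 5, 3, 3, 6 in degrees 0 to 3 and 2 in
every degree at least 4; 2 is invertible, which matters because l + r becomes
multiplication by 2. The map induced by t has rank 2 from degree 3 of a block to
degree 0 of the next one, where its image is spanned by the socle elements, and is
0 otherwise. This leaves the dimensions 3, 3, 3, 4, 2, 2, ..., except that
nothing hits degree 0 of the first block. In degree 4k + i the last block then
contributes 3, 3, 3 or 4 and each of the k others 2, which is the assertion. In the
proof, explicit cocycles on which t vanishes exactly represent a basis: a cocycle is
reduced to them starting from its lowest block ([spanning]), and functionals
vanishing on coboundaries show that they are independent ([freeness]).

The comparison theorem carries this basis to any projective resolution
([cohom_basis_pull]), and HH^0 is computed directly on the given one, as the center.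
All identities between the tables that describe d, t, h, g, the cocycles and the
functionals are identities between integral linear combinations of finitely many
symbols, checked by computation; the periodicity reduces them to finitely many
degrees. *)

Set Implicit Arguments.
Unset Strict Implicit.
Unset Printing Implicit Defensive.

Import GRing.Theory.
Local Open Scope ring_scope.

(** * Comparison of projective resolutions *)

Section Corestriction.
Variables (R : pzRingType) (X V : lmodType R) (S : submodule V).
Variables (f : {linear X -> V}) (Sf : forall x, S (f x)).

Definition corestr_fun (x : X) : submod S := to_submod (Sf x).
Fact corestr_linear : linear corestr_fun.
Proof. by move=> a x y; apply: val_inj; rewrite /= linearP. Qed.
HB.instance Definition _ :=
  GRing.isLinear.Build R X (submod S) *:%R corestr_fun corestr_linear.
Definition corestr : {linear X -> submod S} := corestr_fun.
End Corestriction.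

(** The lifting property concerns surjections, so both maps are first restricted
to the image of [g]. *)
Lemma projective_factor (R : pzRingType) (X A B : lmodType R)
    (g : {linear A -> B}) (f : {linear X -> B}) :
  projective X -> (forall x, exists a, g a = f x) ->
  exists h : {linear X -> A}, forall x, g (h x) = f x.
Proof.
move=> Xproj fg.
have imP a : im_sub g (g a) by exists a.
have [|h hE] := Xproj _ _ (corestr imP) (corestr (f := f) (S := im_sub g) fg).
  by move=> [v Sv]; case/boolp.asboolP: (Sv) => a av; exists a; apply: val_inj.
by exists h => x; have /(congr1 val) := hE x.
Qed.

Section Comparison.
Variables (R : pzRingType) (M : lmodType R).

(** The state of the recursion that builds a chain map holds two consecutive
components, because the next one is constructed from their compatibility. *)
Definition chain_square (P Q : projective_resolution M) n
    (fg : {linear pr_mod P n -> pr_mod Q n} *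
          {linear pr_mod P n.+1 -> pr_mod Q n.+1}) : Prop :=
  forall x, pr_d Q n (fg.2 x) = fg.1 (pr_d P n x).

Record chain_map (P Q : projective_resolution M) := ChainMap {
  cm_map :> forall n, {linear pr_mod P n -> pr_mod Q n};
  cm_aug : forall x, pr_aug Q (cm_map 0 x) = pr_aug P x;
  cm_d : forall n x, pr_d Q n (cm_map n.+1 x) = cm_map n (pr_d P n x) }.

Lemma pr_aug_d (P : projective_resolution M) x : pr_aug P (pr_d P 0 x) = 0.
Proof. by apply/pr_exact0; exists x. Qed.

Lemma pr_dd (P : projective_resolution M) n x : pr_d P n (pr_d P n.+1 x) = 0.
Proof. by apply/pr_exact; exists x. Qed.

Section Lift.
Variables P Q : projective_resolution M.

Lemma lift_step n (fg : {fg | @chain_square P Q n fg}) :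
  exists h, chain_square ((sval fg).2, h).
Proof.
case: fg => -[f g] /= fgP.
apply: (projective_factor (f := g \o pr_d P n.+1)); first exact: pr_projective.
by move=> x; apply/pr_exact; rewrite /= fgP pr_dd linear0.
Qed.

Lemma lift_start : exists fg, @chain_square P Q 0 fg /\
  forall x, pr_aug Q (fg.1 x) = pr_aug P x.
Proof.
have [f fE] := projective_factor (f := pr_aug P) (@pr_projective _ _ P 0)
  (fun x => pr_aug_surj Q (pr_aug P x)).
have [|g gE] := projective_factor (g := pr_d Q 0) (f := f \o pr_d P 0)
  (@pr_projective _ _ P 1).
  by move=> x; apply/pr_exact0; rewrite fE pr_aug_d.
by exists (f, g).
Qed.

Fixpoint lift_seq n : {fg | @chain_square P Q n fg} :=
  if n is n'.+1 then
    let h := boolp.cid (lift_step (lift_seq n')) in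
    exist _ ((sval (lift_seq n')).2, sval h) (svalP h)
  else exist _ (sval (boolp.cid lift_start))
    (proj1 (svalP (boolp.cid lift_start))).

Lemma chain_map_exists : chain_map P Q.
Proof.
exists (fun n => (sval (lift_seq n)).1) => [x|n x].
  exact: (proj2 (svalP (boolp.cid lift_start))).
exact: (svalP (lift_seq n)).
Qed.
End Lift.

(** Two lifts of the identity are chain homotopic, and the homotopy is built
one degree at a time: [s] and [t] are its components into degrees [n] and
[n.+1]. *)
Lemma lift_homotopy (P : projective_resolution M) (F : chain_map P P) n :
  exists (s : {linear pr_mod P n -> pr_mod P n.+1})
         (t : {linear pr_mod P n.+1 -> pr_mod P n.+2}),
    forall x, F n.+1 x - x = s (pr_d P n x) + pr_d P n.+1 (t x).
Proof.
elim: n => [|n [s [t stE]]].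
  have [|s sE] := projective_factor (g := pr_d P 0) (f := F 0 \- idfun)
    (@pr_projective _ _ P 0).
    by move=> x; apply/pr_exact0; rewrite /= linearB /= cm_aug subrr.
  have [|t tE] := projective_factor (g := pr_d P 1)
    (f := (F 1 \- idfun) \- (s \o pr_d P 0)) (@pr_projective _ _ P 1).
    by move=> x; apply/pr_exact; rewrite /= !linearB /= cm_d sE subrr.
  by exists s, t => x; rewrite tE /= [RHS]addrC subrK.
have [|u uE] := projective_factor (g := pr_d P n.+2)
    (f := (F n.+2 \- idfun) \- (t \o pr_d P n.+1)) (@pr_projective _ _ P n.+2).
  move=> x; apply/pr_exact; rewrite /= !linearB /= cm_d.
  have := stE (pr_d P n.+1 x); rewrite pr_dd linear0 add0r => ->.
  by rewrite subrr.
by exists t, u => x; rewrite uE /= [RHS]addrC subrK.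
Qed.

End Comparison.

Section ExtTransport.
Variables (K : fieldType) (R : kalg K) (M N : lmodType R).

Definition precomp (X Y : lmodType R) (s : {linear X -> Y}) (f : homspace Y N) :
  homspace X N := f \o s.

Definition chain_comp (P Q : projective_resolution M) (F : chain_map P Q)
  (G : chain_map Q P) : chain_map P P.
Proof.
exists (fun n => G n \o F n) => [x|n x] /=; first by rewrite !cm_aug.
by rewrite !cm_d.
Defined.

Definition pull (P Q : projective_resolution M) (F : chain_map P Q) n
  (f : homspace (pr_mod Q n) N) : homspace (pr_mod P n) N :=
  precomp (F n) f.

Fact pull_linear P Q (F : chain_map P Q) n : linear (@pull P Q F n).
Proof. by move=> c f g; apply: hom_ext. Qed.
HB.instance Definition _ P Q (F : chain_map P Q) n :=
  GRing.isLinear.Build K _ _ *:%R (@pull P Q F n) (@pull_linear P Q F n).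

Lemma pullback_pull P Q (F : chain_map P Q) n (f : homspace (pr_mod Q n) N) :
  pullback (pull F f) = pull F (pullback f).
Proof. by apply: hom_ext => x; rewrite /= /pull /= cm_d. Qed.

Lemma pull_cobound P Q (F : chain_map P Q) n (f : homspace (pr_mod Q n.+1) N) :
  coboundaries N Q n.+1 f -> coboundaries N P n.+1 (pull F f).
Proof. by case=> g <-; exists (pull F g); apply: pullback_pull. Qed.

(** Composing a cocycle with the homotopy [s] exhibits the difference as a
coboundary; the other half [d t] of the homotopy is killed by the cocycle. *)
Lemma pull_homotopic P (F : chain_map P P) n (f : homspace (pr_mod P n.+1) N) :
  cocycles N P n.+1 f -> coboundaries N P n.+1 (pull F f - f).
Proof.
move=> fc; have [s [t stE]] := lift_homotopy F n.
exists (precomp s f); apply: hom_ext => x /=.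
have fd y : f (pr_d P n.+1 y) = 0.
  by have := congr1 (fun h : homspace _ _ => (h : _ -> _) y) fc.
by rewrite -[RHS](linearB f) /= stE linearD /= fd addr0.
Qed.

Lemma pull_comp P Q (F : chain_map P Q) (G : chain_map Q P) n
    (f : homspace (pr_mod P n) N) :
  pull (chain_comp F G) f = pull F (pull G f).
Proof. exact: hom_ext. Qed.

(** A basis of the cohomology is described on the level of cocycles, where it can
be pulled back along chain maps. *)
Definition cohom_basis (P : projective_resolution M) n (I : finType)
    (z : I -> homspace (pr_mod P n) N) : Prop :=
  [/\ forall i, cocycles N P n (z i),
      forall f, cocycles N P n f -> exists c : I -> K,
        coboundaries N P n (f - \sum_i c i *: z i) &
      forall c : I -> K, coboundaries N P n (\sum_i c i *: z i) ->
        forall i, c i = 0].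

(** Pulling back along F and then along G changes a cocycle by a coboundary only,
so spanning and freeness are carried in opposite directions. *)
Lemma cohom_basis_pull P Q (F : chain_map P Q) (G : chain_map Q P) n
    (I : finType) (z : I -> homspace (pr_mod Q n.+1) N) :
  cohom_basis z -> cohom_basis (fun i => pull F (z i)).
Proof.
case=> zc zspan zfree; split.
- move=> i; rewrite /= pullback_pull; have /= -> := zc i; exact: linear0.
- move=> f fc; have [|c cE] := zspan (pull G f).
    by rewrite /= pullback_pull; have /= -> := fc; exact: linear0.
  exists c; have := pull_cobound F cE; rewrite linearB linear_sum /= => E.
  have := pull_homotopic (chain_comp F G) fc.
  rewrite pull_comp.
  move=> /smemN H; have {H E} := smemD H E; rewrite opprB addrA subrK.
  by congr (smem _ (_ - _)); apply: eq_bigr => i _; rewrite linearZ.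
- move=> c cb; apply: zfree.
  have := pull_cobound G cb; rewrite linear_sum /= => E.
  rewrite -[\sum_i _](subrK (\sum_i pull G (c i *: pull F (z i)))).
  apply: (@smemD _ _ (coboundaries N Q n.+1)) => //; rewrite -sumrB.
  apply: (big_ind (fun g => coboundaries N Q n.+1 g)) => [||i _].
  + exact: smem0.
  + by move=> *; apply: smemD.
  rewrite -opprB; apply: (@smemN _ _ (coboundaries N Q n.+1)).
  rewrite linearZ /= -scalerBr; apply: (@smemZ _ _ (coboundaries N Q n.+1)).
  rewrite -pull_comp; exact: (pull_homotopic (chain_comp G F) (zc i)).
Qed.

Lemma ext_class_eq (P : projective_resolution M) n (f g : submod (cocycles N P n)) :
  quot_proj _ f = quot_proj _ g :> Ext N P n <->
  coboundaries N P n (val f - val g).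
Proof.
rewrite -(linearB (\val : submod (cocycles N P n) -> homspace (pr_mod P n) N)).
exact: quotmodP.
Qed.

Lemma cohom_basis_dim P n (I : finType) (z : I -> homspace (pr_mod P n) N) :
  cohom_basis z -> dim_eq (Ext N P n) #|I|.
Proof.
case=> zc zspan zfree.
pose cl (f : submod (cocycles N P n)) : Ext N P n := quot_proj _ f.
exists (fun i => cl (to_submod (zc (enum_val i)))) => v.
have sumE (c : {ffun 'I_#|I| -> K}) :
    \sum_i c i *: cl (to_submod (zc (enum_val i))) =
    cl (\sum_i c i *: to_submod (zc (enum_val i))).
  by rewrite /cl linear_sum; apply: eq_bigr => i _; rewrite linearZ.
have valE (c : {ffun 'I_#|I| -> K}) :
    val (\sum_i c i *: to_submod (zc (enum_val i)))
     = \sum_j c (enum_rank j) *: z j.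
  rewrite linear_sum (reindex (@enum_val I predT)) /=; last first.
    by exists enum_rank => j _; rewrite ?enum_valK ?enum_rankK.
  by apply: eq_bigr => i _; rewrite enum_valK.
have [f fv] := quot_proj_surj v.
have [c cE] := zspan _ (submodP f).
exists [ffun i => c (enum_val i)]; split=> [|c' c'E].
  rewrite sumE -fv; apply/ext_class_eq; rewrite valE.
  by congr (smem _ (_ - _)): cE; apply: eq_bigr => j _; rewrite ffunE enum_rankK.
apply/ffunP => i; rewrite ffunE; apply/eqP; rewrite -subr_eq0; apply/eqP.
move: c'E; rewrite -fv sumE => /ext_class_eq; rewrite valE => E.
have := smemB E cE; rewrite opprB addrC addrA subrK.
rewrite -sumrB => E'.
have := zfree (fun j => c j - c' (enum_rank j)).
have -> : \sum_i (c i - c' (enum_rank i)) *: z i =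
   \sum_i (c i *: z i - c' (enum_rank i) *: z i).
  by apply: eq_bigr => j _; rewrite scalerBl.
by move=> /(_ E') /(_ (enum_val i)); rewrite enum_valK.
Qed.

End ExtTransport.

(** * Formal integral linear combinations *)

Definition lform (T : Type) := seq (int * T).

Section Eval.
Variables (T : Type) (V : zmodType) (F : T -> V).

Definition ev (l : lform T) : V := \sum_(p <- l) F p.2 *~ p.1.

Lemma ev_nil : ev [::] = 0. Proof. exact: big_nil. Qed.
Lemma ev_cons c t l : ev ((c, t) :: l) = F t *~ c + ev l.
Proof. exact: big_cons. Qed.
Lemma ev1 t : ev [:: (1, t)] = F t.
Proof. by rewrite ev_cons ev_nil addr0. Qed.
Lemma ev_cat l l' : ev (l ++ l') = ev l + ev l'.
Proof. exact: big_cat. Qed.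
End Eval.

Lemma eq_ev T (V : zmodType) (F G : T -> V) l : F =1 G -> ev F l = ev G l.
Proof. by move=> FG; apply: eq_bigr => p _; rewrite FG. Qed.

Lemma raddf_ev T (U V : zmodType) (f : {additive U -> V}) (F : T -> U) l :
  f (ev F l) = ev (f \o F) l.
Proof. by rewrite raddf_sum; apply: eq_bigr => p _; rewrite raddfMz. Qed.

Lemma ev_add T (V : zmodType) (F G : T -> V) l :
  ev (fun t => F t + G t) l = ev F l + ev G l.
Proof. by rewrite /ev -big_split; apply: eq_bigr => p _; rewrite mulrzDl. Qed.

Lemma ev_0 T (V : zmodType) l : ev (fun _ : T => 0 : V) l = 0.
Proof. by rewrite /ev big1 // => p _; rewrite mul0rz. Qed.

Definition lscale T (c : int) (l : lform T) : lform T :=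
  [seq (c * p.1, p.2) | p <- l].

Lemma ev_scale T (V : zmodType) (F : T -> V) c l :
  ev F (lscale c l) = ev F l *~ c.
Proof.
rewrite /ev /lscale big_map /= mulrz_suml; apply: eq_bigr => p _.
by rewrite mulrzA mulrzAC.
Qed.

Definition lbind T T' (l : lform T) (r : T -> lform T') : lform T' :=
  flatten [seq lscale p.1 (r p.2) | p <- l].

Lemma ev_bind T T' (V : zmodType) (F : T' -> V) l (r : T -> lform T') :
  ev F (lbind l r) = ev (fun t => ev F (r t)) l.
Proof.
elim: l => [|[c t] l IHl]; first by rewrite /lbind /= !ev_nil.
by rewrite /lbind /= ev_cat -/(lbind l r) IHl ev_scale ev_cons.
Qed.

(** A combination all of whose collected coefficients vanish evaluates to 0
everywhere. Every identity between explicit tables of coefficients is reduced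
in this way to a computation with integers, valid over all fields at once. *)
Section Zero.
Variable T : eqType.

Definition lcoef (t : T) (l : lform T) : int :=
  foldr (fun p a => if p.2 == t then p.1 + a else a) 0 l.

Definition lzero (l : lform T) : bool := all (fun p => lcoef p.2 l == 0) l.

Lemma ev_coef (V : zmodType) (F : T -> V) l (s : seq T) : uniq s ->
  {subset map snd l <= s} -> ev F l = \sum_(t <- s) F t *~ lcoef t l.
Proof.
move=> us; elim: l => [|[c t] l IHl] sub.
  by rewrite ev_nil big1.
rewrite ev_cons IHl => [|u ul]; last by apply: sub; rewrite inE ul orbT.
have ts : t \in s by apply: sub; rewrite inE eqxx.
rewrite [RHS](bigD1_seq t) //= eqxx mulrzDr (bigD1_seq t ts us) /= addrA.
congr (_ + _); apply: eq_bigr => u ut.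
by rewrite eq_sym (negbTE ut).
Qed.

Lemma ev_zero (V : zmodType) (F : T -> V) l : lzero l -> ev F l = 0.
Proof.
move=> /allP l0; rewrite (@ev_coef _ _ _ (undup (map snd l))) ?undup_uniq //.
  rewrite big_seq big1 // => t; rewrite mem_undup => /mapP[p pl ->].
  by rewrite (eqP (l0 p pl)) mulr0z.
by move=> t; rewrite mem_undup.
Qed.

Definition lequiv (l l' : lform T) := lzero (l ++ lscale (-1) l').

Lemma ev_equiv (V : zmodType) (F : T -> V) l l' : lequiv l l' -> ev F l = ev F l'.
Proof.
move=> /(ev_zero F); rewrite ev_cat ev_scale mulrN1z.
by move/eqP; rewrite subr_eq0 => /eqP.
Qed.
End Zero.

(** * The monomial basis *)

Inductive bas := e1 | e2 | ep | al | be | ab | ba | aba | bab | aa | bb.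

Definition bas_code (x : bas) : 'I_11 :=
  match x with
  | e1 => Ordinal (isT : 0 < 11) | e2 => Ordinal (isT : 1 < 11)
  | ep => Ordinal (isT : 2 < 11) | al => Ordinal (isT : 3 < 11)
  | be => Ordinal (isT : 4 < 11) | ab => Ordinal (isT : 5 < 11)
  | ba => Ordinal (isT : 6 < 11) | aba => Ordinal (isT : 7 < 11)
  | bab => Ordinal (isT : 8 < 11) | aa => Ordinal (isT : 9 < 11)
  | bb => Ordinal (isT : 10 < 11)
  end%N.
Definition all_bas := [:: e1; e2; ep; al; be; ab; ba; aba; bab; aa; bb].
Definition bas_decode (i : 'I_11) : bas := nth e1 all_bas i.
Fact bas_codeK : cancel bas_code bas_decode. Proof. by case. Qed.
HB.instance Definition _ := Finite.copy bas (can_type bas_codeK).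

Lemma big_bas (V : nmodType) (F : bas -> V) :
  \sum_x F x = \sum_(x <- all_bas) F x.
Proof.
rewrite -big_enum /=; apply: perm_big; apply: uniq_perm => [||x].
- exact: enum_uniq.
- by [].
- by rewrite mem_enum; case: x.
Qed.

(** Vertices are booleans, [true] being the vertex 1. *)
Definition bsrc (x : bas) : bool :=
  match x with e2 | be | ba | bab | bb => false | _ => true end.
Definition btgt (x : bas) : bool :=
  match x with e2 | al | ba | aba | bb => false | _ => true end.
Definition idem (v : bool) : bas := if v then e1 else e2.

(** [aa] and [bb] stand for the two socle elements (αβ)² = ε² and (βα)². *)
Definition bmul (x y : bas) : option bas :=
  match x, y with
  | e1, _ => if bsrc y then Some y else None
  | e2, _ => if bsrc y then None else Some y
  | _, e1 => if btgt x then Some x else None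
  | _, e2 => if btgt x then None else Some x
  | ep, ep => Some aa
  | al, be => Some ab | al, ba => Some aba | al, bab => Some aa
  | be, al => Some ba | be, ab => Some bab | be, aba => Some bb
  | ab, al => Some aba | ab, ab => Some aa
  | ba, be => Some bab | ba, ba => Some bb
  | aba, be => Some aa
  | bab, al => Some bb
  | _, _ => None
  end.

Definition omul (x y : option bas) : option bas :=
  if x is Some x' then if y is Some y' then bmul x' y' else None else None.

Lemma omulA : associative omul.
Proof.
move=> [x|] [y|] [z|] //=; last by case: (bmul x y).
by case: x; case: y; case: z.
Qed.

Lemma omul0 x : omul x None = None. Proof. by case: x. Qed.

Lemma bmul_idem_l v x :
  bmul (idem v) x = if bsrc x == v then Some x else None.
Proof. by case: v; case: x. Qed.
Lemma bmul_idem_r v x :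
  bmul x (idem v) = if btgt x == v then Some x else None.
Proof. by case: v; case: x. Qed.

(** The resolution and its cohomology depend on A only through a basis of
monomials that multiply by [bmul]. *)
Record monomial_basis (K : fieldType) (A : kalg K) := MonomialBasis {
  mb : bas -> A;
  crd : bas -> {linear A -> K^o};
  mbM : forall x y, mb x * mb y = if bmul x y is Some z then mb z else 0;
  mb1 : mb e1 + mb e2 = 1;
  mb_span : forall a, a = \sum_x crd x a *: mb x;
  crd_mb : forall x y, crd x (mb y) = (x == y)%:R }.

(** * The monomials form a basis *)

Section QuotientLift.
Variables (K : fieldType) (A : kalg K) (I : ideal A) (V : lmodType K).
Variables (f : {linear A -> V}) (fI : forall x, I x -> f x = 0).

Definition quot_lift_fun (y : quotalg I) : V := f (repr (y : quotmod I)).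

Lemma quot_lift_funE x : quot_lift_fun (quotalg_proj I x) = f x.
Proof.
apply/eqP; rewrite -subr_eq0 -linearB; apply/eqP/fI.
exact: (repr_pi I x).
Qed.

Fact quot_lift_linear : linear quot_lift_fun.
Proof.
move=> c x y; have [{}x <-] := quotalg_proj_surj x.
have [{}y <-] := quotalg_proj_surj y.
by rewrite -linearP !quot_lift_funE linearP.
Qed.
HB.instance Definition _ :=
  GRing.isLinear.Build K (quotalg I) V *:%R quot_lift_fun quot_lift_linear.
Definition quot_lift : {linear quotalg I -> V} := quot_lift_fun.

Lemma quot_liftE x : quot_lift (quotalg_proj I x) = f x.
Proof. exact: quot_lift_funE. Qed.
End QuotientLift.

(** The monomials are linearly independent because they act as a basis in the
algebra with multiplication table [bmul], onto which KQ/I maps. *)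
Section AlgebraBasis.
Variable K : fieldType.

Definition obase (o : option bas) : freemod K bas :=
  if o is Some x then fm_base K x else 0.

Lemma lift_obase (V : lmodType K) (f : option bas -> V) o : f None = 0 ->
  fm_lift (fun x => f (Some x)) (obase o) = f o.
Proof. by case: o => [x|] f0; rewrite ?fm_lift_base // linear0. Qed.

Fact bas_mulA x y z : fm_lift (fun x => obase (bmul x z)) (obase (bmul x y)) =
  fm_lift (fun y => obase (bmul x y)) (obase (bmul y z)).
Proof.
rewrite (lift_obase (f := fun o => obase (omul o (Some z)))) //.
rewrite (lift_obase (f := fun o => obase (omul (Some x) o))) //.
by congr obase; rewrite -(omulA (Some x) (Some y) (Some z)).
Qed.
Definition bas_one : freemod K bas := fm_base K e1 + fm_base K e2.
Fact bas_mul1 x : fm_lift (fun y => obase (bmul y x)) bas_one = fm_base K x.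
Proof. by rewrite linearD /= !fm_lift_base; case: x; rewrite ?add0r ?addr0. Qed.
Fact bas_mulr1 x : fm_lift (fun y => obase (bmul x y)) bas_one = fm_base K x.
Proof. by rewrite linearD /= !fm_lift_base; case: x; rewrite ?add0r ?addr0. Qed.

Definition bas_alg : kalg K :=
  tabalg (@MulTable K bas (fun x y => obase (bmul x y)) bas_one
            bas_mulA bas_mul1 bas_mulr1).

Local Notation KQ := (path_algebra K QQ).

Definition vertex_bas (v : Qvertex) : bas := if v is vtx1 then e1 else e2.
Definition arrow_bas (a : Qarrow) : bas :=
  match a with eps => ep | alpha => al | beta => be end.

(** A path is read from left to right, multiplying by one arrow at a time; [None]
is the zero of the monomial algebra. *)
Definition word_bas (o : option bas) (s : seq Qarrow) : option bas :=
  foldl (fun o a => omul o (Some (arrow_bas a))) o s.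
Definition path_bas (p : qpath QQ) : option bas :=
  word_bas (Some (vertex_bas (psrc p))) (val p).2.

Lemma word_basM o o' s : word_bas (omul o o') s = omul o (word_bas o' s).
Proof. by elim: s o' => //= a s IHs o'; rewrite -omulA IHs. Qed.

Lemma word_bas0 s : word_bas None s = None.
Proof. by elim: s. Qed.

Lemma arrow_tgt o (a : Qarrow) :
  omul (omul o (Some (arrow_bas a))) (Some (vertex_bas (tgt (a : arrow QQ)))) =
  omul o (Some (arrow_bas a)).
Proof. by case: o => [[]|] //; case: a. Qed.

Lemma path_bas_tgt (p : qpath QQ) :
  omul (path_bas p) (Some (vertex_bas (ptgt p))) = path_bas p.
Proof.
rewrite /path_bas /ptgt; move: (psrc p) (val p).2 => v s.
elim/last_ind: s => [|s a _]; first by case: v.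
by rewrite map_rcons last_rcons /word_bas foldl_rcons arrow_tgt.
Qed.

Lemma path_bas_cat p q : omul (path_bas p) (path_bas q) =
  if ptgt p == psrc q then path_bas (pcat p q) else None.
Proof.
rewrite -path_bas_tgt -omulA /path_bas -word_basM.
have [epq|npq] := eqVneq; last first.
  have -> : omul (Some (vertex_bas (ptgt p))) (Some (vertex_bas (psrc q))) = None.
    by move: npq; case: (ptgt p); case: (psrc q).
  by rewrite word_bas0 omul0.
have -> : omul (Some (vertex_bas (ptgt p))) (Some (vertex_bas (psrc q))) =
  Some (vertex_bas (ptgt p)) by rewrite -epq; case: (ptgt p).
rewrite -word_basM -/(path_bas p) path_bas_tgt /word_bas /=.
by rewrite epq eqxx foldl_cat.
Qed.

Definition path_eval : {linear KQ -> bas_alg} :=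
  fm_lift (fun p : qpath QQ => obase (path_bas p)).

Lemma path_eval_base (p : qpath QQ) : path_eval (fm_base K p) = obase (path_bas p).
Proof. exact: fm_lift_base. Qed.

Lemma obaseM o o' : (obase o : bas_alg) * (obase o' : bas_alg) = obase (omul o o').
Proof.
case: o => [x|]; last exact: mul0r.
case: o' => [y|]; last exact: mulr0.
exact: ta_mul_base.
Qed.

Lemma path_evalM x y : path_eval (x * y) = path_eval x * path_eval y.
Proof.
pose mr (z : bas_alg) : {linear bas_alg -> bas_alg} := ta_mulrev z.
pose ml (z : bas_alg) : {linear bas_alg -> bas_alg} := ta_mul z.
pose Mr (z : KQ) : {linear KQ -> KQ} := ta_mulrev z.
pose Ml (z : KQ) : {linear KQ -> KQ} := ta_mul z.
apply: (freemod_ext (f := path_eval \o Mr y) (g := mr (path_eval y) \o path_eval)) x.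
move=> p; apply: (freemod_ext (f := path_eval \o Ml (fm_base K p))
  (g := ml (path_eval (fm_base K p)) \o path_eval)) y => q.
rewrite -[LHS]/(path_eval (ta_mul (fm_base K p) (fm_base K q))).
rewrite -[RHS]/((path_eval (fm_base K p) : bas_alg) * path_eval (fm_base K q)).
rewrite (ta_mul_base (T := path_table K QQ)) [mt_mul _ _]/(pmul K p q) /pmul.
have := obaseM (path_bas p) (path_bas q).
rewrite -!path_eval_base path_bas_cat => ->.
by case: ifP => _; rewrite ?linear0 ?path_eval_base.
Qed.

Definition path_eval_ker : ideal KQ.
Proof.
apply: (@Ideal K KQ (ker_sub path_eval)) => a x x0.
  by change (path_eval (a * x) = 0); rewrite path_evalM (x0 : path_eval x = 0) mulr0.
by change (path_eval (x * a) = 0); rewrite path_evalM (x0 : path_eval x = 0) mul0r.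
Defined.

Lemma path_eval_arrow (a : Qarrow) :
  path_eval (pa_arrow K (a : arrow QQ)) = obase (Some (arrow_bas a)).
Proof. by rewrite [LHS]path_eval_base; case: a. Qed.

Lemma path_evalMo x y o o' : path_eval x = obase o -> path_eval y = obase o' ->
  path_eval (x * y) = obase (omul o o').
Proof. by move=> xo yo; rewrite -obaseM -xo -yo; apply: path_evalM. Qed.

Lemma path_eval_rel x : gen_ideal (@relations K) x -> path_eval x = 0.
Proof.
have arr2 a b := path_evalMo (path_eval_arrow a) (path_eval_arrow b).
move=> /(_ path_eval_ker); apply=> y yr.
change (path_eval y = 0); case: yr.
- exact: (arr2 eps alpha).
- exact: (arr2 beta eps).
- rewrite linearB; apply/eqP; rewrite subr_eq0; apply/eqP.
  transitivity (obase (Some aa)); last by symmetry; exact: (arr2 eps eps).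
  exact: (path_evalMo (arr2 alpha beta) (arr2 alpha beta)).
Qed.

Definition bas_coord : {linear algA K -> bas_alg} := quot_lift path_eval_rel.

(** The eleven monomials, evaluated in any ring at elements playing the roles
of the vertices and arrows of the quiver. *)
Definition bas_monomial (R : pzRingType) (v1 v2 e a b : R) (x : bas) : R :=
  match x with
  | e1 => v1 | e2 => v2 | ep => e | al => a | be => b
  | ab => a * b | ba => b * a | aba => a * b * a | bab => b * a * b
  | aa => a * b * a * b | bb => b * a * b * a
  end.

(** Besides the vanishing of products of arrows that do not match, only two
consequences of the relations occur: αβαβα = ε²α = 0 and βαβαβ = βε² = 0. *)
Lemma bas_monomialM (R : pzRingType) (v1 v2 e a b : R) :
    [/\ v1 * v1 = v1, v1 * v2 = 0, v2 * v1 = 0 & v2 * v2 = v2] ->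
    [/\ v1 * e = e, e * v1 = e, v1 * a = a & a * v2 = a] ->
    v2 * b = b -> b * v1 = b ->
    e * a = 0 -> b * e = 0 -> a * b * a * b = e * e ->
  forall x y, bas_monomial v1 v2 e a b x * bas_monomial v1 v2 e a b y =
    if bmul x y is Some z then bas_monomial v1 v2 e a b z else 0.
Proof.
move=> [v11 v12 v21 v22] [v1e ev1 v1a av2] v2b bv1 ea0 be0 abab x y.
have v2e : v2 * e = 0 by rewrite -v1e mulrA v21 mul0r.
have ev2 : e * v2 = 0 by rewrite -ev1 -mulrA v12 mulr0.
have v2a : v2 * a = 0 by rewrite -v1a mulrA v21 mul0r.
have av1 : a * v1 = 0 by rewrite -av2 -mulrA v21 mulr0.
have v1b : v1 * b = 0 by rewrite -v2b mulrA v12 mul0r.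
have bv2 : b * v2 = 0 by rewrite -bv1 -mulrA v12 mulr0.
have a2 : a * a = 0 by rewrite -{1}av2 -mulrA v2a mulr0.
have b2 : b * b = 0 by rewrite -{1}bv1 -mulrA v1b mulr0.
have ae : a * e = 0 by rewrite -av2 -mulrA v2e mulr0.
have eb : e * b = 0 by rewrite -v2b mulrA ev2 mul0r.
have ababa : a * b * a * b * a = 0 by rewrite abab -mulrA ea0 mulr0.
have babab : b * a * b * a * b = 0.
  by rewrite -!mulrA [a * _]mulrA [a * b * _]mulrA abab mulrA be0 mul0r.
have cancel_r (s t u : R) (stu : s * t = u) r : r * s * t = r * u.
  by rewrite -stu mulrA.
pose rules := (v11, v12, v21, v22, v1e, ev1, v1a, av2, v2b, bv1, ea0, be0,
  v2e, ev2, v2a, av1, v1b, bv2, a2, b2, ae, eb, ababa, babab).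
pose rules_r := (cancel_r _ _ _ v11, cancel_r _ _ _ ev1,
  cancel_r _ _ _ av2, cancel_r _ _ _ bv1, cancel_r _ _ _ ea0,
  cancel_r _ _ _ be0, cancel_r _ _ _ ev2, cancel_r _ _ _ av1,
  cancel_r _ _ _ bv2, cancel_r _ _ _ a2, cancel_r _ _ _ b2,
  cancel_r _ _ _ ae, cancel_r _ _ _ eb).
have ee : e * e = a * b * a * b by [].
by case: x; case: y; rewrite /= ?mulrA; do ?[done | rewrite !(rules, rules_r, mul0r, mulr0)].
Qed.

Definition A_mon : bas -> algA K :=
  bas_monomial (A_e1 K) (A_e2 K) (A_eps K) (A_alpha K) (A_beta K).

Lemma A_projM (x y : KQ) : A_proj (x * y) = A_proj x * A_proj y.
Proof. exact: (rmorphM (quotalg_proj (gen_ideal (@relations K)))). Qed.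

Lemma pa_mul (p q : qpath QQ) :
  (fm_base K p : KQ) * (fm_base K q : KQ) = pmul K p q.
Proof. exact: (ta_mul_base (T := path_table K QQ)). Qed.

Lemma A_rel x y : relations (x - y) -> A_proj x = A_proj y :> algA K.
Proof.
move=> r; apply/eqP; rewrite -subr_eq0; apply/eqP.
rewrite -[LHS](linearB (quotalg_proj (gen_ideal (@relations K)))).
by apply/quotalg_projP => J; apply.
Qed.

Lemma A_monM x y :
  A_mon x * A_mon y = if bmul x y is Some z then A_mon z else 0.
Proof.
have triv_l (p : qpath QQ) v : psrc p = v ->
    (fm_base K (ptriv v) : KQ) * fm_base K p = fm_base K p.
  move=> <-; rewrite pa_mul /pmul eqxx; congr fm_base; apply: val_inj.
  by case: p => -[w s] i; rewrite /= eqxx.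
have triv_r (p : qpath QQ) v : ptgt p = v ->
    (fm_base K p : KQ) * fm_base K (ptriv v) = fm_base K p.
  move=> pv; rewrite pa_mul /pmul pv eqxx; congr fm_base; apply: val_inj.
  by rewrite /= pv eqxx cats0; case: p {pv} => -[w s] i.
have triv0 (v w : Qvertex) : v <> w ->
    (fm_base K (ptriv (v : vertex QQ)) : KQ) * fm_base K (ptriv (w : vertex QQ)) = 0.
  by move=> /eqP vw; rewrite pa_mul /pmul ifN.
have A0 : A_proj 0 = 0 :> algA K.
  exact: (linear0 (quotalg_proj (gen_ideal (@relations K)))).
apply: bas_monomialM.
- split; rewrite -A_projM -?A0; congr A_proj.
  + exact: triv_l.
  + exact: triv0.
  + exact: triv0.
  + exact: triv_l.
- split; rewrite -A_projM; congr A_proj.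
  + exact: (triv_l (@parrow QQ eps)).
  + exact: (triv_r (@parrow QQ eps)).
  + exact: (triv_l (@parrow QQ alpha)).
  + exact: (triv_r (@parrow QQ alpha)).
- by rewrite -A_projM; congr A_proj; exact: (triv_l (@parrow QQ beta)).
- by rewrite -A_projM; congr A_proj; exact: (triv_r (@parrow QQ beta)).
- by rewrite -A_projM -A0; apply: A_rel; rewrite subr0; exact: rel_eps_alpha.
- by rewrite -A_projM -A0; apply: A_rel; rewrite subr0; exact: rel_beta_eps.
- suff sq (u v w : KQ) : relations ((u * v) ^+ 2 - w ^+ 2) ->
      A_proj u * A_proj v * A_proj u * A_proj v = A_proj w * A_proj w.
    exact: (sq _ _ _ (rel_square K)).
  move=> /(@A_rel ((u * v) ^+ 2) (w ^+ 2)) E.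
  apply: (etrans (esym (mulrA (A_proj u * A_proj v) (A_proj u) (A_proj v)))).
  apply: (etrans _ (etrans E (A_projM w w))).
  apply: (etrans _ (esym (A_projM (u * v) (u * v)))).
  exact: (f_equal2 *%R (esym (A_projM u v)) (esym (A_projM u v))).
Qed.

Lemma A_mon1 : A_mon e1 + A_mon e2 = 1.
Proof.
rewrite -[RHS](rmorph1 (quotalg_proj (gen_ideal (@relations K)))).
rewrite -[LHS](linearD (quotalg_proj (gen_ideal (@relations K)))).
congr (quotalg_proj _ _); rewrite [RHS]/(pone K QQ) /pone.
rewrite (bigD1 (vtx1 : vertex QQ)) //= (bigD1 (vtx2 : vertex QQ)) //=.
rewrite big1; last by case.
by apply: (f_equal2 +%R (erefl _)); rewrite addr0.
Qed.

Definition oA_mon (o : option bas) : algA K := if o is Some x then A_mon x else 0.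

Lemma oA_monM o o' : oA_mon o * oA_mon o' = oA_mon (omul o o').
Proof.
by case: o o' => [x|] [y|] //=; rewrite ?mul0r ?mulr0 // A_monM; case: bmul.
Qed.

(** Every path is a monomial or 0 in A, so the monomials span; their coordinates
are read off in [bas_alg]. *)
Lemma A_proj_path (p : qpath QQ) : A_proj (fm_base K p) = oA_mon (path_bas p).
Proof.
case: p => -[v s]; elim/last_ind: s => [|s a IHs] i.
  rewrite [exist _ _ _](_ : _ = ptriv v); last exact: val_inj.
  by case: v {i}.
have /andP[is_s sa] : is_path v s && (src a == last v (map (@tgt QQ) s)).
  by move: i; rewrite /= -cats1 is_path_cat /= andbT.
pose p : qpath QQ := exist _ (v, s) is_s.
have pE : A_proj (fm_base K p) = oA_mon (path_bas p) := IHs is_s.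
have pa : ptgt p == psrc (parrow a) by rewrite eq_sym; exact: sa.
have -> : fm_base K (exist _ (v, rcons s a) i : qpath QQ) =
          (fm_base K p : KQ) * fm_base K (parrow a).
  rewrite pa_mul /pmul pa; congr fm_base; apply: val_inj.
  by rewrite /= pa cats1.
apply: (etrans (A_projM (fm_base K p) (fm_base K (parrow a)))).
have aE : A_proj (fm_base K (parrow a)) = oA_mon (Some (arrow_bas a)).
  by case: a {i sa p pE pa}; exact: erefl.
apply: (etrans (f_equal2 *%R pE aE)).
by rewrite oA_monM /path_bas /= /word_bas foldl_rcons.
Qed.

Definition crd_fun (x : bas) (a : algA K) : K^o :=
  mcoeff x (bas_coord a : freemod K bas).
Fact crd_linear x : linear (crd_fun x).
Proof.
by move=> c a b; rewrite /crd_fun linearP mcoeffD fm_scaleE.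
Qed.
HB.instance Definition _ x :=
  GRing.isLinear.Build K (algA K) K^o *:%R (crd_fun x) (crd_linear x).
Definition A_crd (x : bas) : {linear algA K -> K^o} := crd_fun x.

Lemma A_crd_path x (p : qpath QQ) :
  A_crd x (A_proj (fm_base K p)) = (path_bas p == Some x)%:R.
Proof.
rewrite [LHS](_ : _ = mcoeff x (path_eval (fm_base K p) : freemod K bas)).
  rewrite path_eval_base; case: path_bas => [y|] /=; last exact: mcoeff0.
  by rewrite fm_baseE.
by rewrite -(quot_liftE path_eval_rel).
Qed.

Lemma algA_span (V : lmodType K) (f g : {linear algA K -> V}) :
  (forall p : qpath QQ, f (A_proj (fm_base K p)) = g (A_proj (fm_base K p))) ->
  forall a, f a = g a.
Proof.
move=> fg a; have [x <-] := quotalg_proj_surj a.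
pose pr : {linear KQ -> algA K} := quotalg_proj (gen_ideal (@relations K)).
exact: (freemod_ext (f := f \o pr) (g := g \o pr)) x.
Qed.

Definition A_expand_fun (a : algA K) : algA K := \sum_x A_crd x a *: A_mon x.
Fact A_expand_linear : linear A_expand_fun.
Proof.
move=> c a b; rewrite /A_expand_fun scaler_sumr -big_split /=.
by apply: eq_bigr => x _; rewrite linearP scalerDl scalerA.
Qed.
HB.instance Definition _ :=
  GRing.isLinear.Build K (algA K) (algA K) *:%R A_expand_fun A_expand_linear.

Lemma A_mon_span a : a = \sum_x A_crd x a *: A_mon x.
Proof.
apply: (algA_span (f := idfun) (g := A_expand_fun)) a => p.
apply: (etrans (A_proj_path p)).
transitivity (\sum_x (path_bas p == Some x)%:R *: A_mon x); last first.
  by apply: eq_bigr => x _; rewrite A_crd_path.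
case: path_bas => [x|] /=; last by rewrite big1 // => x _; rewrite scale0r.
rewrite (bigD1 x) //= eqxx scale1r big1 ?addr0 // => y yx.
by rewrite (inj_eq Some_inj) eq_sym (negbTE yx) scale0r.
Qed.

Definition bas_path (x : bas) : qpath QQ :=
  match x with
  | e1 => exist _ (vtx1, [::]) isT | e2 => exist _ (vtx2, [::]) isT
  | ep => exist _ (vtx1, [:: eps]) isT
  | al => exist _ (vtx1, [:: alpha]) isT
  | be => exist _ (vtx2, [:: beta]) isT
  | ab => exist _ (vtx1, [:: alpha; beta]) isT
  | ba => exist _ (vtx2, [:: beta; alpha]) isT
  | aba => exist _ (vtx1, [:: alpha; beta; alpha]) isT
  | bab => exist _ (vtx2, [:: beta; alpha; beta]) isT
  | aa => exist _ (vtx1, [:: alpha; beta; alpha; beta]) isT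
  | bb => exist _ (vtx2, [:: beta; alpha; beta; alpha]) isT
  end.

Lemma bas_pathK x : path_bas (bas_path x) = Some x. Proof. by case: x. Qed.

Lemma A_crd_mon x y : A_crd x (A_mon y) = (x == y)%:R.
Proof.
have -> : A_mon y = A_proj (fm_base K (bas_path y)).
  by rewrite A_proj_path bas_pathK.
by rewrite A_crd_path bas_pathK (inj_eq Some_inj) eq_sym.
Qed.

Definition A_basis : monomial_basis (algA K) :=
  MonomialBasis A_monM A_mon1 A_mon_span A_crd_mon.

End AlgebraBasis.

(** * Tensors in the enveloping algebra *)

Section TensorLift.
Variables (K : fieldType) (B A : kalg K) (V : lmodType K).

Local Notation pre := (tabalg (tensor_table B A)).
Local Notation "[ a , b ]" := (fm_base K ((a, b) : B * A) : pre).

Lemma pre_mulE a b c d : ta_mul [a, b] [c, d] = [a * c, b * d].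
Proof. exact: ta_mul_base. Qed.

Definition pre_mulr (s : pre) : {linear pre -> pre} := ta_mulrev s.
Definition pre_mull (s : pre) : {linear pre -> pre} := ta_mul s.

(** Multiplying a bilinearity relation by pure tensors gives a bilinearity
relation, so the two-sided ideal they generate is only their span. *)
Lemma tensor_rel_kill (f : {linear pre -> V}) :
  (forall t, tensor_rel t -> f t = 0) ->
  forall t, gen_ideal (@tensor_rel K B A) t -> f t = 0.
Proof.
move=> f0.
have f0' t : tensor_rel t -> forall r s, f (ta_mul (ta_mul r t) s) = 0.
  move=> tr r s.
  apply: (freemod_ext (f := f \o (pre_mulr s \o pre_mulr t)) (g := \0)) r => -[a b].
  apply: (freemod_ext (f := f \o pre_mull (pre_mulr t [a, b])) (g := \0)) s => -[c d].
  rewrite -[LHS]/((f \o pre_mulr [c, d] \o pre_mull [a, b]) t).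
  rewrite -[RHS]/(0 : V).
  pose subf (u v : V) := u - v.
  have E x y : (f \o pre_mulr [c, d] \o pre_mull [a, b]) [x, y] =
      f [a * x * c, b * y * d].
    rewrite -[LHS]/(f (ta_mul (ta_mul [a, b] [x, y]) [c, d])).
    by rewrite !pre_mulE.
  case: tr => [x x' y|x y y'|e x y|e x y].
  - rewrite !linearB.
    apply: (etrans (f_equal2 subf (f_equal2 subf (E _ _) (E _ _)) (E _ _))).
    rewrite /subf -!linearB; apply: f0; rewrite mulrDr mulrDl; exact: TensorDl.
  - rewrite !linearB.
    apply: (etrans (f_equal2 subf (f_equal2 subf (E _ _) (E _ _)) (E _ _))).
    rewrite /subf -!linearB; apply: f0; rewrite mulrDr mulrDl; exact: TensorDr.
  - rewrite linearB linearZ.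
    apply: (etrans (f_equal2 (fun u v => u - e *: v) (E _ _) (E _ _))).
    rewrite -linearZ -linearB; apply: f0; rewrite -kscalerAr -kscalerAl; exact: TensorZl.
  - rewrite linearB linearZ.
    apply: (etrans (f_equal2 (fun u v => u - e *: v) (E _ _) (E _ _))).
    rewrite -linearZ -linearB; apply: f0; rewrite -kscalerAr -kscalerAl; exact: TensorZr.
pose g r s : {linear pre -> V} := f \o (pre_mulr s \o pre_mull r).
pose J := fun t : pre => forall r s, g r s t = 0.
have J0 : J 0 by move=> r s; apply: (linear0 (g r s)).
have JP c t u : J t -> J u -> J (c *: t + u).
  move=> tJ uJ r s; rewrite (linearP (g r s)) (tJ r s) (uJ r s).
  by rewrite scaler0 addr0.
have gE r s t : g r s t = f (ta_mul (ta_mul r t) s) by [].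
have mE (a x : pre) : a * x = ta_mul a x by [].
have JMl (a x : pre) : Submodule J0 JP x -> Submodule J0 JP (a * x).
  move=> xJ r s; rewrite mE gE (ta_mulA r a x).
  exact: (xJ (ta_mul r a) s).
have JMr (a x : pre) : Submodule J0 JP x -> Submodule J0 JP (x * a).
  move=> xJ r s; rewrite mE gE (ta_mulA r x a) -(ta_mulA (ta_mul r x) a s).
  exact: (xJ r (ta_mul a s)).
move=> t /(_ (@Ideal K pre _ JMl JMr) f0') /(_ (mt_one _) (mt_one _)).
by rewrite gE (ta_mul1 t) (ta_mulr1 t).
Qed.
End TensorLift.

Section Enveloping.
Variables (K : fieldType) (A : kalg K).

Local Notation pre := (tabalg (tensor_table (opposite A) A)).
Local Notation pr := (quotalg_proj (gen_ideal (@tensor_rel K (opposite A) A))).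

(** [ten a b] acts on bimodules by x |-> b * x * a. *)
Definition ten (a b : A) : enveloping A := @tens K (opposite A) A a b.

Lemma ten_rel (t : pre) : tensor_rel t -> pr t = 0.
Proof. by move=> tr; apply/quotalg_projP => J; apply. Qed.

Let prl : {linear pre -> enveloping A} := pr.

Fact linear_rel3 (U V : lmodType K) (f : {linear U -> V}) x y z :
  f (x - y - z) = 0 -> f x = f y + f z.
Proof. by rewrite !linearB => /eqP; rewrite subr_eq0 subr_eq addrC => /eqP. Qed.
Fact linear_rel2 (U V : lmodType K) (f : {linear U -> V}) c x y :
  f (x - c *: y) = 0 -> f x = c *: f y.
Proof. by rewrite linearB linearZ => /eqP; rewrite subr_eq0 => /eqP. Qed.

Lemma tenDl a a' b : ten (a + a') b = ten a b + ten a' b.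
Proof.
exact: (linear_rel3 (f := prl) (ten_rel (@TensorDl K (opposite A) A a a' b))).
Qed.

Lemma tenDr a b b' : ten a (b + b') = ten a b + ten a b'.
Proof.
exact: (linear_rel3 (f := prl) (ten_rel (@TensorDr K (opposite A) A a b b'))).
Qed.

Lemma tenZl c a b : ten (c *: a) b = c *: ten a b.
Proof.
exact: (linear_rel2 (f := prl) (ten_rel (@TensorZl K (opposite A) A c a b))).
Qed.

Lemma tenZr c a b : ten a (c *: b) = c *: ten a b.
Proof.
exact: (linear_rel2 (f := prl) (ten_rel (@TensorZr K (opposite A) A c a b))).
Qed.

Lemma tenM a b c d : ten a b * ten c d = ten (c * a) (b * d).
Proof.
apply: (etrans (esym (rmorphM (quotalg_proj _) _ _))).
exact: (congr1 pr (pre_mulE (a : opposite A) b c d)).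
Qed.

Lemma ten11 : ten 1 1 = 1.
Proof. exact: (rmorph1 (quotalg_proj (gen_ideal (@tensor_rel K (opposite A) A)))). Qed.

Lemma ten_ind (P : enveloping A -> Prop) :
  P 0 -> (forall s t, P s -> P t -> P (s + t)) -> (forall a b, P (ten a b)) ->
  forall t, P t.
Proof.
move=> P0 PD Pt t; have [x <-] := quotalg_proj_surj t.
pose p : {linear pre -> enveloping A} := pr.
suff : P (p x) by [].
rewrite [x](freemodE (x : freemod K _)) (linear_sum p).
elim/big_ind: _ => // -[a b] _; rewrite (linearZ_LR p).
have -> : p (fm_base K (a, b)) = ten a b by [].
by rewrite -tenZl.
Qed.

Section Lift.
Variables (V : lmodType K) (f : A -> A -> V).
Hypotheses (fl : forall b, linear (f ^~ b)) (fr : forall a, linear (f a)).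

Let fp : {linear pre -> V} :=
  fm_lift (fun p : opposite A * A => f p.1 p.2 : V).
Let fp_base (a : opposite A) (b : A) : fp (fm_base K (a, b)) = f a b.
Proof. exact: fm_lift_base. Qed.

Fact ten_lift_kill t : gen_ideal (@tensor_rel K (opposite A) A) t -> fp t = 0.
Proof.
apply: tensor_rel_kill => {}t [a a' b|a b b'|c a b|c a b].
- rewrite !linearB !fp_base; have := fl b 1 a a'; rewrite !scale1r => ->.
  by rewrite addrAC addrK subrr.
- rewrite !linearB !fp_base; have := fr a 1 b b'; rewrite !scale1r => ->.
  by rewrite addrAC addrK subrr.
- rewrite linearB linearZ /= !fp_base.
  have f0 : f 0 b = 0.
    by have := fl b 1 0 0; rewrite !scale1r addr0 => /(canLR (addrK _)); rewrite subrr.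
  by have := fl b c a 0; rewrite !addr0 f0 addr0 => ->; rewrite subrr.
- rewrite linearB linearZ /= !fp_base.
  have f0 : f a 0 = 0.
    by have := fr a 1 0 0; rewrite !scale1r addr0 => /(canLR (addrK _)); rewrite subrr.
  by have := fr a c b 0; rewrite !addr0 f0 addr0 => ->; rewrite subrr.
Qed.

Definition ten_lift : {linear enveloping A -> V} := quot_lift ten_lift_kill.
Lemma ten_liftE a b : ten_lift (ten a b) = f a b.
Proof. by apply: (etrans (quot_liftE _ _)); apply: fp_base. Qed.
End Lift.

End Enveloping.

(** The enveloping algebra and A as a module over it, reduced to the calculus of
pure tensors: nothing else about A^e enters the resolution. The maps [es_coef]
take the place of the universal property of the tensor product: a functional on
the right factor turns A^e into A. *)
Record env_structure (K : fieldType) (A : kalg K) := EnvStructure {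
  es_alg : kalg K;
  es_ten : A -> A -> es_alg;
  es_tenDl : forall a a' b, es_ten (a + a') b = es_ten a b + es_ten a' b;
  es_tenDr : forall a b b', es_ten a (b + b') = es_ten a b + es_ten a b';
  es_tenZl : forall c a b, es_ten (c *: a) b = c *: es_ten a b;
  es_tenZr : forall c a b, es_ten a (c *: b) = c *: es_ten a b;
  es_tenM : forall a b c d, es_ten a b * es_ten c d = es_ten (c * a) (b * d);
  es_ten11 : es_ten 1 1 = 1;
  es_ind : forall P : es_alg -> Prop,
    P 0 -> (forall s t, P s -> P t -> P (s + t)) ->
    (forall a b, P (es_ten a b)) -> forall t, P t;
  es_coef : {linear A -> K^o} -> {linear es_alg -> A};
  es_coefE : forall f a b, es_coef f (es_ten a b) = (f b : K) *: a;
  es_mod : lmodType es_alg;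
  es_in : {additive A -> es_mod};
  es_out : {additive es_mod -> A};
  es_inK : cancel es_in es_out;
  es_outK : cancel es_out es_in;
  es_act : forall a b x, es_ten a b *: es_in x = es_in (b * x * a) }.

Section EnvelopingStructure.
Variables (K : fieldType) (A : kalg K).

Fact coef_linl (f : {linear A -> K^o}) b : linear (fun a : A => (f b : K) *: a : A).
Proof. by move=> c x y; rewrite scalerDr !scalerA mulrC. Qed.
Fact coef_linr (f : {linear A -> K^o}) a : linear (fun b : A => (f b : K) *: a : A).
Proof. by move=> c x y; rewrite linearP scalerDl scalerA. Qed.
Definition env_coef (f : {linear A -> K^o}) : {linear enveloping A -> A} :=
  ten_lift (V := A) (f := fun a b => (f b : K) *: a) (coef_linl f) (coef_linr f).

Definition bimod_in (x : A) : bimod A := x.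
Definition bimod_out (x : bimod A) : A := x.
Fact bimod_in_additive : zmod_morphism bimod_in. Proof. by []. Qed.
Fact bimod_out_additive : zmod_morphism bimod_out. Proof. by []. Qed.
HB.instance Definition _ :=
  GRing.isZmodMorphism.Build A (bimod A) bimod_in bimod_in_additive.
HB.instance Definition _ :=
  GRing.isZmodMorphism.Build (bimod A) A bimod_out bimod_out_additive.

Definition enveloping_structure : env_structure A.
Proof.
apply: (@EnvStructure K A (enveloping A) (@ten K A) (@tenDl K A) (@tenDr K A)
  (@tenZl K A) (@tenZr K A) (@tenM K A) (@ten11 K A) (@ten_ind K A) env_coef
  _ (bimod A) bimod_in bimod_out).
- by move=> f a b; apply: ten_liftE.
- by [].
- by [].
- by move=> a b x; apply: bimodE.
Defined.
End EnvelopingStructure.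

(** * The blocks of the resolution *)

(** Every term of a block has at most three generators, named by [sym]. *)
Inductive sym := sA | sB | sC.
Definition sym_code (s : sym) : 'I_3 :=
  match s with sA => Ordinal (isT : 0 < 3)%N | sB => Ordinal (isT : 1 < 3)%N
  | sC => Ordinal (isT : 2 < 3)%N end.
Definition all_sym := [:: sA; sB; sC].
Definition sym_decode (i : 'I_3) : sym := nth sA all_sym i.
Fact sym_codeK : cancel sym_code sym_decode. Proof. by case. Qed.
HB.instance Definition _ := Finite.copy sym (can_type sym_codeK).

(** The blocks repeat with period 2 from degree 5 on, so that a computation at
the classes 0, ..., 6 covers all degrees. *)
Definition cls (m : nat) : nat := if (m < 5)%N then m else (if odd m then 5 else 6)%N.

(** The source and the target of the generators of R_m. They are the vertices in
degree 0, the arrows ε, α, β in degree 1, and the relations ε² - (αβ)², εα, βε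
in degree 2. *)
Definition sym_type (m : nat) (s : sym) : option (bool * bool) :=
  match m, s with
  | 0, sA => Some (true, true) | 0, sB => Some (false, false) | 0, sC => None
  | 1, sA | 2, sA => Some (true, true)
  | 1, sB | 2, sB => Some (true, false)
  | 1, sC | 2, sC => Some (false, true)
  | 3, sC => Some (false, false)
  | _, sC => None
  | _, _ => Some (true, true)
  end.

(** [(x, s, y)] is the element x s y of the bimodule generated by the symbols. *)
Definition key : Type := (bas * sym * bas)%type.

Definition pos (x : bas) (s : sym) (y : bas) : int * key := (1, (x, s, y)).
Definition neg (x : bas) (s : sym) (y : bas) : int * key := (-1, (x, s, y)).

(** From degree 5 on the differential is a 2 by 2 matrix with entries l ± r, for
the left and right multiplications l and r by ε and by αβ on
A e1 (x) e1 A. These two elements generate the commutative local ring e1 A e1,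
and the square of the differential vanishes because these operators commute and
(l - r)(l + r) = l² - r² is the same for ε as for αβ. *)
Definition d_even (s : sym) : lform key :=
  match s with
  | sA => [:: pos ep sA e1; neg e1 sA ep; neg ab sB e1; pos e1 sB ab]
  | sB => [:: pos ab sA e1; pos e1 sA ab; neg ep sB e1; neg e1 sB ep]
  | sC => [::]
  end.
Definition d_odd (s : sym) : lform key :=
  match s with
  | sA => [:: pos ep sA e1; pos e1 sA ep; neg ab sB e1; pos e1 sB ab]
  | sB => [:: pos ab sA e1; pos e1 sA ab; neg ep sB e1; pos e1 sB ep]
  | sC => [::]
  end.

(** The differential inside a block: commutators with the vertices in degree 1,
noncommutative derivatives of the relations in degree 2, overlaps of the
relations in degree 3. Degree 4 has two terms more than the periodic part,
because R_3 still has a generator at the vertex 2. *)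
Definition d_tab (c : nat) (s : sym) : lform key :=
  match c, s with
  | 0, _ => [::]
  | 1, sA => [:: pos ep sA e1; neg e1 sA ep]
  | 1, sB => [:: pos al sB e2; neg e1 sA al]
  | 1, sC => [:: pos be sA e1; neg e2 sB be]
  | 2, sA => [:: pos e1 sA ep; pos ep sA e1; neg e1 sB bab; neg al sC ab;
                 neg ab sB be; neg aba sC e1]
  | 2, sB => [:: pos ep sB e2; pos e1 sA al]
  | 2, sC => [:: pos be sA e1; pos e2 sC ep]
  | 3, sA => [:: neg ab sA e1; pos e1 sA ab; pos al sC ep; neg ep sB be]
  | 3, sB => [:: neg ep sA e1; pos e1 sA ep; neg e1 sB bab; pos aba sC e1]
  | 3, sC => [:: pos e2 sC al; neg be sB e2]
  | 4, sA => d_even sA ++ [:: pos al sC bab; neg aba sC be]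
  | 5, _ => d_odd s
  | _, _ => d_even s
  end.

(** The map R_m -> R_(m+3) to the previous block. On R_0 it picks the cycles of
degree 3 that span H_3(R), which is a second copy of A; in the other degrees it
is an extension that anticommutes with the differential. *)
Definition t_tab (c : nat) (s : sym) : lform key :=
  match c, s with
  | 0, sA => [:: neg ab sB e1; neg e1 sA ep; pos al sC bab]
  | 0, sB => [:: pos e2 sC bb; pos bb sC e2; neg be sB al]
  | 1, sA => [:: pos e1 sA ep]
  | 1, sC => [:: neg be sA e1]
  | 2, sA => [:: neg e1 sA ep; neg ab sB e1]
  | 0, _ | 1, _ | 2, _ => [::]
  | _, sC => [::]
  | 3, sA | 5, sA => [:: pos ab sA e1]
  | 3, sB | 5, sB => [:: neg e1 sA ep]
  | _, sA => [::]
  | _, sB => [:: neg e1 sA ep; neg ab sB e1]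
  end.

(** A contraction of the block, linear for right multiplication by A: the entry
at [(s, x)] is the image of the generator s multiplied on the left by x. *)
Definition h_tab (c : nat) (s : sym) (x : bas) : lform key :=
  match c, s, x with
  | 0, sA, ab => [:: pos al sC e1; pos e1 sB be]
  | 0, sB, aba => [:: pos al sC al; pos e1 sB ba; pos ab sB e2]
  | 0, sB, al => [:: pos e1 sB e2]
  | 0, sB, ba => [:: pos be sB e2; pos e2 sC al]
  | 0, sA, bab => [:: pos ba sC e1; pos e2 sC ab; pos be sB be]
  | 0, sB, bb => [:: pos ba sC al; pos e2 sC aba; pos bab sB e2; pos be sB ba]
  | 0, sA, be => [:: pos e2 sC e1]
  | 0, sA, ep => [:: pos e1 sA e1]
  | 0, sA, aa => [:: pos e1 sB bab; pos aba sC e1; pos al sC ab; pos ab sB be]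
  | 0, _, _ => [::]
  | 1, sA, ab => [:: pos al sC e1]
  | 1, sA, bab => [:: pos ba sC e1]
  | 1, sC, bb => [:: pos e2 sC ep; neg be sA e1]
  | 1, sA, be => [:: pos e2 sC e1]
  | 1, sA, ep => [:: pos e1 sA e1]
  | 1, sB, ep => [:: pos e1 sB e2]
  | 1, sA, aa => [:: pos aba sC e1]
  | 1, sB, aa => [:: pos ep sB e2; neg e1 sA al]
  | 1, _, _ => [::]
  | 2, sA, ab => [:: neg e1 sA e1]
  | 2, sB, ab => [:: neg al sC e2]
  | 2, sA, bab => [:: neg be sA e1]
  | 2, sB, bab => [:: neg ba sC e2]
  | 2, sC, bb => [:: pos be sB e1; neg e2 sC bab]
  | 2, sB, be => [:: neg e2 sC e2]
  | 2, sA, ep => [:: neg e1 sB e1]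
  | 2, sA, aa => [:: neg e1 sB ep; neg ep sB e1]
  | 2, sB, aa => [:: neg aba sC e2]
  | 2, _, _ => [::]
  | _, sA, ep => [:: pos e1 sA e1]
  | _, sA, ab => [:: pos e1 sB e1]
  | _, sA, bab => [:: pos be sB e1]
  | _, sB, bab => [:: neg be sA e1]
  | _, sA, aa => [:: pos ab sB e1; neg e1 sB ab]
  | _, sB, aa => [:: neg ep sB e1; pos e1 sA ab]
  | _, _, _ => [::]
  end.

(** A right linear map R_3 -> R_0 that vanishes on boundaries and inverts
[t_tab] on the copy of A in H_3(R). *)
Definition g_tab (s : sym) (x : bas) : lform key :=
  match s, x with
  | sA, ep | sB, ab => [:: neg e1 sA e1]
  | sA, aa => [:: neg e1 sA ep]
  | sB, aa => [:: neg e1 sA ab]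
  | sB, bab => [:: neg e2 sB be]
  | sC, bb => [:: pos e2 sB e2]
  | _, _ => [::]
  end.

Definition mul_l (x : bas) (l : lform key) : lform key :=
  pmap (fun p => if bmul x p.2.1.1 is Some x' then
                   Some (p.1, (x', p.2.1.2, p.2.2)) else None) l.
Definition mul_r (y : bas) (l : lform key) : lform key :=
  pmap (fun p => if bmul p.2.2 y is Some y' then
                   Some (p.1, (p.2.1, y')) else None) l.

Definition d_key m (k : key) := mul_l k.1.1 (mul_r k.2 (d_tab (cls m) k.1.2)).
Definition t_key m (k : key) := mul_l k.1.1 (mul_r k.2 (t_tab (cls m) k.1.2)).
Definition h_key m (k : key) := mul_r k.2 (h_tab (cls m) k.1.2 k.1.1).
Definition g_key (k : key) := mul_r k.2 (g_tab k.1.2 k.1.1).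

Definition key_ok m (k : key) : bool :=
  if sym_type (cls m) k.1.2 is Some (i, j) then (btgt k.1.1 == i) && (bsrc k.2 == j)
  else false.
Definition keys_ok m (l : lform key) := all (fun p => key_ok m p.2) l.

Lemma cls_tail m : cls m.+4.+1 = (if odd m then 6 else 5)%N.
Proof. by rewrite /cls /= !negbK; case: odd. Qed.

Definition all_sb (P : sym -> bas -> bool) :=
  all (fun s => all (P s) all_bas) all_sym.
Lemma all_sbP P : all_sb P -> forall s x, P s x.
Proof.
move=> /allP aP s x; have /allP : all (P s) all_bas by apply: aP; case: s.
by apply; case: x.
Qed.

(** Degrees up to 8 are decided one by one, since an identity in degree m may
involve R_(m+4); from there on all classes depend on the parity of m only. *)
Ltac by_class m :=
  do 9 (case: m => [|m]; first by vm_compute);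
  rewrite !cls_tail; cbn [odd]; rewrite ?negbK; case: (odd m); by vm_compute.

(* A statement about generators alone is also quantified over a monomial, here
fixed to be [e1], to be decided by [all_sb]. *)
Lemma d_tab_ok m s : keys_ok m (d_tab (cls m.+1) s).
Proof.
move: s e1; apply/all_sbP. rewrite /keys_ok /key_ok.
by_class m. Qed.
Lemma t_tab_ok m s : keys_ok m.+3 (t_tab (cls m) s).
Proof. move: s e1; apply/all_sbP; rewrite /keys_ok /key_ok; by_class m. Qed.
Lemma h_tab_ok m s x : keys_ok m.+1 (h_tab (cls m) s x).
Proof. move: s x; apply/all_sbP; rewrite /keys_ok /key_ok; by_class m. Qed.
Lemma g_tab_ok s x : keys_ok 0 (g_tab s x).
Proof. by move: s x; apply/all_sbP. Qed.

(** Sorted by the change of the block number, (d + t)² = 0 means that d² = 0,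
dt + td = 0 and t² = 0. *)
Lemma d_d_zero m s : lzero (lbind (d_tab (cls m.+1) s) (d_key m)).
Proof. move: s e1; apply/all_sbP; rewrite /d_key; by_class m. Qed.

Lemma d_t_zero0 s : lzero (lbind (t_tab (cls 0) s) (d_key 3)).
Proof. by move: s e1; apply/all_sbP. Qed.
Lemma d_t_zero m s :
  lzero (lbind (d_tab (cls m.+1) s) (t_key m) ++
         lbind (t_tab (cls m.+1) s) (d_key m.+4)).
Proof. move: s e1; apply/all_sbP; rewrite /d_key /t_key; by_class m. Qed.
Lemma t_t_zero m s : lzero (lbind (t_tab (cls m) s) (t_key m.+3)).
Proof. move: s e1; apply/all_sbP; rewrite /t_key; by_class m. Qed.

(** Homotopies are determined on the keys whose right factor is an idempotent. *)
Definition lkey_ok m (s : sym) (x : bas) : bool :=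
  if sym_type (cls m) s is Some (i, j) then btgt x == i else false.
Definition rtgt m (s : sym) : bas :=
  if sym_type (cls m) s is Some (i, j) then idem j else e1.

(** The composite of the augmentation R_0 -> A with its right linear section
x |-> e_i (x) x, for x with source i. *)
Definition sigma (x : bas) : lform key :=
  [:: pos (idem (bsrc x)) (if bsrc x then sA else sB) x].

(** The contracting identities: dh + sigma = 1 in degree 0, tg + dh + hd = 1 in
degree 3, and dh + hd = 1 in all other degrees. Moreover gt = sigma, so that the
second copy of A cancels against the augmentation of the next block. *)
Lemma h_zero s x : lkey_ok 0 s x ->
  lequiv (lbind (h_key 0 (x, s, rtgt 0 s)) (d_key 1) ++ sigma x) [:: pos x s (rtgt 0 s)].
Proof. by apply/implyP; move: s x; apply/all_sbP; vm_compute. Qed.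

Lemma g_zero s x : lkey_ok 0 s x ->
  lequiv (lbind (t_key 0 (x, s, rtgt 0 s)) g_key) (sigma x).
Proof. by apply/implyP; move: s x; apply/all_sbP; vm_compute. Qed.

Lemma h_succ m s x : lkey_ok m.+1 s x ->
  lequiv (lbind (h_key m.+1 (x, s, rtgt m.+1 s)) (d_key m.+2) ++
          lbind (d_key m.+1 (x, s, rtgt m.+1 s)) (h_key m) ++
          (if m == 2 then lbind (g_key (x, s, rtgt m.+1 s)) (t_key 0) else [::]))
         [:: pos x s (rtgt m.+1 s)].
Proof.
apply/implyP; move: s x; apply/all_sbP.
rewrite /d_key /h_key /lkey_ok /rtgt; by_class m.
Qed.

Lemma g_d_zero s x : lzero (lbind (d_key 4 (x, s, rtgt 4 s)) g_key).
Proof. by move: s x; apply/all_sbP; vm_compute. Qed.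

(** A free module is used only through its universal property and its
coordinates. *)
Record free_module (R : pzRingType) (X : choiceType) := FreeModule {
  fr_mod :> lmodType R;
  fr_base : X -> fr_mod;
  fr_coef : X -> fr_mod -> R;
  fr_supp : fr_mod -> seq X;
  fr_lift : forall W : lmodType R, (X -> W) -> {linear fr_mod -> W};
  fr_coefP : forall g c u v, fr_coef g (c *: u + v) = c * fr_coef g u + fr_coef g v;
  fr_coef_base : forall g h, fr_coef g (fr_base h) = (h == g)%:R;
  fr_uniq : forall v, uniq (fr_supp v);
  fr_out : forall v g, g \notin fr_supp v -> fr_coef g v = 0;
  fr_expand : forall v, v = \sum_(g <- fr_supp v) fr_coef g v *: fr_base g;
  fr_lift_base : forall (W : lmodType R) (f : X -> W) g, fr_lift f (fr_base g) = f g }.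

Definition freemod_free (R : pzRingType) (X : choiceType) : free_module R X.
Proof.
apply: (@FreeModule R X (freemod R X) (@fm_base R X) (@mcoeff X R)
  (fun v => msupp v) (@fm_lift R X)).
- by move=> g c u v; rewrite mcoeffD fm_scaleE.
- by move=> g h; rewrite fm_baseE.
- by move=> v; apply: fset_uniq.
- by move=> v g /mcoeff_outdom.
- exact: freemodE.
- by move=> W f g; apply: fm_lift_base.
Defined.

Section FreeModuleTheory.
Variables (R : pzRingType) (X : choiceType) (V : free_module R X).

Lemma fr_coef0 g : fr_coef g (0 : V) = 0.
Proof.
have := fr_coefP g 1 (0 : V) 0; rewrite scale1r mul1r addr0.
by move/(canLR (addrK _)); rewrite subrr.
Qed.
Lemma fr_coefZ g c (u : V) : fr_coef g (c *: u) = c * fr_coef g u.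
Proof. by have := fr_coefP g c u 0; rewrite fr_coef0 !addr0. Qed.
Lemma fr_coefD g (u v : V) : fr_coef g (u + v) = fr_coef g u + fr_coef g v.
Proof. by have := fr_coefP g 1 u v; rewrite scale1r mul1r. Qed.
Lemma fr_coefN g (u : V) : fr_coef g (- u) = - fr_coef g u.
Proof. by rewrite -scaleN1r fr_coefZ mulN1r. Qed.

Lemma fr_ext (W : lmodType R) (f h : {linear V -> W}) :
  (forall g, f (fr_base V g) = h (fr_base V g)) -> forall v, f v = h v.
Proof.
move=> fh v; rewrite [v]fr_expand !linear_sum; apply: eq_bigr => g _.
by rewrite !linearZ /= fh.
Qed.

Lemma fr_expand_in (s : seq X) (v : V) : uniq s ->
  (forall g, g \notin s -> fr_coef g v = 0) ->
  v = \sum_(g <- s) fr_coef g v *: fr_base V g.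
Proof.
move=> us out; rewrite {1}[v]fr_expand.
rewrite [LHS](bigID (mem s)) [RHS](bigID (mem (fr_supp v))) /=.
rewrite [X in _ + X]big1 => [|g /out ->]; last exact: scale0r.
rewrite [X in _ = _ + X]big1 => [|g /fr_out ->]; last exact: scale0r.
rewrite [LHS]addr0 [RHS]addr0 -[LHS]big_filter -[RHS]big_filter.
apply: perm_big; apply: uniq_perm => [||g].
- by rewrite filter_uniq ?fr_uniq.
- by rewrite filter_uniq.
- by rewrite !mem_filter andbC.
Qed.
End FreeModuleTheory.

Section Blocks.
Variables (K : fieldType) (A : kalg K) (M : monomial_basis A).
Variable E : env_structure A.

Local Notation Lam := (es_alg E).
Local Notation ten := (es_ten E).
Local Notation gen := (nat * sym)%type.
Variable V : free_module Lam (nat * sym)%type.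
Local Notation mb := (mb M).

Lemma ten0l b : ten 0 b = 0.
Proof. by apply: (addIr (ten 0 b)); rewrite -es_tenDl !add0r. Qed.
Lemma ten0r a : ten a 0 = 0.
Proof. by apply: (addIr (ten a 0)); rewrite -es_tenDr !add0r. Qed.

Lemma tenBl a a' b : ten (a - a') b = ten a b - ten a' b.
Proof. by apply: (addIr (ten a' b)); rewrite -es_tenDl !subrK. Qed.

(** The scalar a (x) b acts on bimodules by x |-> b x a, so the left factor of a
key is the second factor of the tensor. *)
Definition key_elt (k : nat) (q : key) : V :=
  ten (mb q.2) (mb q.1.1) *: fr_base V (k, q.1.2).

Lemma ten_split a b : ten a b = ten 1 b * ten a 1.
Proof. by rewrite es_tenM mulr1 mulr1. Qed.

Lemma ev_mul_l x k l :
  ten 1 (mb x) *: ev (key_elt k) l = ev (key_elt k) (mul_l x l).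
Proof.
elim: l => [|[c [[x' s] y]] l IHl]; first by rewrite ev_nil scaler0.
rewrite ev_cons scalerDr IHl -scalerMzr /key_elt scalerA es_tenM mulr1 mbM /=.
by case: bmul => [z|]; rewrite ?ev_cons //= ten0r scale0r mul0rz add0r.
Qed.

Lemma ev_mul_r y k l :
  ten (mb y) 1 *: ev (key_elt k) l = ev (key_elt k) (mul_r y l).
Proof.
elim: l => [|[c [[x s] y']] l IHl]; first by rewrite ev_nil scaler0.
rewrite ev_cons scalerDr IHl -scalerMzr /key_elt scalerA es_tenM mul1r mbM /=.
by case: bmul => [z|]; rewrite ?ev_cons //= ten0l scale0r mul0rz add0r.
Qed.

Lemma ev_mul x y k l : ten (mb y) (mb x) *: ev (key_elt k) l =
  ev (key_elt k) (mul_l x (mul_r y l)).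
Proof. by rewrite ten_split -scalerA ev_mul_r ev_mul_l. Qed.

(** The differential of the n-th term: [d] stays in the k-th block and [t]
moves to the block k - 1. *)
Definition D_gen (n : nat) (g : gen) : V :=
  let: (k, s) := g in
  if (4 * k <= n)%N then
    ev (key_elt k) (d_tab (cls (n - 4 * k)) s) +
    (if k is k'.+1 then ev (key_elt k') (t_tab (cls (n - 4 * k)) s) else 0)
  else 0.

Definition D (n : nat) : {linear V -> V} := fr_lift V (D_gen n).

Lemma D_base n g : D n (fr_base V g) = D_gen n g.
Proof. exact: fr_lift_base. Qed.

Lemma D_key n k q : (4 * k <= n)%N -> D n (key_elt k q) =
  ev (key_elt k) (d_key (n - 4 * k) q) +
  (if k is k'.+1 then ev (key_elt k') (t_key (n - 4 * k) q) else 0).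
Proof.
move=> kn; rewrite {1}/key_elt (linearZ_LR (D n)) D_base /D_gen kn scalerDr ev_mul.
by apply: (f_equal2 +%R (erefl _)); case: k {kn} => [|k]; [exact: scaler0|exact: ev_mul].
Qed.

Lemma D_ev n k l : (4 * k <= n)%N -> D n (ev (key_elt k) l) =
  ev (key_elt k) (lbind l (d_key (n - 4 * k))) +
  (if k is k'.+1 then ev (key_elt k') (lbind l (t_key (n - 4 * k))) else 0).
Proof.
move=> kn; rewrite raddf_ev (eq_ev (G := fun q => _) _ (fun q => D_key q kn)).
rewrite ev_add ev_bind; congr (_ + _).
by case: k kn => [|k] kn; rewrite ?ev_bind ?ev_0.
Qed.

Lemma D_gen_sq n k s : D n (D_gen n.+1 (k, s)) = 0.
Proof.
rewrite /D_gen; case: ifP => [kn|_]; last exact: linear0.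
case m_def: (n.+1 - 4 * k)%N => [|m].
  case: k kn m_def => [|k] kn m_def; first by lia.
  have -> : d_tab (cls 0) s = [::] by [].
  rewrite ev_nil add0r D_ev; last by lia.
  have -> : (n - 4 * k = 3)%N by lia.
  rewrite (ev_zero _ (d_t_zero0 s)) add0r; case: k {kn m_def} => // k.
  exact: (ev_zero _ (t_t_zero 0 s)).
rewrite linearD D_ev; last by lia.
have -> : (n - 4 * k = m)%N by lia.
rewrite (ev_zero _ (d_d_zero m s)) add0r.
case: k kn m_def => [|k] kn m_def; first by rewrite linear0 addr0.
rewrite D_ev; last by lia.
have -> : (n - 4 * k = m.+4)%N by lia.
rewrite addrA -ev_cat (ev_zero _ (d_t_zero m s)) add0r.
case: k {kn m_def} => // k; exact: (ev_zero _ (t_t_zero m.+1 s)).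
Qed.

Lemma D_D n v : D n (D n.+1 v) = 0.
Proof.
apply: (fr_ext (f := D n \o D n.+1) (h := \0)) v => -[k s].
exact: (etrans (congr1 (D n) (D_base n.+1 (k, s))) (D_gen_sq n k s)).
Qed.

(** The n-th term is a direct summand of a free module: the coefficient of a
generator from vertex i to vertex j lies in the left ideal of e_j (x) e_i. *)
Definition gen_idem (n : nat) (g : gen) : Lam :=
  let: (k, s) := g in
  if (4 * k <= n)%N then
    if sym_type (cls (n - 4 * k)) s is Some (i, j) then
      ten (mb (idem j)) (mb (idem i)) else 0
  else 0.

Definition in_term n (v : V) := forall g, fr_coef g v * gen_idem n g = fr_coef g v.
Fact in_term0 n : in_term n 0.
Proof. by move=> g; rewrite fr_coef0 mul0r. Qed.
Fact in_termP n a u v : in_term n u -> in_term n v -> in_term n (a *: u + v).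
Proof. by move=> un vn g; rewrite fr_coefP mulrDl -mulrA un vn. Qed.
Definition term n : submodule V := Submodule (in_term0 n) (@in_termP n).

Lemma smem_mulz (S : submodule V) u (c : int) : S u -> S (u *~ c).
Proof. by move=> Su; rewrite -scaler_int; apply: smemZ. Qed.

Lemma smem_ev (S : submodule V) k l :
  (forall q, q \in map snd l -> S (key_elt k q)) -> S (ev (key_elt k) l).
Proof.
elim: l => [|[c q] l IHl] Sl; first by rewrite ev_nil; apply: smem0.
rewrite ev_cons; apply: smemD; first by apply/smem_mulz/Sl; rewrite inE eqxx.
by apply: IHl => q' q'l; apply: Sl; rewrite inE q'l orbT.
Qed.

Lemma key_elt_term n k q : (4 * k <= n)%N -> key_ok (n - 4 * k) q ->
  term n (key_elt k q).
Proof.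
case: q => -[x s] y kn; rewrite /key_ok /= => qok g.
rewrite fr_coefZ fr_coef_base /=.
have [<-|_] := eqVneq; last by rewrite mulr0 mul0r.
rewrite mulr1 /gen_idem kn.
case: sym_type qok => [[i j]|//] /andP[/eqP xi /eqP yj].
by rewrite es_tenM !mbM bmul_idem_l bmul_idem_r xi yj !eqxx.
Qed.

Lemma ev_term n k l : (4 * k <= n)%N -> keys_ok (n - 4 * k) l ->
  term n (ev (key_elt k) l).
Proof.
move=> kn /allP lok; apply: smem_ev => q /mapP[p pl ->].
by apply: key_elt_term => //; apply: lok.
Qed.

Lemma D_term n v : term n (D n.+1 v).
Proof.
rewrite [v]fr_expand linear_sum; apply: (big_ind (term n)) => [||[k s] _].
- exact: smem0.
- by move=> u w; apply: smemD.
rewrite (linearZ_LR (D n.+1)); apply: smemZ; rewrite D_base /D_gen.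
case: ifP => [kn|_]; last exact: smem0.
apply: smemD.
  case m_def: (n.+1 - 4 * k)%N => [|m]; first by rewrite ev_nil; apply: smem0.
  by apply: ev_term; [lia|have -> : (n - 4 * k = m)%N by lia]; apply: d_tab_ok.
case: k kn => [|k] kn; first exact: smem0.
apply: ev_term; first by lia.
have -> : (n - 4 * k = (n.+1 - 4 * k.+1).+3)%N by lia.
exact: t_tab_ok.
Qed.

(** * Exactness *)

(** As a right A-module A^e is free on the eleven monomials of the left factor;
[lcoef_of x] is the coordinate at x. *)
Definition lcoef_of (x : bas) (t : Lam) : A := es_coef E (crd M x) t.

Lemma lcoefD x s t : lcoef_of x (s + t) = lcoef_of x s + lcoef_of x t.
Proof. exact: linearD. Qed.
Lemma lcoefB x s t : lcoef_of x (s - t) = lcoef_of x s - lcoef_of x t.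
Proof. exact: linearB. Qed.
Lemma lcoef0 x : lcoef_of x 0 = 0.
Proof. exact: linear0. Qed.

Lemma lcoef_ten x a y : lcoef_of x (ten a (mb y)) = (x == y)%:R *: a.
Proof. by rewrite /lcoef_of es_coefE crd_mb. Qed.

Lemma lcoef_mulr x a t : lcoef_of x (ten a 1 * t) = lcoef_of x t * a.
Proof.
elim/es_ind: t => [|s t IHs IHt|b c]; first by rewrite mulr0 lcoef0 mul0r.
  by rewrite mulrDr !lcoefD IHs IHt mulrDl.
by rewrite es_tenM mul1r /lcoef_of !es_coefE kscalerAl.
Qed.

Lemma es_ten_sum a (I : finType) (F : I -> A) :
  ten a (\sum_i F i) = \sum_i ten a (F i).
Proof. by apply: (big_morph _ (es_tenDr E a) (ten0r a)). Qed.

Lemma lcoef_expand t : t = \sum_x ten (lcoef_of x t) (mb x).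
Proof.
elim/es_ind: t => [|s t IHs IHt|a b].
- by rewrite big1 // => x _; rewrite lcoef0 ten0l.
- rewrite {1}IHs {1}IHt -big_split; apply: eq_bigr => x _.
  by rewrite lcoefD es_tenDl.
- rewrite {1}[b](mb_span M) es_ten_sum; apply: eq_bigr => x _.
  by rewrite /lcoef_of es_coefE es_tenZl es_tenZr.
Qed.

Definition gens (n : nat) : seq gen :=
  [seq (k, s) | k <- iota 0 (n %/ 4).+1, s <- all_sym].

Lemma gens_uniq n : uniq (gens n).
Proof. by apply: allpairs_uniq => //; [apply: iota_uniq|move=> [? ?] [? ?]]. Qed.

Lemma mem_gens n k s : ((k, s) \in gens n) = (4 * k <= n)%N.
Proof.
have kE j : (j \in iota 0 (n %/ 4).+1) = (4 * j <= n)%N.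
  by rewrite mem_iota; lia.
apply/allpairsP/idP => [[p [pk _ [-> _]]]|kn]; first by rewrite -kE.
by exists (k, s); rewrite kE; split=> //; case: s.
Qed.

(** The homotopy follows h inside a block and continues by g into the next one. It
is linear for right multiplication only, hence the expansion of the coefficients
in the monomials of the left factor. *)
Definition H_elt n (g : gen) (x : bas) : V :=
  let: (k, s) := g in
  ev (key_elt k) (h_tab (cls (n - 4 * k)) s x) +
  (if (n - 4 * k)%N == 3 then ev (key_elt k.+1) (g_tab s x) else 0).

Definition hmap n (v : V) : V :=
  \sum_(g <- gens n) \sum_x ten (lcoef_of x (fr_coef g v)) 1 *: H_elt n g x.

Fact hmap_additive n : zmod_morphism (hmap n).
Proof.
move=> u v; rewrite /hmap -sumrB; apply: eq_bigr => g _.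
rewrite -sumrB; apply: eq_bigr => x _.
by rewrite fr_coefD fr_coefN lcoefB tenBl scalerBl.
Qed.
HB.instance Definition _ n := GRing.isZmodMorphism.Build V V (hmap n) (hmap_additive n).

Lemma hmapD n u v : hmap n (u + v) = hmap n u + hmap n v.
Proof. exact: raddfD. Qed.
Lemma hmap0 n : hmap n 0 = 0.
Proof. exact: raddf0. Qed.

Lemma hmap_sum n I (r : seq I) (P : pred I) (F : I -> V) :
  hmap n (\sum_(i <- r | P i) F i) = \sum_(i <- r | P i) hmap n (F i).
Proof. exact: raddf_sum. Qed.

Lemma hmap_tenr n a v : hmap n (ten a 1 *: v) = ten a 1 *: hmap n v.
Proof.
rewrite /hmap scaler_sumr; apply: eq_bigr => g _; rewrite scaler_sumr.
apply: eq_bigr => x _; rewrite fr_coefZ lcoef_mulr scalerA es_tenM.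
by rewrite mulr1.
Qed.

Lemma hmap_key n k q : (4 * k <= n)%N -> hmap n (key_elt k q) =
  ev (key_elt k) (h_key (n - 4 * k) q) +
  (if (n - 4 * k)%N == 3 then ev (key_elt k.+1) (g_key q) else 0).
Proof.
case: q => -[x s] y kn; rewrite /hmap.
rewrite (bigD1_seq (k, s)) ?mem_gens ?gens_uniq //= [X in _ + X]big1 => [|g gk].
  rewrite [LHS]addr0 (bigD1 x) //= [X in _ + X]big1 => [|z zx].
    rewrite [LHS]addr0 fr_coefZ fr_coef_base eqxx mulr1 lcoef_ten eqxx scale1r.
    rewrite scalerDr ev_mul_r; congr (_ + _).
    by case: ifP => _; [rewrite ev_mul_r|rewrite scaler0].
  rewrite fr_coefZ fr_coef_base eqxx mulr1 lcoef_ten (negbTE zx) scale0r.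
  by rewrite ten0l scale0r.
rewrite big1 // => z _; rewrite fr_coefZ fr_coef_base eq_sym (negbTE gk) mulr0.
by rewrite lcoef0 ten0l scale0r.
Qed.

Lemma hmap_ev n k l : (4 * k <= n)%N -> hmap n (ev (key_elt k) l) =
  ev (key_elt k) (lbind l (h_key (n - 4 * k))) +
  (if (n - 4 * k)%N == 3 then ev (key_elt k.+1) (lbind l g_key) else 0).
Proof.
move=> kn; rewrite raddf_ev (eq_ev (G := fun q => _) _ (fun q => hmap_key q kn)).
rewrite ev_add ev_bind; congr (_ + _).
by case: ifP => _; rewrite ?ev_bind ?ev_0.
Qed.

Lemma hmap_term n v : term n.+1 (hmap n v).
Proof.
rewrite /hmap big_seq; apply: (big_ind (term n.+1)) => [||[k s]].
- exact: smem0.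
- by move=> u w; apply: smemD.
rewrite mem_gens => kn; apply: (big_ind (term n.+1)) => [||x _].
- exact: smem0.
- by move=> u w; apply: smemD.
apply/smemZ/smemD.
  apply: ev_term; first by lia.
  have -> : (n.+1 - 4 * k = (n - 4 * k).+1)%N by lia.
  exact: h_tab_ok.
case: eqP => [k3|_]; last exact: smem0.
apply: ev_term; first by lia.
have -> : (n.+1 - 4 * k.+1 = 0)%N by lia.
exact: g_tab_ok.
Qed.

Lemma term_out n v k s : term n v -> (n < 4 * k)%N -> fr_coef (k, s) v = 0.
Proof.
by move=> vn kn; rewrite -(vn (k, s)) /gen_idem leqNgt kn /= mulr0.
Qed.

Lemma term_expand n v : term n v ->
  v = \sum_(g <- gens n) \sum_(x | lkey_ok (n - 4 * g.1) g.2 x)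
  ten (lcoef_of x (fr_coef g v)) 1 *:
    key_elt g.1 (x, g.2, rtgt (n - 4 * g.1) g.2).
Proof.
move=> vn; rewrite {1}(fr_expand_in (s := gens n) (v := v)) ?gens_uniq //; last first.
  by move=> [k s]; rewrite mem_gens -ltnNge => kn; apply: (term_out _ vn).
rewrite big_seq [RHS]big_seq; apply: eq_bigr => -[k s]; rewrite mem_gens => kn /=.
rewrite -{1}(vn (k, s)) /gen_idem kn {1}[fr_coef (k, s) v]lcoef_expand.
rewrite /lkey_ok /rtgt; case: sym_type => [[i j]|]; last by rewrite mulr0 scale0r big_pred0.
rewrite mulr_suml scaler_suml [RHS]big_mkcond; apply: eq_bigr => x _.
rewrite es_tenM mbM bmul_idem_r.
case: ifP => _; last by rewrite ten0r scale0r.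
by rewrite /key_elt scalerA es_tenM mul1r.
Qed.

(** Elements supported in the blocks below K0. *)
Definition low (K0 : nat) (v : V) := forall k s, (K0 <= k)%N -> fr_coef (k, s) v = 0.
Fact low_0 K0 : low K0 0.
Proof. by move=> k s _; rewrite fr_coef0. Qed.
Fact low_P K0 a u v : low K0 u -> low K0 v -> low K0 (a *: u + v).
Proof. by move=> ul vl k s kK; rewrite fr_coefP ul ?vl // mulr0 addr0. Qed.
Definition lows K0 : submodule V := Submodule (@low_0 K0) (@low_P K0).

Lemma ev_low K0 k l : (k < K0)%N -> lows K0 (ev (key_elt k) l).
Proof.
move=> kK; apply: smem_ev => q _ k' s Kk'; rewrite fr_coefZ fr_coef_base.
by have [[kk' _]|_] := eqVneq; [lia|rewrite mulr0].
Qed.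

(** The homotopy identity holds only up to lower blocks, because th + ht need not
vanish: the defect of an element of the blocks up to k lies in the blocks up to
k - 1. *)
Definition defect n (v : V) : V := v - D n.+2 (hmap n.+1 v) - hmap n (D n.+1 v).

Lemma defectD n u v : defect n (u + v) = defect n u + defect n v.
Proof.
rewrite /defect (linearD (D n.+1)) hmapD (linearD (D n.+2)).
by rewrite hmapD opprD addrACA opprD [LHS]addrACA.
Qed.

Lemma defect_tenr n a v : defect n (ten a 1 *: v) = ten a 1 *: defect n v.
Proof.
rewrite /defect hmap_tenr (linearZ_LR (D n.+2)) (linearZ_LR (D n.+1)) hmap_tenr.
by rewrite !scalerBr.
Qed.

Lemma ev_d_key0 k l : ev (key_elt k) (lbind l (d_key 0)) = 0.
Proof. by rewrite ev_bind (eq_ev (G := fun=> 0)) ?ev_0 // => t; apply: ev_nil. Qed.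

Lemma defect_key n k s x : (4 * k <= n.+1)%N -> lkey_ok (n.+1 - 4 * k) s x ->
  lows k (defect n (key_elt k (x, s, rtgt (n.+1 - 4 * k) s))).
Proof.
move=> kn; set m := (n.+1 - 4 * k)%N; set q := (x, s, _) => qok.
have m_def : (n.+1 - 4 * k)%N = m by [].
have qE : key_elt k q = ev (key_elt k) [:: pos x s (rtgt m s)].
  by rewrite ev_cons ev_nil addr0 mulr1z.
rewrite /defect hmap_key // D_key // m_def linearD D_ev; last by lia.
have -> : (n.+2 - 4 * k = m.+1)%N by lia.
clearbody m; case: m m_def @q qok qE => [|m] m_def q qok qE.
  case: k kn m_def qE => [|k] kn m_def qE; first by lia.
  have -> : d_key 0 q = [::] by [].
  have k3 : (n - 4 * k = 3)%N by lia.
  rewrite linear0 addr0 ev_nil add0r hmap_ev; last by lia.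
  rewrite k3 /= (ev_equiv _ (g_zero qok)) qE -(ev_equiv _ (h_zero qok)) ev_cat.
  set X := ev _ _; set S := ev _ (sigma x); set Y := ev _ _; set Z := ev _ _.
  have -> : X + S - (X + Y) - (Z + S) = - Y - Z.
    by rewrite [X + S]addrC addrKA [S - Y]addrC [Z + S]addrC addrKA.
  by apply: (@smemB _ _ (lows k.+1)); [apply: (@smemN _ _ (lows k.+1))|]; apply: ev_low.
have km : (n - 4 * k = m)%N by lia.
rewrite hmapD hmap_ev ?km; last by lia.
have -> : (if m == 3 then ev (key_elt k.+1) (lbind (d_key m.+1 q) g_key) else 0) = 0.
  by case: eqP => // m3; rewrite /q m3 (ev_zero _ (g_d_zero s x)).
have -> : D n.+2 (if m.+1 == 3 then ev (key_elt k.+1) (g_key q) else 0) =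
    ev (key_elt k) (if m == 2 then lbind (g_key q) (t_key 0) else [::]).
  rewrite eqSS; case: eqP => [m2|_]; last by rewrite linear0 ev_nil.
  rewrite D_ev; last by lia.
  have -> : (n.+2 - 4 * k.+1 = 0)%N by lia.
  by rewrite ev_d_key0 add0r.
have {1}-> : key_elt k q = ev (key_elt k) (lbind (h_key m.+1 q) (d_key m.+2)) +
    (ev (key_elt k) (lbind (d_key m.+1 q) (h_key m)) +
     ev (key_elt k) (if m == 2 then lbind (g_key q) (t_key 0) else [::])).
  by rewrite qE -(ev_equiv _ (h_succ qok)) !ev_cat.
set X := ev _ _; set Y := ev _ _; set W := ev _ _.
set l1 := match k with 0 => 0 | _ => _ end.
set l2 := hmap n _.
have -> : X + (Y + W) - (X + l1 + W) - (Y + 0 + l2) = - l1 - l2.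
  rewrite addr0 [X + (Y + W)]addrC -[X + l1 + W]addrA addrKA [l1 + W]addrC addrKA.
  by rewrite [Y - l1]addrC addrKA.
apply: (@smemB _ _ (lows k)); [apply: (@smemN _ _ (lows k))|].
  rewrite /l1; case: k {kn m_def qE km X Y W l1 l2} => [|k]; first exact: smem0.
  exact: ev_low.
rewrite /l2; case: k kn km m_def {qE X Y W l1 l2} => [|k] kn km m_def.
  by rewrite hmap0; apply: smem0.
rewrite hmap_ev; last by lia.
have -> : (n - 4 * k = m.+4)%N by lia.
by rewrite addr0; apply: ev_low.
Qed.

Lemma defect_low n K0 v : term n.+1 v -> lows K0.+1 v -> lows K0 (defect n v).
Proof.
move=> vn vlow; rewrite [v](term_expand vn) /=.
have defect_sum I (r : seq I) (P : pred I) (F : I -> V) :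
    defect n (\sum_(i <- r | P i) F i) = \sum_(i <- r | P i) defect n (F i).
  apply: (big_morph _ (defectD n)).
  by rewrite /defect linear0 hmap0 hmap0 linear0 !subr0.
rewrite defect_sum big_seq; apply: (big_ind (lows K0)) => [||[k s]].
- exact: smem0.
- by move=> u w; apply: smemD.
rewrite mem_gens defect_sum => kn; apply: (big_ind (lows K0)) => [||x xok].
- exact: smem0.
- by move=> u w; apply: smemD.
rewrite defect_tenr; have [Kk|kK] := ltnP K0 k.
  by rewrite vlow // lcoef0 ten0l scale0r; apply: smem0.
apply: smemZ => k' s' Kk'; apply: (defect_key kn xok); lia.
Qed.

Lemma term_low n v : term n v -> lows n.+1 v.
Proof. by move=> vn k s nk; apply: (term_out s vn); lia. Qed.

(** Subtracting the boundary of its image under the homotopy moves a cycle one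
block down, so finitely many steps exhaust it. *)
Lemma D_exact n v : term n.+1 v -> D n.+1 v = 0 ->
  exists2 z, term n.+2 z & D n.+2 z = v.
Proof.
move=> vn; move: (term_low vn); set K0 := (X in lows X); clearbody K0.
elim: K0 v vn => [|K0 IHK] v vn vlow Dv.
  exists 0; first exact: smem0.
  rewrite linear0 [v]fr_expand big1 // => -[k s] _.
  by rewrite vlow // scale0r.
have dE : defect n v = v - D n.+2 (hmap n.+1 v).
  by rewrite /defect Dv hmap0 subr0.
have [|||z zn zE] := IHK (defect n v).
- by rewrite dE; apply: smemB => //; apply: D_term.
- exact: defect_low.
- by rewrite dE linearB Dv D_D subrr.
exists (z + hmap n.+1 v).
  by apply: (@smemD _ _ (term n.+2)) => //; apply: hmap_term.
by rewrite linearD zE dE subrK.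
Qed.

Definition aug_gen (g : gen) : es_mod E :=
  match g with
  | (0, sA) => es_in E (mb e1) | (0, sB) => es_in E (mb e2) | _ => 0
  end.
Definition aug : {linear V -> es_mod E} := fr_lift V aug_gen.

Definition unit_elt : V := key_elt 0 (e1, sA, e1) + key_elt 0 (e2, sB, e2).

Lemma unit_elt_term : term 0 unit_elt.
Proof. by apply: smemD; apply: key_elt_term. Qed.

Lemma aug_key x s y : aug (key_elt 0 (x, s, y)) =
  es_in E (mb x * (match s with sA => mb e1 | sB => mb e2 | sC => 0 end) * mb y).
Proof.
rewrite /key_elt (linearZ_LR aug) /= fr_lift_base.
by case: s; rewrite /= ?es_act // mulr0 mul0r scaler0 raddf0.
Qed.

Lemma aug_unit_elt : aug unit_elt = es_in E 1.
Proof. by rewrite linearD !aug_key -raddfD !mbM /= ?mbM /= mb1. Qed.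

Lemma sigmaE x : ten (mb x) 1 *: unit_elt = ev (key_elt 0) (sigma x).
Proof.
have -> : unit_elt = ev (key_elt 0) [:: pos e1 sA e1; pos e2 sB e2].
  by rewrite !ev_cons ev_nil addr0 !mulr1z.
by rewrite ev_mul_r; apply: ev_equiv; case: x.
Qed.

Lemma aug_D v : aug (D 1 v) = 0.
Proof.
apply: (fr_ext (f := aug \o D 1) (h := \0)) v => -[k s].
rewrite -[LHS]/(aug (D 1 (fr_base V (k, s)))) D_base /D_gen.
case: k => [|k]; last by rewrite ifF ?linear0 //; lia.
rewrite (_ : (4 * 0 <= 1)%N = true) // addr0 (raddf_ev aug).
case: s; rewrite !ev_cons ev_nil /=;
by rewrite !aug_key !mbM /= ?mbM /= addr0 mulr1z mulrN1z subrr.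
Qed.

Lemma es_sum_ten (I : finType) (P : pred I) (F : I -> A) b :
  ten (\sum_(i | P i) F i) b = \sum_(i | P i) ten (F i) b.
Proof. exact: (big_morph (ten ^~ b) (fun a a' => es_tenDl E a a' b) (ten0l b)). Qed.

(** Only block 0 occurs in degree 0, where the contracting identity is exact:
v - D h v is the section of [aug v]. *)
Lemma aug_exact v : term 0 v -> aug v = 0 -> exists2 z, term 1 z & D 1 z = v.
Proof.
move=> vn augv; exists (hmap 0 v); first exact: hmap_term.
pose L s x := lcoef_of x (fr_coef (0%N, s) v).
have vE : v = \sum_s \sum_(x | lkey_ok 0 s x)
    ten (L s x) 1 *: key_elt 0 (x, s, rtgt 0 s).
  rewrite {1}(term_expand vn) big_allpairs (big_seq1 _ 0%N).
  have symE : perm_eq (index_enum sym) all_sym.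
    by apply: uniq_perm => [||[]]; rewrite ?index_enum_uniq ?mem_index_enum.
  by rewrite (perm_big _ symE).
pose b := \sum_s \sum_(x | lkey_ok 0 s x) mb x * L s x.
have bE : ten b 1 = \sum_s \sum_(x | lkey_ok 0 s x) ten (L s x) 1 * ten (mb x) 1.
  rewrite es_sum_ten; apply: eq_bigr => s _; rewrite es_sum_ten.
  by apply: eq_bigr => x _; rewrite es_tenM mulr1.
have keyE s x : lkey_ok 0 s x -> key_elt 0 (x, s, rtgt 0 s) =
    D 1 (hmap 0 (key_elt 0 (x, s, rtgt 0 s))) + ten (mb x) 1 *: unit_elt.
  move=> xok; rewrite sigmaE hmap_key // addr0 D_ev // addr0 -ev_cat.
  by rewrite (ev_equiv _ (h_zero xok)) ev_cons ev_nil addr0 mulr1z.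
have vb : v = D 1 (hmap 0 v) + ten b 1 *: unit_elt.
  rewrite {1}vE bE scaler_suml {1}vE hmap_sum (linear_sum (D 1)) -big_split.
  apply: eq_bigr => s _; rewrite scaler_suml hmap_sum (linear_sum (D 1)) -big_split.
  apply: eq_bigr => x xok; rewrite {1}(keyE _ _ xok) scalerDr -scalerA.
  by congr (_ + _); rewrite hmap_tenr (linearZ_LR (D 1)).
have b0 : b = 0.
  move: augv; rewrite vb linearD aug_D add0r (linearZ_LR aug) aug_unit_elt es_act.
  by rewrite !mul1r => /(congr1 (es_out E)); rewrite es_inK raddf0.
by rewrite [RHS]vb b0 ten0l scale0r addr0.
Qed.

Lemma aug_surj x : exists2 v, term 0 v & aug v = x.
Proof.
exists (ten (es_out E x) 1 *: unit_elt); first exact/smemZ/unit_elt_term.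
by rewrite (linearZ_LR aug) aug_unit_elt es_act !mul1r es_outK.
Qed.

Definition term_mod (n : nat) : lmodType Lam := submod (term n).

Lemma gen_idemK n g : gen_idem n g * gen_idem n g = gen_idem n g.
Proof.
case: g => k s; rewrite /gen_idem; case: ifP => _; last exact: mul0r.
case: sym_type => [[i j]|]; last exact: mul0r.
by rewrite es_tenM !mbM !bmul_idem_l; case: i; case: j.
Qed.

Fact gen_elt_term n g : term n (gen_idem n g *: fr_base V g).
Proof.
move=> h; rewrite fr_coefZ fr_coef_base.
by have [<-|_] := eqVneq; rewrite ?mulr1 ?gen_idemK // mulr0 mul0r.
Qed.
Definition gen_elt n g : term_mod n := to_submod (gen_elt_term n g).

Lemma term_gen_expand n (v : term_mod n) :
  v = \sum_(g <- fr_supp (val v)) fr_coef g (val v) *: gen_elt n g.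
Proof.
apply: val_inj; rewrite linear_sum {1}[val v]fr_expand; apply: eq_bigr => g _.
by rewrite -{1}(submodP v g) -scalerA.
Qed.

(** A term is a direct summand of a free module: a map on it is lifted on the free
generators and restricted. *)
Lemma term_projective n : projective (term_mod n).
Proof.
move=> U W g f gsurj.
pose u i := sval (boolp.cid (gsurj (f (gen_elt n i)))).
have uE i : g (u i) = f (gen_elt n i) by rewrite /u; case: boolp.cid.
pose val_lin : {linear term_mod n -> V} := \val.
exists (fr_lift V u \o val_lin) => v /=.
rewrite {2}(term_gen_expand v) [X in fr_lift V u X](fr_expand (val_lin v)).
rewrite !linear_sum; apply: eq_bigr => i _.
by rewrite !linearZ /= fr_lift_base uE.
Qed.

Definition term_val n : {linear term_mod n -> V} := \val.
Fact D_val_term n (v : term_mod n.+1) : term n ((D n.+1 \o term_val n.+1) v).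
Proof. exact: D_term. Qed.
Definition term_d n : {linear term_mod n.+1 -> term_mod n} :=
  corestr (@D_val_term n).
Lemma term_dE n v : term_val n (term_d n v) = D n.+1 (term_val n.+1 v).
Proof. by []. Qed.

Definition resolution : projective_resolution (es_mod E).
Proof.
refine (@ProjRes Lam (es_mod E) term_mod term_d (aug \o term_val 0) term_projective
  _ _ _).
- by move=> x; have [v v0 <-] := aug_surj x; exists (to_submod v0).
- move=> y; split=> [y0|[z <-]]; last first.
    exact: (aug_D (term_val 1 z)).
  have [z z1 zE] := aug_exact (submodP y) y0.
  by exists (to_submod z1); apply: val_inj.
- move=> n y; split=> [y0|[z <-]]; last first.
    by apply: val_inj; apply: D_D.
  have [|z z1 zE] := D_exact (submodP y); first exact: (congr1 (term_val n) y0).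
  by exists (to_submod z1); apply: val_inj.
Defined.

End Blocks.

(** * The cohomology of the blocks *)

Definition coord : Type := (sym * bas)%type.

Definition coord_ok m (p : coord) : bool :=
  if sym_type (cls m) p.1 is Some (i, j) then (bsrc p.2 == i) && (btgt p.2 == j)
  else false.

(** The coordinate [p] of the cochain obtained by composing with [tab], in terms
of the coordinates of the given cochain. *)
Definition row (tab : sym -> lform key) (p : coord) : lform coord :=
  lbind (tab p.1) (fun q =>
    [seq ((1 : int), (q.1.2, z)) | z <- all_bas
       & omul (omul (Some q.1.1) (Some z)) (Some q.2) == Some p.2]).

Definition d_row m := row (d_tab (cls m)).
Definition t_row m := row (t_tab (cls m)).

Definition n_class m : nat := nth 2%N [:: 3; 3; 3; 4]%N m.

(** Cocycles that represent a basis of the cohomology, chosen such that t kills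
them exactly and not only up to a coboundary. *)
Definition z_tab (c : nat) (j : nat) : lform coord :=
  match c, j with
  | 0, 0 => [:: (1, (sA, e1)); (1, (sB, e2))]
  | 0, 1 => [:: (1, (sA, ep))]
  | 0, 2 => [:: (1, (sA, ab)); (1, (sB, ba))]
  | 1, 0 => [:: (1, (sA, aa))]
  | 1, 1 => [:: (1, (sA, ep)); (1, (sB, al))]
  | 1, 2 => [:: (1, (sB, aba))]
  | 2, 0 => [:: (1, (sA, e1))]
  | 2, 1 => [:: (1, (sA, ab))]
  | 2, 2 => [:: (1, (sA, ep))]
  | 3, 0 | 5, 0 => [:: (1, (sA, ab)); (1, (sB, ep))]
  | 3, 1 => [:: (-1, (sA, ep)); (2, (sB, ab)); (1, (sC, e2))]
  | 3, 2 => [:: (1, (sA, aa))]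
  | 3, 3 => [:: (1, (sB, aa))]
  | 5, 1 => [:: (1, (sA, ep)); (-1, (sB, ab))]
  | 4, 0 | 6, 0 => [:: (1, (sA, aa))]
  | 4, 1 | 6, 1 => [:: (1, (sB, e1))]
  | _, _ => [::]
  end.

(** Functionals that vanish on coboundaries and take the value 4 on their own
class and 0 on the others. *)
Definition q_tab (c : nat) (j : nat) : lform coord :=
  match c, j with
  | 0, 0 => [:: (4, (sA, e1))]
  | 0, 1 => [:: (4, (sA, ep))]
  | 0, 2 => [:: (4, (sA, ab))]
  | 1, 0 => [:: (4, (sA, aa))]
  | 1, 1 => [:: (4, (sB, al)); (4, (sC, be))]
  | 1, 2 => [:: (4, (sB, aba)); (4, (sC, bab))]
  | 2, 0 => [:: (4, (sA, e1))]
  | 2, 1 => [:: (4, (sA, ab))]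
  | 2, 2 => [:: (4, (sA, ep)); (-8, (sB, al))]
  | 3, 0 | 5, 0 => [:: (2, (sA, ab)); (2, (sB, ep))]
  | 3, 1 => [:: (4, (sC, e2))]
  | 3, 2 => [:: (4, (sA, aa))]
  | 3, 3 => [:: (4, (sB, aa)); (-4, (sC, ba))]
  | 5, 1 => [:: (2, (sA, ep)); (-2, (sB, ab))]
  | 4, 0 | 6, 0 => [:: (4, (sA, aa))]
  | 4, 1 | 6, 1 => [:: (4, (sB, e1))]
  | _, _ => [::]
  end.

(** A contraction of the block onto these classes. It is scaled by 4 to have
integral coefficients; this is where 2 has to be invertible, as l + r acts by 2
on cochains with values in a commutative ring. *)
Definition s_tab (c : nat) (p : coord) : lform coord :=
  match c, p with
  | 1, (sB, e2) => [:: (-4, (sC, be))]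
  | 1, (sB, ba) => [:: (-4, (sC, bab))]
  | 2, (sA, e1) => [:: (4, (sB, al))]
  | 2, (sA, ab) => [:: (4, (sB, aba))]
  | 2, (sA, ep) => [:: (2, (sA, aa))]
  | 3, (sC, be) => [:: (4, (sC, ba))]
  | 3, (sC, bab) => [:: (4, (sC, bb))]
  | 4, (sA, e1) | 6, (sA, e1) => [:: (2, (sB, ab))]
  | 4, (sB, e1) | 6, (sB, e1) => [:: (-2, (sB, ep))]
  | 4, (sA, ab) | 6, (sA, ab) => [:: (1, (sB, aa))]
  | 4, (sB, ep) | 6, (sB, ep) => [:: (-1, (sB, aa))]
  | 5, (sA, e1) => [:: (1, (sA, ep)); (1, (sB, ab))]
  | 5, (sA, ep) => [:: (2, (sA, aa))]
  | 5, (sA, ab) => [:: (2, (sB, aa))]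
  | _, _ => [::]
  end.

(** A partial inverse of 4^-1 t from degree 3 of a block to degree 0 of the next
one. It links the two classes of degree 3 that t does not kill with the socle
elements in degree 0, so both disappear from the cohomology. *)
Definition r_tab (p : coord) : lform coord :=
  match p with
  | (sA, ep) => [:: (4, (sB, bb)); (-4, (sA, aa))]
  | (sB, ab) => [:: (-4, (sB, bb))]
  | _ => [::]
  end.

(** The functionals of degree 0, composed with t, factor through the differential
inside the previous block. So they vanish on the images under t of its
cocycles. *)
Definition w_tab (j : nat) : lform coord :=
  match j with
  | 1 => [:: (-2, (sB, ab))]
  | 2 => [:: (2, (sB, ep))]
  | _ => [::]
  end.

Definition zq m (p : coord) : lform coord :=
  flatten [seq lscale (lcoef p (z_tab (cls m) j)) (q_tab (cls m) j)
          | j <- iota 0 (n_class (cls m))].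

Definition four m (p : coord) : lform coord :=
  if coord_ok m p then [:: (4, p)] else [::].

Definition lval (l z : lform coord) : int :=
  foldr (fun p a => p.1 * lcoef p.2 z + a) 0 l.

Definition all_coord (P : coord -> bool) := all_sb (fun s b => P (s, b)).
Lemma all_coordP P : all_coord P -> forall p, P p.
Proof. by move=> /all_sbP aP [s b]; apply: aP. Qed.

(** The identity 4 = ds + sd + zq in positive degrees of a block, with rt added in
degree 3; in degree 0 the correction is tr. *)
Lemma contraction m p :
  lequiv (four m.+1 p)
    (lbind (d_row m.+1 p) (s_tab (cls m.+1)) ++
     lbind (s_tab (cls m.+2) p) (d_row m.+2) ++ zq m.+1 p ++
     (if m == 2 then lbind (r_tab p) (t_row 0) else [::])).
Proof.
by move: p; apply/all_coordP; rewrite /four /coord_ok /d_row /zq; by_class m.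
Qed.

Lemma contraction0 p :
  lequiv (four 0 p)
    (lbind (s_tab (cls 1) p) (d_row 1) ++ zq 0 p ++ lbind (t_row 0 p) r_tab).
Proof. by move: p; apply/all_coordP; vm_compute. Qed.

Lemma r_cocycle p : lzero (lbind (d_row 4 p) r_tab).
Proof. by move: p; apply/all_coordP; vm_compute. Qed.

Definition all_class m (P : nat -> bool) := all P (iota 0 (n_class (cls m))).
Lemma all_classP m P : all_class m P -> forall j, (j < n_class (cls m))%N -> P j.
Proof. by move=> /allP aP j jm; apply: aP; rewrite mem_iota. Qed.

Lemma z_d m j p : (j < n_class (cls m))%N -> lval (d_row m.+1 p) (z_tab (cls m) j) == 0.
Proof.
move: p j; have : all_class m (fun j => all_coord (fun p =>
   lval (d_row m.+1 p) (z_tab (cls m) j) == 0)).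
  by rewrite /all_class /d_row; by_class m.
by move=> H p j /(all_classP H) /all_coordP.
Qed.

Lemma z_t m j p : (j < n_class (cls m.+3))%N ->
  lval (t_row m p) (z_tab (cls m.+3) j) == 0.
Proof.
move: p j; have : all_class m.+3 (fun j => all_coord (fun p =>
   lval (t_row m p) (z_tab (cls m.+3) j) == 0)).
  by rewrite /all_class /t_row; by_class m.
by move=> H p j /(all_classP H) /all_coordP.
Qed.

Lemma z_ok m j p : (j < n_class (cls m))%N ->
  ~~ coord_ok m p -> lcoef p (z_tab (cls m) j) == 0.
Proof.
move=> jm; apply/implyP; move: p j jm; have : all_class m (fun j => all_coord (fun p =>
   ~~ coord_ok m p ==> (lcoef p (z_tab (cls m) j) == 0))).
  by rewrite /all_class /coord_ok; by_class m.
by move=> H p j /(all_classP H) /all_coordP.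
Qed.

Lemma q_d m j : (j < n_class (cls m.+1))%N ->
  lzero (lbind (q_tab (cls m.+1) j) (d_row m.+1)).
Proof.
move: j; apply/all_classP; rewrite /all_class /d_row; by_class m.
Qed.

Lemma q_t0 j : lequiv (lbind (q_tab (cls 0) j) (t_row 0)) (lbind (w_tab j) (d_row 4)).
Proof. by do 3![case: j => [|j]; first by vm_compute]. Qed.

Lemma q_z m i j : (i < n_class (cls m))%N -> (j < n_class (cls m))%N ->
  lval (q_tab (cls m) i) (z_tab (cls m) j) == (if i == j then 4 else 0).
Proof.
move=> im; move: i im j; have : all_class m (fun i => all_class m (fun j =>
   lval (q_tab (cls m) i) (z_tab (cls m) j) == (if i == j then 4 else 0))).
  by rewrite /all_class; by_class m.
by move=> H i /(all_classP H) /all_classP.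
Qed.

Lemma d_row_ok m p : all (fun c => coord_ok m c.2) (d_row m.+1 p).
Proof. by move: p; apply/all_coordP; rewrite /coord_ok /d_row; by_class m. Qed.
Lemma t_row_ok m p : all (fun c => coord_ok m.+3 c.2) (t_row m p).
Proof. by move: p; apply/all_coordP; rewrite /coord_ok /t_row; by_class m. Qed.

(** A generator of a term is the multiple by an idempotent of a free one. Since the
tables are invariant under these idempotents, they give the differential of the
generators of the terms themselves. *)
Definition norm_ok m (tab : sym -> lform key) (s : sym) : bool :=
  if sym_type (cls m) s is Some (i, j) then
    lequiv (mul_l (idem i) (mul_r (idem j) (tab s))) (tab s)
  else nilp (tab s).
Lemma d_norm m s : norm_ok m (d_tab (cls m)) s.
Proof. by move: s e1; apply/all_sbP; rewrite /norm_ok; by_class m. Qed.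
Lemma t_norm m s : norm_ok m (t_tab (cls m)) s.
Proof. by move: s e1; apply/all_sbP; rewrite /norm_ok; by_class m. Qed.

(** The complex Hom(Q, A), known only through the coordinates of its cochains at a
block, a generator and a monomial. *)
Record block_complex (K : fieldType) := BlockComplex {
  bc : nat -> lmodType K;
  bc_d : forall n, {linear bc n -> bc n.+1};
  bc_dd : forall n f, bc_d n.+1 (bc_d n f) = 0;
  bc_crd : forall n, bc n -> nat -> coord -> K;
  bc_crdP : forall n k p c f g,
    bc_crd (c *: f + g : bc n) k p = c * bc_crd f k p + bc_crd g k p;
  bc_inj : forall n (f g : bc n), (forall k p, bc_crd f k p = bc_crd g k p) -> f = g;
  bc_mk : forall n, (nat -> coord -> K) -> bc n;
  bc_mkE : forall n F k p, bc_crd (bc_mk n F) k p =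
    if (4 * k <= n)%N && coord_ok (n - 4 * k) p then F k p else 0;
  bc_out : forall n (f : bc n) k p, (4 * k <= n)%N && coord_ok (n - 4 * k) p = false ->
    bc_crd f k p = 0;
  bc_crd_d : forall n (f : bc n) k p, bc_crd (bc_d n f) k p =
    if (4 * k <= n.+1)%N then
      ev (bc_crd f k) (d_row (n.+1 - 4 * k) p) +
      (if k is k'.+1 then ev (bc_crd f k') (t_row (n.+1 - 4 * k) p) else 0)
    else 0 }.

Section Cochains.
Variables (K : fieldType) (A : kalg K) (M : monomial_basis A).
Variable E : env_structure A.
Variable V : free_module (es_alg E) (nat * sym)%type.

Local Notation Lam := (es_alg E).
Local Notation ten := (es_ten E).
Local Notation mb := (mb M).
Local Notation N := (es_mod E).
Local Notation Q := (term_mod M V).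
Local Notation C n := (homspace (Q n) N : lmodType K).

Definition gval n (f : homspace (Q n) N) (g : nat * sym) : N := f (gen_elt M V n g).

(** A map on a term is the restriction of the map on the free module that sends
each generator to the value on its multiple by the idempotent. *)
Definition hom_ext_free n (f : homspace (Q n) N) : {linear V -> N} :=
  fr_lift V (gval f).

Lemma hom_ext_freeE n (f : homspace (Q n) N) (v : Q n) :
  hom_ext_free f (term_val M V n v) = f v.
Proof.
rewrite {2}(term_gen_expand v) [X in hom_ext_free f X](fr_expand (term_val M V n v)).
rewrite (linear_sum (hom_ext_free f)) (linear_sum f); apply: eq_bigr => g _.
by rewrite (linearZ_LR (hom_ext_free f)) (linearZ_LR f) fr_lift_base.
Qed.

Definition hcrd n (f : homspace (Q n) N) (k : nat) (p : coord) : K :=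
  crd M p.2 (es_out E (gval f (k, p.1))).

Lemma crd_sandwich b x y a : crd M b (mb x * a * mb y) =
  ev (fun z => crd M z a : K^o) [seq ((1 : int), z) | z <- all_bas
    & omul (omul (Some x) (Some z)) (Some y) == Some b].
Proof.
have oM o o' : (if o is Some z then mb z else 0) * (if o' is Some z then mb z else 0)
    = (if omul o o' is Some z then mb z else 0).
  by case: o o' => [u|] [w|] //=; rewrite ?mul0r ?mulr0 // mbM.
rewrite {1}[a](mb_span M) mulr_sumr mulr_suml linear_sum.
rewrite big_bas /ev big_map big_filter [RHS]big_mkcond; apply: eq_bigr => z _ /=.
rewrite -kscalerAr -kscalerAl linearZ /=.
have := oM (omul (Some x) (Some z)) (Some y).
rewrite -(oM (Some x) (Some z)) => ->.
case: omul => [w|]; last by rewrite linear0 scaler0.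
rewrite crd_mb (inj_eq Some_inj) eq_sym.
by case: eqP; rewrite ?mulr1z -[_ *: _]/(_ * _) ?mulr1 ?mulr0.
Qed.

Lemma crd_idem i j b a : crd M b (mb (idem i) * a * mb (idem j)) =
  if (bsrc b == i) && (btgt b == j) then crd M b a else 0.
Proof.
by rewrite crd_sandwich; case: i; case: j; case: b => /=;
  rewrite /ev ?big_nil ?big_seq1 ?mulr1z.
Qed.

Lemma gval_idem n (f : homspace (Q n) N) g : gen_idem M E n g *: gval f g = gval f g.
Proof.
rewrite /gval -(linearZ_LR f); congr (f _); apply: val_inj.
by rewrite linearZ /= scalerA gen_idemK.
Qed.

Lemma hcrd_out n (f : homspace (Q n) N) k p :
  (4 * k <= n)%N && coord_ok (n - 4 * k) p = false -> hcrd f k p = 0.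
Proof.
rewrite /hcrd /coord_ok -(gval_idem f) /gen_idem.
case: leqP => kn /=; last by rewrite scale0r !raddf0.
case: sym_type => [[i j]|]; last by rewrite scale0r !raddf0.
rewrite -(es_outK (gval f _)) es_act es_inK crd_idem.
by move=> ->.
Qed.

Lemma hcrd_key n (f : homspace (Q n) N) k x s y b :
  crd M b (es_out E (hom_ext_free f (key_elt M V k (x, s, y)))) =
  ev (hcrd f k : coord -> K^o) [seq ((1 : int), (s, z)) | z <- all_bas
       & omul (omul (Some x) (Some z)) (Some y) == Some b].
Proof.
rewrite (linearZ_LR (hom_ext_free f)) fr_lift_base.
rewrite -(es_outK (gval f _)) es_act es_inK crd_sandwich /ev !big_map.
by [].
Qed.

Lemma hcrd_ev n (f : homspace (Q n) N) k l b :
  crd M b (es_out E (hom_ext_free f (ev (key_elt M V k) l))) =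
  ev (hcrd f k : coord -> K^o) (lbind l (fun q =>
    [seq ((1 : int), (q.1.2, z)) | z <- all_bas
       & omul (omul (Some q.1.1) (Some z)) (Some q.2) == Some b])).
Proof.
rewrite (raddf_ev (hom_ext_free f)) (raddf_ev (es_out E)) (raddf_ev (crd M b)).
rewrite ev_bind; apply: eq_ev => -[[x s] y]; exact: hcrd_key.
Qed.

Lemma D_gen_norm n k s :
  D M V n (val (gen_elt M V n (k, s))) = D_gen M V n (k, s).
Proof.
rewrite (linearZ_LR (D M V n)) D_base /D_gen /gen_idem.
case: ifP => kn; last by rewrite scale0r.
have norm k' tab : norm_ok (n - 4 * k) tab s ->
    (if sym_type (cls (n - 4 * k)) s is Some (i, j) then
      ten (mb (idem j)) (mb (idem i)) else 0) *: ev (key_elt M V k') (tab s) =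
    ev (key_elt M V k') (tab s).
  rewrite /norm_ok; case: sym_type => [[i j]|].
    by move=> H; rewrite ev_mul (ev_equiv _ H).
  by move=> /nilP ->; rewrite ev_nil scaler0.
rewrite scalerDr (norm _ _ (d_norm _ s)); congr (_ + _).
by case: k {kn} norm => [|k] norm; rewrite ?scaler0 ?(norm _ _ (t_norm _ s)).
Qed.

Lemma hcrd_d n (f : homspace (Q n) N) k p :
  hcrd (precomp (term_d M V n) f : homspace (Q n.+1) N) k p =
  if (4 * k <= n.+1)%N then
    ev (hcrd f k : coord -> K^o) (d_row (n.+1 - 4 * k) p) +
    (if k is k'.+1 then ev (hcrd f k' : coord -> K^o) (t_row (n.+1 - 4 * k) p) else 0)
  else 0.
Proof.
case: p => s b; rewrite /hcrd /gval /= -hom_ext_freeE term_dE D_gen_norm /D_gen.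
case: ifP => kn; last by rewrite !raddf0.
rewrite (linearD (hom_ext_free f)) (raddfD (es_out E)) (linearD (crd M b)).
rewrite hcrd_ev; congr (_ + _); case: k kn => [|k] kn; first by rewrite !raddf0.
exact: hcrd_ev.
Qed.

Lemma hcrd_linear n k p c (f g : homspace (Q n) N) :
  hcrd (c *: f + g) k p = c * hcrd f k p + hcrd g k p.
Proof.
rewrite /hcrd.
have -> : gval (c *: f + g) (k, p.1) =
    (c *: (1 : Lam)) *: gval f (k, p.1) + gval g (k, p.1) by [].
rewrite -es_ten11 -es_tenZl -{1}(es_outK (gval f _)) es_act mul1r.
by rewrite (raddfD (es_out E)) es_inK linearD -kscalerAr mulr1 linearZ.
Qed.

Lemma hcrd_inj n (f g : homspace (Q n) N) :
  (forall k p, hcrd f k p = hcrd g k p) -> f = g.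
Proof.
move=> fg; apply: hom_ext => v.
rewrite [v]term_gen_expand (linear_sum f) (linear_sum g); apply: eq_bigr => -[k s] _.
rewrite (linearZ_LR f) (linearZ_LR g); congr (_ *: _).
apply: (can_inj (@es_outK _ _ E)); rewrite [LHS](mb_span M) [RHS](mb_span M).
by apply: eq_bigr => b _; congr (_ *: _); apply: (fg k (s, b)).
Qed.

Definition hmk n (F : nat -> coord -> K) : homspace (Q n) N :=
  fr_lift V (fun g => es_in E (\sum_b F g.1 (g.2, b) *: mb b)) \o term_val M V n.

Lemma hmkE n F k p : hcrd (hmk n F) k p =
  if (4 * k <= n)%N && coord_ok (n - 4 * k) p then F k p else 0.
Proof.
case: ifP => [/andP[kn]|]; last exact: hcrd_out.
case: p => s b; rewrite /coord_ok /hcrd /gval /hmk /= => pok.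
rewrite (linearZ_LR (fr_lift V _)) fr_lift_base /gen_idem kn.
case: sym_type pok => [[i j]|//] pok.
rewrite es_act es_inK crd_idem pok linear_sum (bigD1 b) //= big1 ?addr0.
  by rewrite linearZ /= crd_mb eqxx -[_ *: _]/(_ * _) mulr1.
move=> z zb; rewrite linearZ /= crd_mb eq_sym (negbTE zb).
by rewrite -[_ *: _]/(_ * _) mulr0.
Qed.

Local Notation P := (resolution M V).

Definition hom_complex : block_complex K.
Proof.
refine (@BlockComplex K (fun n => homspace (pr_mod P n) N) (fun n => @pullback _ _ _ N P n)
  _ (fun n f => @hcrd n f) _ _ hmk _ _ _).
- move=> n f; apply: hom_ext => x.
  exact: (etrans (congr1 f (pr_dd x)) (linear0 f)).
- by move=> n k p c f g; apply: hcrd_linear.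
- by move=> n f g; apply: hcrd_inj.
- by move=> n F k p; apply: hmkE.
- by move=> n f k p; apply: hcrd_out.
- by move=> n f k p; apply: hcrd_d.
Defined.

End Cochains.

(** * Degeneration *)

Definition ncls n k := n_class (cls (n - 4 * k)).

Definition classes n : seq (nat * nat) :=
  [seq (k, j) | k <- iota 0 (n %/ 4).+1, j <- iota 0 (ncls n k)].

Lemma classes_uniq n : uniq (classes n).
Proof.
apply: allpairs_uniq_dep => [|k _|[k j] [k' j'] _ _ /= [-> ->] //].
  exact: iota_uniq.
exact: iota_uniq.
Qed.

Lemma mem_classes n k j : ((k, j) \in classes n) = (4 * k <= n)%N && (j < ncls n k)%N.
Proof.
have kE i : (i \in iota 0 (n %/ 4).+1) = (4 * i <= n)%N by rewrite mem_iota; lia.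
apply/allpairsPdep/andP => [[k' [j' []]]|[kn jm]].
  by rewrite kE mem_iota => kn jm [-> ->].
by exists k, j; rewrite kE mem_iota.
Qed.

(** A block has two classes in each degree at least 4, so all the blocks but the
last contribute 2. *)
Lemma size_classes k i : (i < 4)%N ->
  size (classes (4 * k + i)) = (2 * k + n_class i)%N.
Proof.
move=> i4; set n := (4 * k + i)%N; have -> : (n_class i = ncls n k)%N.
  rewrite /ncls; have -> : (n - 4 * k = i)%N by lia.
  by case: i i4 {n} => [|[|[|[|i]]]].
rewrite size_allpairs_dep sumnE big_map.
have -> : (n %/ 4 = k)%N by lia.
under eq_bigr do rewrite size_iota.
have -> : iota 0 k.+1 = index_iota 0 k.+1 by rewrite /index_iota subn0.
rewrite big_mkord big_ord_recr /=; congr (_ + _)%N.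
rewrite (eq_bigr (fun=> 2%N)) ?sum_nat_const ?card_ord 1?mulnC // => k' _.
have -> : ncls n k' = 2%N; last by [].
have := ltn_ord k'; rewrite /ncls; case m_def: (n - 4 * k')%N => [|[|[|[|m]]]]; try lia.
by move=> _; rewrite /cls; do 2?case: ifP => //; case: (m).
Qed.

Section Cohomology.
Variables (K : fieldType) (B : block_complex K) (charK : 2%N \notin [pchar K]).

Local Notation C := (bc B).
Local Notation d := (bc_d B).
Local Notation crd f := (bc_crd f).

Lemma crd0 n k p : crd (0 : C n) k p = 0.
Proof.
have := bc_crdP k p 1 (0 : C n) 0; rewrite scale1r mul1r addr0.
by move/(canLR (addrK _)); rewrite subrr.
Qed.
Lemma crdD n k p (f g : C n) : crd (f + g) k p = crd f k p + crd g k p.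
Proof. by have := bc_crdP k p 1 f g; rewrite scale1r mul1r. Qed.
Lemma crdZ n k p c (f : C n) : crd (c *: f) k p = c * crd f k p.
Proof. by have := bc_crdP k p c f 0; rewrite crd0 !addr0. Qed.
Lemma crdB n k p (f g : C n) : crd (f - g) k p = crd f k p - crd g k p.
Proof. by rewrite crdD -scaleN1r crdZ mulN1r. Qed.
Lemma crd_sum n k p I (r : seq I) (Q : pred I) (F : I -> C n) :
  crd (\sum_(i <- r | Q i) F i) k p = \sum_(i <- r | Q i) crd (F i) k p.
Proof. exact: (big_morph (fun f => crd f k p) (crdD k p) (crd0 n k p)). Qed.

Lemma four_neq0 : 4 != 0 :> K.
Proof.
have two : 2 != 0 :> K by move: charK; rewrite inE /=.
by rewrite -[4]/((2 * 2)%:R) natrM mulf_neq0.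
Qed.

Lemma ev_supp (F G : coord -> K) l : (forall c, c \in l -> F c.2 = G c.2) ->
  ev F l = ev G l.
Proof. by move=> FG; apply: eq_big_seq => c cl; rewrite FG. Qed.

Lemma ev_eq0 (F : coord -> K) l : (forall p, F p = 0) -> ev F l = 0.
Proof. by move=> F0; rewrite (eq_ev (G := fun=> 0)) ?ev_0. Qed.

Lemma ev_scalel (F : coord -> K) c l : ev (fun p => c * F p) l = c * ev F l.
Proof. by rewrite /ev mulr_sumr; apply: eq_bigr => p _; rewrite mulrzAr. Qed.

Lemma ev_sum (I : finType) (F : I -> coord -> K) l :
  ev (fun p => \sum_i F i p) l = \sum_i ev (F i) l.
Proof.
rewrite /ev exchange_big; apply: eq_bigr => p _.
by rewrite mulrz_suml.
Qed.

Definition zvec (c j : nat) (p : coord) : K := (lcoef p (z_tab c j))%:~R.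

Lemma ev_zvec c j l : ev (zvec c j) l = (lval l (z_tab c j))%:~R.
Proof.
elim: l => [|[a p] l IHl]; first by rewrite ev_nil.
by rewrite ev_cons IHl rmorphD rmorphM /= /zvec -mulrzr mulrC.
Qed.

Definition Z n k j : C n :=
  bc_mk B n (fun k' p => if k' == k then zvec (cls (n - 4 * k)) j p else 0).

Lemma crd_Z n k j k' p : (4 * k <= n)%N -> (j < ncls n k)%N ->
  crd (Z n k j) k' p = if k' == k then zvec (cls (n - 4 * k)) j p else 0.
Proof.
move=> kn jn; rewrite bc_mkE; have [->|_] := eqVneq k' k; last by case: ifP.
rewrite kn /=; case: ifP => // /negbT pok.
by rewrite /zvec (eqP (z_ok jn pok)).
Qed.

Lemma Z_cocycle n k j : (4 * k <= n)%N -> (j < ncls n k)%N -> d n (Z n k j) = 0.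
Proof.
move=> kn jn; apply: bc_inj => k' p; rewrite crd0 bc_crd_d.
case: ifP => // k'n.
have [kk'|kk'] := eqVneq k' k.
  rewrite kk' (eq_ev (G := zvec (cls (n - 4 * k)) j)); last first.
    by move=> q; rewrite crd_Z // eqxx.
  have -> : (n.+1 - 4 * k = (n - 4 * k).+1)%N by lia.
  rewrite ev_zvec (eqP (z_d p jn)) add0r; case: k kn jn {k'n kk'} => [//|k] kn jn.
  apply: ev_eq0 => q; rewrite crd_Z //; case: eqP => //; lia.
rewrite ev_eq0 ?add0r; last by move=> q; rewrite crd_Z // (negbTE kk').
case: k' k'n kk' => // k' k'n kk'.
have [k'k|k'k] := eqVneq k' k; last first.
  by apply: ev_eq0 => q; rewrite crd_Z // (negbTE k'k).
rewrite k'k (eq_ev (G := zvec (cls (n - 4 * k)) j)); last first.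
  by move=> q; rewrite crd_Z // eqxx.
have m3 : (n - 4 * k = (n.+1 - 4 * k.+1).+3)%N by lia.
move: jn; rewrite /ncls ev_zvec m3 => jn.
by rewrite (eqP (z_t p jn)).
Qed.

Lemma ev_flatten (F : coord -> K) (s : seq (lform coord)) :
  ev F (flatten s) = \sum_(l <- s) ev F l.
Proof.
by elim: s => [|l s IHs]; rewrite ?big_nil ?ev_nil //= ev_cat big_cons IHs.
Qed.

Lemma ev_zq (F : coord -> K) m p : ev F (zq m p) =
  \sum_(j < n_class (cls m)) ev F (q_tab (cls m) j) * zvec (cls m) j p.
Proof.
rewrite /zq ev_flatten big_map -{1}[n_class _]subn0 big_mkord.
by apply: eq_bigr => j _; rewrite ev_scale mulrzr.
Qed.

Lemma crd_four n (f : C n) k p : (4 * k <= n)%N ->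
  crd f k p = 4^-1 * ev (crd f k) (four (n - 4 * k) p).
Proof.
move=> kn; rewrite /four; case: ifP => pok.
  by rewrite ev_cons ev_nil addr0 -mulrzr mulrCA mulVf ?four_neq0 ?mulr1.
by rewrite ev_nil mulr0; apply: bc_out; rewrite kn pok.
Qed.

Definition single n k (F : coord -> K) : C n :=
  bc_mk B n (fun k' p => if k' == k then F p else 0).

Lemma crd_single_neq n k F k' p : k' != k -> crd (single n k F) k' p = 0.
Proof. by move=> kk'; rewrite bc_mkE (negbTE kk'); case: ifP. Qed.

Lemma ev_single n k F l : (4 * k <= n)%N ->
  all (fun c => coord_ok (n - 4 * k) c.2) l -> ev (crd (single n k F) k) l = ev F l.
Proof.
move=> kn /allP lok; apply: ev_supp => c cl.
by rewrite bc_mkE kn eqxx lok.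
Qed.

(** One step of the reduction of a cocycle modulo classes and coboundaries, from
its lowest block upwards. *)
Definition cleaned n (f : C n.+1) k0 :=
  exists (c : nat -> K) (psi : C n), forall k p, (k <= k0)%N ->
    crd (f - \sum_(j < ncls n.+1 k0) c j *: Z n.+1 k0 j - d n psi) k p = 0.

Lemma crd_comb n k0 (c : nat -> K) k p : (4 * k0 <= n)%N ->
  crd (\sum_(j < ncls n k0) c j *: Z n k0 j) k p =
  if k == k0 then \sum_(j < ncls n k0) c j * zvec (cls (n - 4 * k0)) j p else 0.
Proof.
move=> kn; rewrite crd_sum; case: ifP => kk0.
  by apply: eq_bigr => j _; rewrite crdZ crd_Z // kk0.
by rewrite big1 // => j _; rewrite crdZ crd_Z // kk0 mulr0.
Qed.

Lemma clean n k0 m (f : C n.+1) : (n.+1 = 4 * k0 + m.+1)%N ->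
  (forall k p, (k < k0)%N -> crd f k p = 0) ->
  (forall p, ev (crd f k0) (d_row m.+2 p) = 0) ->
  (m = 2%N -> forall p, ev (crd f k0) (t_row 0 p) = 0) -> cleaned f k0.
Proof.
move=> nE flow df tf; set F := crd f k0.
have k0n : (4 * k0 <= n)%N by lia.
have mE : (n.+1 - 4 * k0 = m.+1)%N by lia.
have mE' : (n - 4 * k0 = m)%N by lia.
pose c j := 4^-1 * ev F (q_tab (cls m.+1) j); exists c.
exists (single n k0 (fun p => 4^-1 * ev F (s_tab (cls m.+1) p))).
move=> k p kk0; rewrite !crdB crd_comb ?bc_crd_d; last by lia.
have -> : (4 * k <= n.+1)%N by lia.
have [->|nk] := eqVneq k k0; last first.
  rewrite flow ?ltn_neqAle ?nk // subr0 sub0r ev_eq0 => [|q]; last exact: crd_single_neq.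
  rewrite add0r; case: k nk kk0 => [|k] nk kk0; first by rewrite oppr0.
  rewrite ev_eq0 ?oppr0 // => q; apply: crd_single_neq.
  by apply/eqP => kk; move: kk0; rewrite kk ltnn.
rewrite mE ev_single //; last by rewrite mE'; apply: d_row_ok.
have -> : match k0 with 0 => 0 | k'.+1 => ev (crd (single n k0
    (fun p => 4^-1 * ev F (s_tab (cls m.+1) p))) k') (t_row m.+1 p) end = 0.
  case: (k0) => // k'; apply: ev_eq0 => q; apply: crd_single_neq.
  by rewrite neq_ltn ltnSn.
rewrite addr0 ev_scalel -ev_bind (crd_four f p) ?mE; last by lia.
rewrite (ev_equiv _ (contraction m p)) !ev_cat ev_zq /c /ncls mE -/F.
rewrite [ev F (lbind (s_tab _ _) _)]ev_bind [ev _ (s_tab (cls m.+2) p)]ev_eq0 //.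
have -> : ev F (if m == 2 then lbind (r_tab p) (t_row 0) else [::]) = 0.
  case: eqP => [m2|_]; last exact: ev_nil.
  by rewrite ev_bind ev_eq0 //; apply: tf.
rewrite add0r addr0 mulrDr [4^-1 * (\sum_(_ < _) _)]mulr_sumr.
under [X in _ + X - _ - _]eq_bigr do rewrite mulrA.
by rewrite addrK subrr.
Qed.

(** In degree 0 of a block the correction comes from degree 3 of the previous one:
[r_cocycle] ensures that it disturbs neither that block nor an earlier one. *)
Lemma clean0 n k0 (f : C n.+1) : (n.+1 = 4 * k0)%N ->
  (forall k p, (k < k0)%N -> crd f k p = 0) ->
  (forall p, ev (crd f k0) (d_row 1 p) = 0) -> cleaned f k0.
Proof.
case: k0 => // k0 nE flow df; set F := crd f k0.+1.
have k0n : (4 * k0 <= n)%N by lia.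
have mE : (n.+1 - 4 * k0.+1 = 0)%N by lia.
have mE' : (n - 4 * k0 = 3)%N by lia.
have mE4 : (n.+1 - 4 * k0 = 4)%N by lia.
pose c j := 4^-1 * ev F (q_tab (cls 0) j); exists c.
exists (single n k0 (fun p => 4^-1 * ev F (r_tab p))).
move=> k p kk0; rewrite !crdB crd_comb ?bc_crd_d; last by lia.
have -> : (4 * k <= n.+1)%N by lia.
have [->|nk] := eqVneq k k0.+1.
  rewrite mE ev_single ?mE' //; last exact: t_row_ok.
  rewrite ev_nil add0r ev_scalel -ev_bind (crd_four f p) ?mE; last by lia.
  rewrite (ev_equiv _ (contraction0 p)) ev_cat [ev _ (zq 0 p ++ _)]ev_cat ev_zq.
  rewrite /c /ncls mE -/F.
  rewrite [ev F (lbind (s_tab _ _) _)]ev_bind [ev _ (s_tab (cls 1) p)]ev_eq0 //.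
  rewrite add0r mulrDr [4^-1 * (\sum_(_ < _) _)]mulr_sumr.
  under [X in X + _ - _ - _]eq_bigr do rewrite mulrA.
  by rewrite [X in X - _ - _]addrC addrK subrr.
rewrite flow ?ltn_neqAle ?nk // subr0 sub0r.
have [->|nk'] := eqVneq k k0.
  rewrite mE4 ev_single ?mE' //; last exact: d_row_ok.
  rewrite ev_scalel -ev_bind (ev_zero _ (r_cocycle p)) mulr0 add0r.
  case: (k0) => [|k']; first by rewrite oppr0.
  rewrite ev_eq0 ?oppr0 // => q; apply: crd_single_neq.
  by rewrite neq_ltn ltnSn.
rewrite ev_eq0 ?add0r => [|q]; last exact: crd_single_neq.
case: k nk nk' kk0 => [|k] nk nk' kk0; first by rewrite oppr0.
rewrite ev_eq0 ?oppr0 // => q; apply: crd_single_neq.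
by apply/eqP => kk; move: nk; rewrite kk eqxx.
Qed.

Definition comb n (c : nat -> nat -> K) : C n :=
  \sum_(k < (n %/ 4).+1) \sum_(j < ncls n k) c k j *: Z n k j.

Definition in_span n (f : C n.+1) :=
  exists (c : nat -> nat -> K) (psi : C n), f = comb n.+1 c + d n psi.

Fact in_span0 n : @in_span n 0.
Proof.
exists (fun _ _ => 0), 0; rewrite linear0 addr0 /comb big1 // => k _.
by rewrite big1 // => j _; rewrite scale0r.
Qed.
Fact in_spanP n a (f g : C n.+1) : in_span f -> in_span g -> in_span (a *: f + g).
Proof.
move=> [c [phi ->]] [e [psi ->]].
exists (fun k j => a * c k j + e k j), (a *: phi + psi).
rewrite linearP scalerDr addrACA; congr (_ + _); rewrite /comb scaler_sumr -big_split.
apply: eq_bigr => k _; rewrite scaler_sumr -big_split; apply: eq_bigr => j _.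
by rewrite scalerDl scalerA.
Qed.
Definition span_sub n : submodule (C n.+1) := Submodule (in_span0 n) (@in_spanP n).

Lemma span_Z n k j : (4 * k <= n.+1)%N -> (j < ncls n.+1 k)%N -> span_sub n (Z n.+1 k j).
Proof.
move=> kn jn; exists (fun k' j' => ((k' == k) && (j' == j))%:R), 0.
have kn' : (k < (n.+1 %/ 4).+1)%N by lia.
rewrite linear0 addr0 /comb (bigD1 (Ordinal kn')) //= [X in _ + X]big1 => [|k' k'k].
  rewrite addr0 (bigD1 (Ordinal jn)) //= !eqxx scale1r big1 ?addr0 // => j' j'j.
  have -> : (j' == j :> nat) = false.
    by apply: negbTE; apply: contra j'j => /eqP jj; apply/eqP/val_inj.
  by rewrite andbF scale0r.
rewrite big1 // => j' _.
have -> : (k' == k :> nat) = false.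
  by apply: negbTE; apply: contra k'k => /eqP kk; apply/eqP/val_inj.
by rewrite scale0r.
Qed.

Lemma span_d n (psi : C n) : span_sub n (d n psi).
Proof.
exists (fun _ _ => 0), psi; rewrite /comb big1 ?add0r // => k _.
by rewrite big1 // => j _; rewrite scale0r.
Qed.

Lemma d_row_cocycle n k (f : C n) : d n f = 0 -> (4 * k <= n)%N ->
  (forall k' p, (k' < k)%N -> crd f k' p = 0) ->
  forall p, ev (crd f k) (d_row (n - 4 * k).+1 p) = 0.
Proof.
move=> df kn flow p; have := crd0 n.+1 k p; rewrite -df bc_crd_d.
have -> : (4 * k <= n.+1)%N by lia.
have -> : (n.+1 - 4 * k = (n - 4 * k).+1)%N by lia.
case: k {kn} flow => [|k] flow; first by rewrite addr0.
by rewrite [X in _ + X]ev_eq0 ?addr0 // => q; apply: flow.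
Qed.

Lemma t_row_cocycle n k (f : C n) : d n f = 0 -> (n = 4 * k + 3)%N ->
  forall p, ev (crd f k) (t_row 0 p) = 0.
Proof.
move=> df nE p; have := crd0 n.+1 k.+1 p; rewrite -df bc_crd_d.
have -> : (4 * k.+1 <= n.+1)%N by lia.
have -> : (n.+1 - 4 * k.+1 = 0)%N by lia.
by rewrite ev_nil add0r.
Qed.

(** A cocycle is cleaned on its lowest block, and the next block is lowest for what
remains. *)
Lemma spanning n (f : C n.+1) : d n.+1 f = 0 -> span_sub n f.
Proof.
suff H r k0 (g : C n.+1) : d n.+1 g = 0 -> (n.+1 < 4 * (k0 + r))%N ->
    (forall k p, (k < k0)%N -> crd g k p = 0) -> span_sub n g.
  by move=> df; apply: (H n.+1 0%N) => //; lia.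
elim: r k0 g {f} => [|r IHr] k0 f df rn flow.
  suff -> : f = 0 by apply: smem0.
  apply: bc_inj => k p; rewrite crd0; have [kk0|kk0] := ltnP k k0; first exact: flow.
  by apply: bc_out; apply/negbTE; rewrite negb_and -ltnNge; apply/orP; left; lia.
have [kn|kn] := leqP (4 * k0) n.+1; last first.
  apply: (IHr k0.+1) => // [|k p kk0]; first lia.
  have [kk|kk] := ltnP k k0; first exact: flow.
  by apply: bc_out; apply/negbTE; rewrite negb_and -ltnNge; apply/orP; left; lia.
have [c [psi cE]] : cleaned f k0.
  have drow := d_row_cocycle df kn flow.
  case m_def: (n.+1 - 4 * k0)%N drow => [|m] drow; first by apply: clean0 => //; lia.
  apply: (clean (m := m)) => // [|m2]; first by lia.
  by apply: t_row_cocycle => //; lia.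
set g := f - _ - _ in cE.
have -> : f = (\sum_(j < ncls n.+1 k0) c j *: Z n.+1 k0 j + d n psi) + g.
  by rewrite /g -[f - _ - _]addrA -opprD [RHS]addrC subrK.
apply: smemD; last first.
  apply: (IHr k0.+1); [|by lia|exact: cE].
  rewrite /g !linearB /= df bc_dd linear_sum big1 ?subrr // => j _.
  by rewrite linearZ /= Z_cocycle ?scaler0.
apply: smemD; last exact: span_d.
apply: (big_ind (span_sub n)) => [||j _]; first exact: smem0.
  by move=> u v; apply: smemD.
by apply/smemZ/span_Z.
Qed.

Lemma crd_combn n (c : nat -> nat -> K) k p : (4 * k <= n)%N ->
  crd (comb n c) k p =
  \sum_(j < ncls n k) c k j * zvec (cls (n - 4 * k)) j p.
Proof.
move=> kn; have kn' : (k < (n %/ 4).+1)%N by lia.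
rewrite /comb crd_sum (bigD1 (Ordinal kn')) //= [X in _ + X]big1 => [|k' k'k].
  by rewrite addr0 crd_comb // eqxx.
rewrite crd_comb; last by have := ltn_ord k'; lia.
by case: eqP => // kk; case/eqP: k'k; apply: val_inj.
Qed.

Lemma q_comb n (c : nat -> nat -> K) k i : (i < ncls n k)%N ->
  ev (fun p => \sum_(j < ncls n k) c k j * zvec (cls (n - 4 * k)) j p)
    (q_tab (cls (n - 4 * k)) i) = 4 * c k i.
Proof.
move=> im; rewrite ev_sum (bigD1 (Ordinal im)) //= big1 ?addr0 => [|j ji].
  by rewrite ev_scalel ev_zvec (eqP (q_z im im)) eqxx mulrC.
rewrite ev_scalel ev_zvec (eqP (q_z im (ltn_ord j))).
by case: eqP => [ij|_]; [case/eqP: ji; apply: val_inj|rewrite mulr0].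
Qed.

Lemma four_mul_eq0 (x : K) : 4 * x = 0 -> x = 0.
Proof. by move/eqP; rewrite mulf_eq0 (negbTE four_neq0) => /eqP. Qed.

(** Suppose that a combination of the classes is a coboundary d psi. By cleaning psi
one may assume that it vanishes on the blocks below k; then the part of d psi on
block k is a coboundary of that block alone, and the functionals [q_tab] read off
that the coefficients of its classes vanish. *)
Section Freeness.
Variables (n : nat) (c : nat -> nat -> K).

Lemma free_block k m (psi : C n) : d n psi = comb n.+1 c ->
  (n.+1 = 4 * k + m.+1)%N -> (forall k' p, (k' < k)%N -> crd psi k' p = 0) ->
  (forall j, (j < ncls n.+1 k)%N -> c k j = 0) /\
  (forall p, ev (crd psi k) (d_row m.+1 p) = 0).
Proof.
move=> psiE nE low; have mE : (n.+1 - 4 * k = m.+1)%N by lia.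
have E p : ev (crd psi k) (d_row m.+1 p) =
    \sum_(j < ncls n.+1 k) c k j * zvec (cls (n.+1 - 4 * k)) j p.
  rewrite -crd_combn; last by lia.
  rewrite -psiE bc_crd_d mE ifT; last by lia.
  case: k {nE mE} low => [|k] low; first by rewrite addr0.
  by rewrite [X in _ + X]ev_eq0 ?addr0 // => q; apply: low.
have c0 j : (j < ncls n.+1 k)%N -> c k j = 0.
  move=> jm; apply: four_mul_eq0; rewrite -(q_comb c jm) -(eq_ev _ E) -ev_bind mE.
  by apply/ev_zero/q_d; rewrite -mE.
by split=> // p; rewrite E big1 // => j _; rewrite c0 ?mul0r.
Qed.

Lemma free_reduce k (psi : C n) : d n psi = comb n.+1 c -> (4 * k < n.+1)%N ->
  exists2 psi' : C n, d n psi' = comb n.+1 c &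
    forall k' p, (k' < k)%N -> crd psi' k' p = 0.
Proof.
move=> psiE; elim: k => [|k IHk] kn; first by exists psi.
have [|phi phiE low] := IHk; first by lia.
have [m nE] : {m | n.+1 = 4 * k + m.+4}%N by exists (n - 4 * k - 3)%N; lia.
have [_ drow] := free_block phiE nE low.
move: phi phiE low drow nE kn; case: (n) => [|n'] phi phiE low drow nE kn; first by lia.
have [e [psi' eE]] : cleaned phi k.
  by apply: (clean (m := m.+2)) => // [|m2]; lia.
exists (phi - \sum_(j < ncls n'.+1 k) e j *: Z n'.+1 k j - d n' psi'); last first.
  by move=> k' p k'k; apply: eE.
rewrite !linearB /= bc_dd subr0 linear_sum big1 ?subr0 // => j _.
by rewrite linearZ /= Z_cocycle ?scaler0 //; lia.
Qed.

Lemma freeness (psi : C n) : d n psi = comb n.+1 c ->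
  forall k j, (4 * k <= n.+1)%N -> (j < ncls n.+1 k)%N -> c k j = 0.
Proof.
move=> psiE k j kn jm; case m_def: (n.+1 - 4 * k)%N => [|m]; last first.
  have [|phi phiE low] := @free_reduce k psi psiE; first by lia.
  have [|c0 _] := @free_block k m phi phiE _ low; first by lia.
  exact: c0.
case: k kn jm m_def => [|k] kn jm m_def; first by lia.
have [|phi phiE low] := @free_reduce k psi psiE; first by lia.
have [|_ drow] := @free_block k 3 phi phiE _ low; first by lia.
apply: four_mul_eq0; rewrite -(q_comb c jm) m_def.
have E p : ev (crd phi k) (t_row 0 p) =
    \sum_(j < ncls n.+1 k.+1) c k.+1 j * zvec (cls 0) j p.
  rewrite -m_def -crd_combn // -phiE bc_crd_d kn m_def.
  by rewrite ev_nil add0r.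
by rewrite -(eq_ev _ E) -ev_bind (ev_equiv _ (q_t0 j)) ev_bind ev_eq0.
Qed.
End Freeness.

Lemma comb_classes n c : comb n c = \sum_(p <- classes n) c p.1 p.2 *: Z n p.1 p.2.
Proof.
rewrite /classes big_allpairs_dep /comb -(big_mkord xpredT (fun k =>
  \sum_(j < ncls n k) c k j *: Z n k j)) /index_iota subn0.
apply: eq_bigr => k _.
by rewrite -(big_mkord xpredT (fun j => c k j *: Z n k j)) /index_iota subn0.
Qed.

Definition class_vec n (i : 'I_(size (classes n))) : C n :=
  let p := nth (0, 0)%N (classes n) i in Z n p.1 p.2.

Lemma class_sum n (c : nat -> nat -> K) : comb n c =
  \sum_(i < size (classes n))
    (let p := nth (0, 0)%N (classes n) i in c p.1 p.2) *: class_vec i.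
Proof. by rewrite comb_classes (big_nth (0, 0)%N) big_mkord. Qed.

Lemma class_vec_cocycle n i : d n (@class_vec n i) = 0.
Proof.
have := mem_nth (0, 0)%N (ltn_ord i); rewrite /class_vec.
by case: nth => k j; rewrite mem_classes => /andP[kn jm]; apply: Z_cocycle.
Qed.

Lemma class_vec_span n (f : C n.+1) : d n.+1 f = 0 ->
  exists c : 'I_(size (classes n.+1)) -> K, exists psi,
    d n psi = f - \sum_i c i *: class_vec i.
Proof.
move=> /spanning[c [psi ->]]; rewrite class_sum.
exists (fun i : 'I_(size (classes n.+1)) =>
  let p := nth (0, 0)%N (classes n.+1) i in c p.1 p.2), psi.
by rewrite [_ + d n psi]addrC addrK.
Qed.

Lemma class_vec_free n (c : 'I_(size (classes n.+1)) -> K) psi :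
  d n psi = \sum_i c i *: class_vec i -> forall i, c i = 0.
Proof.
pose c' k j := if insub (index (k, j) (classes n.+1)) is
  Some i then c (i : 'I_(size (classes n.+1))) else 0.
have cE (i : 'I_(size (classes n.+1))) :
    (let p := nth (0, 0)%N (classes n.+1) i in c' p.1 p.2) = c i.
  rewrite /c' -surjective_pairing index_uniq ?classes_uniq //.
  by rewrite insubT //= => ii; congr c; apply: val_inj.
move=> psiE i; rewrite -cE.
have := mem_nth (0, 0)%N (ltn_ord i); case nE: nth => [k j].
rewrite mem_classes => /andP[kn jm] /=.
apply: (freeness (psi := psi)) kn jm.
by rewrite psiE class_sum; apply: eq_bigr => i' _; rewrite cE.
Qed.

End Cohomology.

(** * Dimensions *)

Lemma resolution_cohom_basis (K : fieldType) (A : kalg K) (M : monomial_basis A)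
    (E : env_structure A) (V : free_module (es_alg E) (nat * sym)%type) n :
  2%N \notin [pchar K] ->
  cohom_basis (P := resolution M V)
    (fun i => @class_vec K (hom_complex M V) n.+1 i : homspace _ (es_mod E)).
Proof.
move=> charK; split.
- exact: (@class_vec_cocycle K (hom_complex M V)).
- exact: (@class_vec_span K (hom_complex M V) charK n).
- move=> c [psi psiE]; exact: (@class_vec_free K (hom_complex M V) charK n c psi psiE).
Qed.

(** The dimension is computed on the resolution by blocks and transported to P by
the comparison maps. *)
Lemma ext_dim (K : fieldType) (A : kalg K) (M : monomial_basis A)
    (E : env_structure A) (P : projective_resolution (es_mod E)) k i :
  2%N \notin [pchar K] -> (i < 4)%N -> (0 < 4 * k + i)%N ->
  dim_eq (Ext (es_mod E) P (4 * k + i)) (2 * k + n_class i).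
Proof.
move=> charK i4; rewrite -(size_classes k i4).
case: (4 * k + i)%N => // n _.
pose V := freemod_free (es_alg E) (nat * sym)%type.
have F := chain_map_exists P (resolution M V).
have G := chain_map_exists (resolution M V) P.
have := cohom_basis_dim (cohom_basis_pull F G (resolution_cohom_basis M V n charK)).
by rewrite card_ord.
Qed.

(** * The center *)

Section CenterBasis.
Variables (K : fieldType) (A : kalg K) (M : monomial_basis A).
Local Notation mb := (mb M).

Definition center_elt (i : nat) : A :=
  nth 0 [:: mb e1 + mb e2; mb ep; mb ab + mb ba; mb aa; mb bb] i.

(** Each of the five central elements contains one monomial that occurs in none of
the others. *)
Definition center_pivot (i : nat) : bas := nth e1 [:: e1; ep; ab; aa; bb] i.

Lemma center_pivotE (i j : 'I_5) :
  crd M (center_pivot i) (center_elt j) = (i == j)%:R.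
Proof.
by case: i => -[|[|[|[|[|i]]]]] //= ?; case: j => -[|[|[|[|[|j]]]]] //= ?;
  rewrite /center_elt /center_pivot /= ?linearD /= !crd_mb ?addr0.
Qed.

Lemma center_elt_central i : central (center_elt i).
Proof.
have cM w : (forall x, w * mb x = mb x * w) -> central w.
  move=> wC a; rewrite [a](mb_span M) mulr_sumr mulr_suml.
  by apply: eq_bigr => x _; rewrite -kscalerAl -kscalerAr wC.
apply: cM => x; rewrite /center_elt; case: i => [|[|[|[|[|i]]]]] /=;
  rewrite ?nth_nil ?mul0r ?mulr0 ?mulrDl ?mulrDr ?mbM //;
  by case: x => /=; rewrite ?addr0 ?add0r.
Qed.

Lemma central_crd w b (x y : bas) : central w -> mb x * mb y = 0 ->
  ev (fun z => crd M z w : K^o) [seq ((1 : int), z) | z <- all_bas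
    & omul (omul (Some x) (Some z)) (Some y) == Some b] = 0.
Proof. by move=> wC xy; rewrite -crd_sandwich -wC -mulrA xy mulr0 linear0. Qed.

(** Commuting with the idempotents removes the monomials between different
vertices, and commuting with α identifies the coefficients of e_1 and e_2 and
those of αβ and βα. *)
Lemma central_expand w : central w -> w = \sum_(i < 5)
  crd M (center_pivot i) w *: center_elt i.
Proof.
move=> wC.
have v12 : mb e1 * mb e2 = 0 by rewrite mbM.
have v21 : mb e2 * mb e1 = 0 by rewrite mbM.
have al0 : crd M al w = 0.
  by have := central_crd al wC v12; rewrite /ev big_seq1 mulr1z.
have aba0 : crd M aba w = 0.
  by have := central_crd aba wC v12; rewrite /ev big_seq1 mulr1z.
have be0 : crd M be w = 0.
  by have := central_crd be wC v21; rewrite /ev big_seq1 mulr1z.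
have bab0 : crd M bab w = 0.
  by have := central_crd bab wC v21; rewrite /ev big_seq1 mulr1z.
have alC : mb al * w * mb e2 = mb e1 * w * mb al.
  by rewrite -!wC -!mulrA !mbM.
have E12 : crd M e2 w = crd M e1 w.
  pose F z : K^o := crd M z w.
  exact: (etrans (esym (ev1 F e2)) (etrans (etrans (esym (crd_sandwich M al al e2 w))
    (etrans (congr1 (crd M al) alC) (crd_sandwich M al e1 al w))) (ev1 F e1))).
have Eab : crd M ba w = crd M ab w.
  pose F z : K^o := crd M z w.
  exact: (etrans (esym (ev1 F ba)) (etrans (etrans (esym (crd_sandwich M aba al e2 w))
    (etrans (congr1 (crd M aba) alC) (crd_sandwich M aba e1 al w))) (ev1 F ab))).
rewrite {1}[w](mb_span M) big_bas !big_ord_recl big_ord0 !big_cons big_nil.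
rewrite /center_elt /= al0 aba0 be0 bab0 E12 Eab !scalerDr !scale0r !add0r !addr0.
by rewrite -!addrA.
Qed.

Definition center_vec (i : 'I_5) : submod (center A) :=
  @to_submod _ _ (center A) _ (center_elt_central i).

Lemma center_basis : is_basis center_vec.
Proof.
move=> v.
have sumE (c : {ffun 'I_5 -> K}) :
    val (\sum_i c i *: center_vec i) = \sum_i c i *: center_elt i.
  by rewrite linear_sum; apply: eq_bigr => i _; rewrite linearZ.
exists [ffun i : 'I_5 => crd M (center_pivot i) (val v)]; split=> [|c cE].
  apply: val_inj; rewrite sumE [LHS](central_expand (submodP v)).
  by apply: eq_bigr => i _; rewrite ffunE.
have vE := congr1 val cE; rewrite sumE in vE.
apply/ffunP => i; rewrite ffunE vE linear_sum (bigD1 i) //= big1 => [|j ji].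
  by rewrite addr0 linearZ /= center_pivotE eqxx -[_ *: _]/(_ * _) mulr1.
by rewrite linearZ /= center_pivotE eq_sym (negbTE ji) scaler0.
Qed.
End CenterBasis.

(** * Degree zero *)

Section DegreeZero.
Variables (K : fieldType) (A : kalg K) (P : projective_resolution (bimod A)).

Lemma bimod_ten (a b : A) (x : bimod A) :
  ten a b *: x = (b * (x : A) * a : A) :> bimod A.
Proof. exact: bimodE. Qed.

Lemma bimod_scale (c : K) (x : bimod A) :
  (c *: (1 : enveloping A)) *: x = (c *: (x : A) : A) :> bimod A.
Proof.
have -> : c *: (1 : enveloping A) = ten (c *: (1 : A)) (1 : A) by rewrite tenZl ten11.
by rewrite bimod_ten mul1r -kscalerAr mulr1.
Qed.

Lemma center_HH0_linear : linear (center_HH0 P).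
Proof.
move=> c z w; rewrite /center_HH0 -linearP; congr (quot_proj _ _).
apply: val_inj; apply: hom_ext => x.
pose y : A := pr_aug P x.
have E (u : A) : (c *: (1 : enveloping A)) *: (y * u : bimod A) =
    (y * (c *: u) : A) :> bimod A.
  by rewrite bimod_scale kscalerAr.
exact: (etrans (mulrDr y (c *: val z) (val w))
  (f_equal2 (fun s t : bimod A => s + t) (esym (E (val z))) (erefl _))).
Qed.

Lemma center_HH0_inj z w : center_HH0 P z = center_HH0 P w -> z = w.
Proof.
move=> /ext_class_eq /= zw; apply: val_inj.
have [y yE] := pr_aug_surj P (1 : A).
have : aug_mul z y = aug_mul w y.
  exact: (congr1 (fun f : homspace _ _ => (f : _ -> bimod A) y) (subr0_eq zw)).
rewrite /aug_mul yE => E.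
exact: (etrans (esym (mul1r (val z))) (etrans E (mul1r (val w)))).
Qed.

(** A cocycle of degree 0 factors through the augmentation P_0 -> A. Its value at a
lift of 1 determines it and is central. *)
Lemma center_HH0_surj v : exists z, center_HH0 P z = v.
Proof.
have [f <-] := quot_proj_surj v; pose h : {linear pr_mod P 0 -> bimod A} := val f.
have hd x : h (pr_d P 0 x) = 0.
  exact: (congr1 (fun f : homspace _ _ => (f : _ -> bimod A) x) (submodP f)).
have haug x y : pr_aug P x = pr_aug P y -> h x = h y.
  move=> xy; have : pr_aug P (x - y) = 0 by rewrite linearB xy subrr.
  by case/pr_exact0 => u uE; apply: subr0_eq; rewrite -linearB -uE hd.
have [y yE] := pr_aug_surj P (1 : A).
pose z : A := h y.
have hE x : h x = (pr_aug P x : A) * z.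
  have -> : h x = h (ten 1 (pr_aug P x : A) *: y).
    by apply: haug; rewrite linearZ /= yE bimod_ten !mulr1.
  by rewrite linearZ /= bimod_ten mulr1.
have zC : central z.
  move=> a; have : h (ten a 1 *: y) = h (ten 1 a *: y).
    by apply: haug; rewrite !linearZ /= yE !bimod_ten !mulr1 mul1r.
  by rewrite !linearZ /= !bimod_ten mulr1 mul1r.
exists (to_submod (zC : center A z)); congr (quot_proj _ _).
by apply: val_inj; apply: hom_ext => x; rewrite [RHS]hE.
Qed.

Lemma center_HH0_basis n (z : 'I_n -> submod (center A)) :
  is_basis z -> is_basis (fun i => center_HH0 P (z i)).
Proof.
move=> zB v; have [w <-] := center_HH0_surj v.
pose phi : {linear submod (center A) -> HH P 0} :=
  HB.pack (center_HH0 P) (GRing.isLinear.Build K (submod (center A)) (HH P 0)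
    *:%R (center_HH0 P) center_HH0_linear).
have sumE (c : {ffun 'I_n -> K}) :
    \sum_i c i *: center_HH0 P (z i) = center_HH0 P (\sum_i c i *: z i).
  rewrite -[RHS]/(phi _) linear_sum; apply: eq_bigr => i _.
  by rewrite linearZ.
have [c [cE cU]] := zB w; exists c; split; first by rewrite sumE -cE.
by move=> c'; rewrite sumE => /center_HH0_inj; apply: cU.
Qed.

End DegreeZero.

Theorem theorem3p2 (K : fieldType) (charK : 2%N \notin [pchar K])
    (P : projective_resolution (bimod (algA K))) :
  (forall k : nat,
    [/\ (0 < k)%N -> dim_eq (HH P (4 * k)%N) (2 * k + 3)%N,
        dim_eq (HH P (4 * k + 1)%N) (2 * k + 3)%N,
        dim_eq (HH P (4 * k + 2)%N) (2 * k + 3)%N &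
        dim_eq (HH P (4 * k + 3)%N) (2 * k + 4)%N]) /\
  (exists z : 'I_5 -> submod (center (algA K)),
    [/\ forall i, val (z i) =
          nth 0 [:: A_e1 K + A_e2 K;
                    A_eps K;
                    A_alpha K * A_beta K + A_beta K * A_alpha K;
                    A_eps K ^+ 2;
                    A_beta K * A_alpha K * A_beta K * A_alpha K] i,
        is_basis z &
        is_basis (fun i => center_HH0 P (z i))]).
Proof.
pose M := A_basis K; pose E := enveloping_structure (algA K).
have dims k i : (i < 4)%N -> (0 < 4 * k + i)%N ->
    dim_eq (HH P (4 * k + i)) (2 * k + n_class i).
  by move=> i4; apply: (@ext_dim K (algA K) M E P k i charK i4).
split=> [k|].
  split; last by apply: dims; lia.
  - by move=> k0; have := dims k 0%N isT; rewrite addn0; apply; lia.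
  - by apply: dims; lia.
  - by apply: dims; lia.
exists (center_vec M); split; [|exact: center_basis|exact/center_HH0_basis/center_basis].
case=> -[|[|[|[|[|i]]]]] i5; last by exfalso; move: i5; rewrite ltnNge.
- exact: (erefl (A_mon K e1 + A_mon K e2)).
- exact: (erefl (A_mon K ep)).
- exact: (erefl (A_mon K ab + A_mon K ba)).
- exact: (esym (A_monM K ep ep)).
- exact: (erefl (A_mon K bb)).
Qed.
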